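(* Let $K$ be a local field of equal characteristic with ring of integers $\mathcal O$, residue field $\mathbb F_q$ and uniformizer $\pi$, and let $\lambda\in\overline{\mathbb Q}_\ell^*$. The unique $\mathrm{Iw}$-invariant function $W_\lambda$ in the Whittaker model of the twisted Steinberg representation $\mathrm{St}_\lambda$ of $\mathrm{GL}_n(K)$, normalized by $W_\lambda(1)=1$, is given, for $\underline d=(d_1,\dots,d_n)\in\mathbb Z^n$ and $\sigma\in S_n$, by $$W_\lambda(\mathrm{diag}(\underline d)\cdot\sigma)=\begin{cases}\dfrac{\mathrm{sign}(\sigma)\,\lambda^{\sum_i d_i}}{q^{\sum_{i<j}(d_i-d_j)}\ \mathrm{vol}(\mathrm{Iw}\,\sigma\,\mathrm{Iw})}&\text{if } d_i\ge d_{i+1}-\delta_{\sigma^{-1}(i)>\sigma^{-1}(i+1)}\text{ for all }1\le i\le n-1,\\[2ex] 0&\text{otherwise,}\end{cases}$$ where $\delta_{\sigma^{-1}(i)>\sigma^{-1}(i+1)}=1$ if $\sigma^{-1}(i)>\sigma^{-1}(i+1)$ and $0$ otherwise, and the volume is normalized by $\mathrm{vol}(\mathrm{Iw})=1$.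
   Context: $\mathrm{diag}(\underline d)$ is the diagonal matrix with entries $\pi^{d_1},\dots,\pi^{d_n}$, and $\sigma$ also denotes the permutation matrix $\sigma(e_i)=e_{\sigma(i)}$. $\mathrm{Iw}\subset\mathrm{GL}_n(\mathcal O)$ is the subgroup of matrices that are upper triangular modulo $\pi$. $\mathrm B_n$ is the group of upper triangular and $\mathrm N_n$ that of unipotent upper triangular matrices. $\mathcal C^\infty(\mathrm{GL}_n(K))$ is the space of $\overline{\mathbb Q}_\ell$-valued functions that are right invariant under some compact open subgroup. Let $\delta_\lambda:\mathrm B_n(K)\to\overline{\mathbb Q}_\ell^*$ be the character depending only on the valuations $d_i$ of the diagonal entries, $\delta_\lambda=\lambda^{\sum_i d_i}\prod_{i<j}q^{-(d_i-d_j)}$. $\mathrm{St}_\lambda$ is the unique irreducible subrepresentation of the (unnormalized) induced representation $\{f\in\mathcal C^\infty(\mathrm{GL}_n(K)) : f(bg)=\delta_\lambda(b)f(g)\ \forall b\in \mathrm B_n(K)\}$, with $\mathrm{GL}_n(K)$ acting by right translation. It has, up to scalar, a unique nonzero $\mathrm{Iw}$-invariant vector. Let $\psi:\mathbb F_q\to\overline{\mathbb Q}_\ell^*$ be a nontrivial additive character and $\Psi:\mathrm N_n(K)\to\overline{\mathbb Q}_\ell^*$, $\Psi(u)=\psi\big(\mathrm{Res}(\sum_{i=1}^{n-1}u_{i,i+1}\,\omega)\big)$, where $\omega$ is a generator of the module of (continuous) differentials of $\mathcal O$ (e.g. $\omega=d\pi$); so the induced character on each $u_{i,i+1}$ is trivial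 on $\mathcal O$ and nontrivial on $\pi^{-1}\mathcal O$. The Whittaker model of $\mathrm{St}_\lambda$ is the subrepresentation isomorphic to $\mathrm{St}_\lambda$ of the space $\{f\in\mathcal C^\infty(\mathrm{GL}_n(K)):f(ug)=\Psi(u)f(g)\ \forall u\in\mathrm N_n(K)\}$. *)

(* Defs.v *)
From HB Require Import structures.
From mathcomp Require Import all_boot all_order all_fingroup all_algebra.
From mathcomp Require Import all_classical all_reals all_analysis.

Set Implicit Arguments.
Unset Strict Implicit.
Unset Printing Implicit Defensive.
Import Order.TTheory GRing.Theory Num.Theory.
Local Open Scope classical_set_scope.
Local Open Scope ring_scope.

(* [vge v m x] is "v(x) >= m", with v(0) = +oo; a valuation is represented by
   an int-valued function whose value at 0 is irrelevant. *)
Definition vge (F : fieldType) (v : F -> int) (m : int) (x : F) : Prop :=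
  x = 0 \/ (m <= v x)%R.

(* A local field of equal characteristic: a field complete for a normalized
   discrete valuation, with finite residue field of the same characteristic.
   The residue field is presented by a reduction map, of which only the values
   on the ring of integers matter. *)
Record localField := LocalField {
  lf_field :> fieldType;
  residue : finFieldType;
  lf_val : lf_field -> int;
  red : lf_field -> residue;
  lf_valM : forall x y, x != 0 -> y != 0 -> lf_val (x * y) = lf_val x + lf_val y;
  lf_valD : forall m x y, vge lf_val m x -> vge lf_val m y -> vge lf_val m (x + y);
  lf_val_onto : exists2 x, x != 0 & lf_val x = 1;
  lf_complete : forall u : nat -> lf_field,
    (forall m, exists N, forall i j, (N <= i)%N -> (N <= j)%N ->
      vge lf_val m (u i - u j)) ->
    exists l, forall m, exists N, forall i, (N <= i)%N -> vge lf_val m (u i - l);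
  red1 : red 1 = 1;
  redD : forall x y, vge lf_val 0 x -> vge lf_val 0 y -> red (x + y) = red x + red y;
  redM : forall x y, vge lf_val 0 x -> vge lf_val 0 y -> red (x * y) = red x * red y;
  red_eq0 : forall x, vge lf_val 0 x -> (red x = 0 <-> vge lf_val 1 x);
  red_onto : forall a, exists2 x, vge lf_val 0 x & red x = a;
  equal_char : [pchar lf_field] =i [pchar residue]
}.

Definition integer (K : localField) (x : K) : Prop := vge (@lf_val K) 0 x.
Definition uniformizer (K : localField) (x : K) : Prop := x != 0 /\ lf_val x = 1.
Definition integer_unit (K : localField) (x : K) : Prop := x != 0 /\ lf_val x = 0.

(* The differentials of O form the free O-module on d(pi), so a generator is
   w d(pi) with w in O^*.  [Res pi w x] is the residue of x w d(pi), i.e. the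
   coefficient of pi^-1 in the pi-adic expansion of x w with coefficients in
   the copy {c | c^q = c} of F_q inside K. *)
Definition Res (K : localField) (pi w x : K) : residue K :=
  xget 0 [set a | exists (m : nat) (c : nat -> K),
    [/\ forall i, c i ^+ #|residue K| = c i,
        integer (x * w - \sum_(i < m.+1) c i * pi ^- i.+1) &
        a = red (c 0%N)]].

Section GeneralLinear.
Variables (K : localField) (n : nat).

Record GL := MkGL { gl_mx :> 'M[K]_n; gl_unit : gl_mx \in unitmx }.
HB.instance Definition _ := [isSub for gl_mx].
HB.instance Definition _ := [Choice of GL by <:].

Definition gl1 : GL := MkGL (unitmx1 K n).
Lemma glM_unit (g h : GL) : gl_mx g *m gl_mx h \in unitmx.
Proof. by rewrite unitmx_mul !gl_unit. Qed.
Definition glM (g h : GL) : GL := MkGL (glM_unit g h).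
Lemma glV_unit (g : GL) : invmx (gl_mx g) \in unitmx.
Proof. by rewrite unitmx_inv gl_unit. Qed.
Definition glV (g : GL) : GL := MkGL (glV_unit g).

Lemma glA : associative glM.
Proof. by move=> x y z; apply: val_inj; rewrite /= mulmxA. Qed.
Lemma gl1g : left_id gl1 glM.
Proof. by move=> x; apply: val_inj; rewrite /= mul1mx. Qed.
Lemma glg1 : right_id gl1 glM.
Proof. by move=> x; apply: val_inj; rewrite /= mulmx1. Qed.
Lemma glVg : left_inverse gl1 glV glM.
Proof. by move=> x; apply: val_inj; rewrite /= mulVmx ?gl_unit. Qed.
Lemma glgV : right_inverse gl1 glV glM.
Proof. by move=> x; apply: val_inj; rewrite /= mulmxV ?gl_unit. Qed.
HB.instance Definition _ := isGroup.Build GL glA gl1g glg1 glVg glgV.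

(* The topology of GL_n(K) as a subspace of K^(n x n). *)
Definition gl_open (A : set GL) : Prop :=
  forall g, A g -> exists m : int, forall h : GL,
    (forall i j, vge (@lf_val K) m (h i j - g i j)) -> A h.

Lemma gl_openT : gl_open setT.
Proof. by move=> g _; exists 0. Qed.

Lemma vge_le (m m' : int) (x : K) :
  (m <= m')%R -> vge (@lf_val K) m' x -> vge (@lf_val K) m x.
Proof. by move=> le [->|h]; [left|right; apply: le_trans h]. Qed.

Lemma gl_openI : setI_closed gl_open.
Proof.
move=> A B oA oB g [/oA[m hm] /oB[m' hm']].
exists (Num.max m m') => h hh; split; [apply: hm|apply: hm'] => i j;
  by apply: vge_le (hh i j); rewrite le_max lexx ?orbT.
Qed.

Lemma gl_open_bigU (I : Type) (f : I -> set GL) :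
  (forall i, gl_open (f i)) -> gl_open (\bigcup_i f i).
Proof.
move=> of_ g [i _ /of_[m hm]]; exists m => h hh.
by exists i => //; apply: hm.
Qed.

HB.instance Definition _ :=
  isOpenTopological.Build GL gl_openT gl_openI gl_open_bigU.

Definition is_subgroup (U : set GL) : Prop :=
  U 1%g /\ forall g h, U g -> U h -> U (g * h^-1)%g.

Definition upper_triangular (b : GL) : Prop :=
  forall i j : 'I_n, (j < i)%N -> b i j = 0.

Definition unipotent (u : GL) : Prop :=
  upper_triangular u /\ forall i, u i i = 1.

Definition Iwahori : set GL := [set g : GL | [/\
  forall i j, integer (g i j),
  integer_unit (\det g) &
  forall i j : 'I_n, (j < i)%N -> vge (@lf_val K) 1 (g i j)]].

Definition Iwahori_double_coset (s : GL) : set GL :=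
  [set g | exists a b, [/\ Iwahori a, Iwahori b & g = (a * s * b)%g]].

Lemma diag_pi_unit (pi : K) (hpi : uniformizer pi) (d : 'I_n -> int) :
  diag_mx (\row_i (pi ^ d i)) \in unitmx.
Proof.
case: hpi => pi0 _; rewrite unitmxE det_diag unitfE.
by apply/prodf_neq0 => i _; rewrite mxE expfz_neq0.
Qed.
Definition diag_pi (pi : K) (hpi : uniformizer pi) (d : 'I_n -> int) : GL :=
  MkGL (diag_pi_unit hpi d).

(* The matrix of e_i |-> e_(s i) on column vectors, with (i, j) entry
   (i == s j); [perm_mx s] is the matrix for row vectors. *)
Lemma perm_gl_unit (s : 'S_n) : (perm_mx s)^T \in @unitmx K n.
Proof. by rewrite unitmx_tr unitmx_perm. Qed.
Definition perm_gl (s : 'S_n) : GL := MkGL (perm_gl_unit s).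

End GeneralLinear.

Section Representations.
Variables (K : localField) (n : nat) (C : fieldType).
Local Notation G := (GL K n).

Definition smooth (f : G -> C) : Prop :=
  exists U : set G, [/\ is_subgroup U, compact U, open U &
    forall g u, U u -> f (g * u)%g = f g].

Definition right_translate (h : G) (f : G -> C) : G -> C :=
  fun g => f (g * h)%g.

Definition subrepresentation (V S : set (G -> C)) : Prop :=
  [/\ S `<=` V,
      S (fun=> 0),
      forall a f1 f2, S f1 -> S f2 -> S (fun g => a * f1 g + f2 g) &
      forall h f, S f -> S (right_translate h f)].

Definition irreducible (S : set (G -> C)) : Prop :=
  (exists2 f, S f & exists g, f g <> 0) /\
  forall S', subrepresentation S S' -> S' = [set fun=> 0] \/ S' = S.

Definition rep_isomorphic (S V : set (G -> C)) : Prop :=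
  exists Phi : (G -> C) -> (G -> C),
    [/\ set_bij S V Phi,
        forall a f1 f2, S f1 -> S f2 ->
          Phi (fun g => a * f1 g + f2 g) = (fun g => a * Phi f1 g + Phi f2 g) &
        forall h f, S f -> Phi (right_translate h f) = right_translate h (Phi f)].

Definition res_card : C := #|residue K|%:R.

Definition delta (lambda : C) (b : G) : C :=
  lambda ^ (\sum_i lf_val (b i i)) *
  \prod_(p : 'I_n * 'I_n | (p.1 < p.2)%N)
    res_card ^ (- (lf_val (b p.1 p.1) - lf_val (b p.2 p.2))).

Definition induced_delta (lambda : C) : set (G -> C) := [set f |
  smooth f /\
  forall b g, upper_triangular b -> f (b * g)%g = delta lambda b * f g].

(* [induced_delta lambda] has only one irreducible subrepresentation, hence
   this characterizes St_lambda. *)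
Definition is_steinberg (lambda : C) (S : set (G -> C)) : Prop :=
  subrepresentation (induced_delta lambda) S /\ irreducible S.

Definition nontrivial_additive_character (psi : residue K -> C) : Prop :=
  [/\ psi 0 = 1, forall x y, psi (x + y) = psi x * psi y &
      exists x, psi x <> 1].

Definition Psi (psi : residue K -> C) (pi w : K) (u : G) : C :=
  psi (Res pi w (\sum_(p : 'I_n * 'I_n | p.2 == p.1.+1 :> nat) u p.1 p.2)).

Definition induced_Psi (psi : residue K -> C) (pi w : K) : set (G -> C) :=
  [set f | smooth f /\
    forall u g, unipotent u -> f (u * g)%g = Psi psi pi w u * f g].

(* By uniqueness of Whittaker models at most one [V] satisfies this. *)
Definition is_whittaker_model (psi : residue K -> C) (pi w : K)
    (S V : set (G -> C)) : Prop :=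
  subrepresentation (induced_Psi psi pi w) V /\ rep_isomorphic S V.

Definition Iwahori_invariant (f : G -> C) : Prop :=
  forall g k, Iwahori k -> f (g * k)%g = f g.

(* The C-valued Haar measure of GL_n(K), a finitely additive function on
   compact open sets; the values of [vol] on other sets are irrelevant. *)
Definition is_normalized_haar (vol : set G -> C) : Prop :=
  [/\ forall A B, compact A -> open A -> compact B -> open B ->
        A `&` B = set0 -> vol (A `|` B) = vol A + vol B,
      forall (g : G) (A : set G), compact A -> open A ->
        vol [set (g * a)%g | a in A] = vol A &
      vol (@Iwahori K n) = 1].

End Representations.

Definition in_support (n : nat) (d : 'I_n -> int) (s : 'S_n) : bool :=
  [forall i : 'I_n, forall j : 'I_n, (j == i.+1 :> nat) ==>
    (d j - ((s^-1)%g j < (s^-1)%g i)%N%:Z <= d i)%R].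

(* Main.v *)
Require Import Defs.
From HB Require Import structures.
From mathcomp Require Import all_boot all_order all_fingroup all_algebra.
From mathcomp Require Import all_classical all_reals all_analysis.
From mathcomp Require Import all_field zify ring.

(** The idea is to show that the Iwahori-fixed vectors of the Steinberg
    representation form a line on which the Iwahori-Hecke algebra acts by a
    character, and that this character determines both the values of the fixed
    vector in the induced representation and those of its image in the Whittaker
    model.  The two computations obey the same recursion, so that they agree on
    the support of the Whittaker function.

    The induced representation has one Iwahori-fixed vector for each cell
    B s Iw, by the Iwasawa decomposition [iwasawa].  Among them,
    [sign_vector], with value (-1)^s / q^l(s) at s, satisfies two equations: the
    sum over the q cosets in the double coset of a simple reflection is -1 times
    the vector ([sign_vector_refl]), and right translation by [rotation], which
    normalizes Iw, is multiplication by a scalar ([sign_vector_rot]).  These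
    operators generate all double cosets ([affine_ind]), so every double coset
    acts on it by a scalar ([sign_vector_eigen]).

    The line is found inside of an arbitrary irreducible subrepresentation S.
    Averaging a translate by a very dominant diagonal matrix gives a fixed
    vector that does not vanish at 1 ([fixed_vector]).  The Hecke operators of
    the fundamental coweights are triangular with respect to an order on the
    cells ([minuscule_triangular], from the valuations of the minors of the last
    rows).  For the coweight of a descent of s, the diagonal coefficient at s
    differs from the eigenvalue on [sign_vector] ([cell_eigenvalue_neq]), so that
    products of these operators, shifted by diagonal coefficients, project
    onto [sign_vector], which therefore lies in S ([sign_vector_in]).  Finally
    the vectors whose averages are multiples of [sign_vector] are a
    subrepresentation, hence all of S ([fixed_vector_unique], which rests on the
    affine Bruhat decomposition [affine_bruhat]).

    In the Whittaker model the image W of [sign_vector] satisfies the same two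
    equations.  At diag(pi^d) s outside of the support, the character Psi is
    nontrivial on a root subgroup of the stabilizer, which gives the value 0
    ([whittaker_zero]).  On the support, Psi is trivial on the cosets which occur
    in the equation of a simple reflection, which thus relates two values of W by
    the factor -1/q, as for [sign_vector] ([whittaker_step]).  The support is an
    intersection of half-spaces bounded by affine root hyperplanes, so it is
    stable under the steps that decrease the length, and W is determined by its
    value at 1 ([whittaker_formula]).  This value is not 0 because W is not.  The
    volume of Iw s Iw is the number q^l(s) of cosets that it contains, once Iw is
    known to be compact ([Iw_compact], [vol_double_coset]). *)

Set Implicit Arguments.
Unset Strict Implicit.
Unset Printing Implicit Defensive.
Import Order.TTheory GRing.Theory Num.Theory.
Local Open Scope ring_scope.

(** * Valuations *)

Section Valuation.
Variable K : localField.
Local Notation v := (@lf_val K).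
Local Notation vge := (vge v).
Implicit Types (x y : K) (m : int).

Lemma val1 : v 1 = 0.
Proof.
have := @lf_valM K 1 1 (oner_neq0 _) (oner_neq0 _); rewrite mulr1; lia.
Qed.

Lemma valN1 : v (-1) = 0.
Proof.
have n0 : (-1 : K) != 0 by rewrite oppr_eq0 oner_eq0.
have := @lf_valM K (-1) (-1) n0 n0; rewrite mulrNN mulr1 val1; lia.
Qed.

Lemma valN x : v (- x) = v x.
Proof.
have [->|x0] := eqVneq x 0; first by rewrite oppr0.
by rewrite -mulN1r lf_valM ?oppr_eq0 ?oner_eq0// valN1 add0r.
Qed.

Lemma valV x : x != 0 -> v x^-1 = - v x.
Proof.
move=> x0; have := @lf_valM K x x^-1 x0; rewrite invr_eq0 divff// val1.
by move=> /(_ x0); lia.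
Qed.

Lemma valX x k : x != 0 -> v (x ^+ k) = v x *+ k.
Proof.
move=> x0; elim: k => [|k IH]; first by rewrite expr0 val1.
by rewrite exprS lf_valM ?expf_neq0// IH mulrS.
Qed.

Lemma valXz x m : x != 0 -> v (x ^ m) = v x * m.
Proof.
move=> x0; case: m => k; first by rewrite -exprnP valX// -mulr_natr natz.
by rewrite NegzE -exprnN valV ?expf_neq0// valX// mulrN -mulr_natr natz.
Qed.

Lemma val_prod (I : Type) (r : seq I) (P : pred I) (f : I -> K) :
  (forall i, P i -> f i != 0) ->
  v (\prod_(i <- r | P i) f i) = \sum_(i <- r | P i) v (f i).
Proof.
move=> f0; suff : \prod_(i <- r | P i) f i != 0 /\
  v (\prod_(i <- r | P i) f i) = \sum_(i <- r | P i) v (f i) by case.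
elim/big_rec2: _ => [|i y1 y2 Pi [y0 <-]]; first by rewrite oner_neq0 val1.
by rewrite mulf_neq0 ?f0// lf_valM ?f0.
Qed.

Lemma vge0 m : vge m 0. Proof. by left. Qed.
Hint Resolve vge0 : core.

Lemma vge_neq0 m x : x != 0 -> vge m x <-> m <= v x.
Proof. by move=> x0; split=> [[e|//]|]; [rewrite e eqxx in x0|right]. Qed.

Lemma vgeM m m' x y : vge m x -> vge m' y -> vge (m + m') (x * y).
Proof.
have [->|x0] := eqVneq x 0; first by rewrite mul0r.
have [->|y0] := eqVneq y 0; first by rewrite mulr0.
by rewrite !vge_neq0 ?mulf_neq0// lf_valM//; lia.
Qed.

Lemma vgeMl m m' m'' x y : vge m x -> vge m' y -> m'' <= m + m' -> vge m'' (x * y).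
Proof. by move=> hx hy le; apply: vge_le le (vgeM hx hy). Qed.

Lemma vgeD m x y : vge m x -> vge m y -> vge m (x + y).
Proof. exact: lf_valD. Qed.

Lemma vgeN m x : vge m x -> vge m (- x).
Proof. by case=> [->|h]; [rewrite oppr0|right; rewrite valN]. Qed.

Lemma vgeB m x y : vge m x -> vge m y -> vge m (x - y).
Proof. by move=> hx hy; apply/vgeD/vgeN. Qed.

Lemma vge_sum m (I : Type) (r : seq I) (P : pred I) (f : I -> K) :
  (forall i, P i -> vge m (f i)) -> vge m (\sum_(i <- r | P i) f i).
Proof. by move=> h; elim/big_ind: _ => //; apply: vgeD. Qed.

Lemma vge1 : vge 0 1. Proof. by right; rewrite val1. Qed.
Hint Resolve vge1 : core.

Lemma vge_prod (I : Type) (r : seq I) (P : pred I) (f : I -> K) :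
  (forall i, P i -> vge 0 (f i)) -> vge 0 (\prod_(i <- r | P i) f i).
Proof.
by move=> h; elim/big_ind: _ => // x y hx hy; rewrite -[0]addr0; apply: vgeM.
Qed.

Lemma vge_prod1 (I : finType) (f : I -> K) i :
  (forall j, vge 0 (f j)) -> vge 1 (f i) -> vge 1 (\prod_j f j).
Proof.
move=> h hi; rewrite (bigD1 i)//=; rewrite -[1](addr0 1); apply: vgeM => //.
exact: vge_prod.
Qed.

Lemma vge_sign (b : bool) m x : vge m x -> vge m ((-1) ^+ b * x).
Proof. by case: b => h; rewrite ?mul1r// mulN1r; apply: vgeN. Qed.

Lemma unit_vge x : integer_unit x -> vge 0 x.
Proof. by case=> x0 vx; right; rewrite vx. Qed.

Lemma unit1 : integer_unit (1 : K). Proof. by split; rewrite ?oner_neq0 ?val1. Qed.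

Lemma unitM x y : integer_unit x -> integer_unit y -> integer_unit (x * y).
Proof. by case=> x0 vx [y0 vy]; split; rewrite ?mulf_neq0// lf_valM// vx vy. Qed.

Lemma unitMsign (b : bool) x : integer_unit x -> integer_unit ((-1) ^+ b * x).
Proof.
by case: b => // -[x0 vx]; rewrite ?mul1r// mulN1r; split; rewrite ?oppr_eq0 ?valN.
Qed.

Lemma unitV x : integer_unit x -> integer_unit x^-1.
Proof. by case=> x0 vx; split; rewrite ?invr_eq0// valV// vx. Qed.

Lemma unit_prod (I : Type) (r : seq I) (P : pred I) (f : I -> K) :
  (forall i, P i -> integer_unit (f i)) -> integer_unit (\prod_(i <- r | P i) f i).
Proof. by move=> h; elim/big_ind: _ => //; [exact: unit1|exact: unitM]. Qed.

Lemma unitP x : integer_unit x <-> vge 0 x /\ ~ vge 1 x.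
Proof.
split=> [[x0 vx]|[[->|h] n1]]; first by rewrite !vge_neq0// vx.
  by case: n1.
have x0 : x != 0 by apply/eqP => x0; apply: n1; left.
by split=> //; move: n1; rewrite vge_neq0//; lia.
Qed.

Lemma unitD x y : integer_unit x -> vge 1 (y - x) -> integer_unit y.
Proof.
move=> /unitP[hx nx] hy; apply/unitP; split.
  by rewrite -(subrK x y); apply: vgeD => //; apply: vge_le hy.
move=> y1; apply: nx; rewrite -(subKr y x); apply: vgeB => //.
Qed.

Lemma vge_div m x y : x != 0 -> vge (v x + m) y -> vge m (y / x).
Proof.
move=> x0 hy; have h : vge (- v x) x^-1 by right; rewrite valV.
by apply: (vgeMl hy h); lia.
Qed.

Lemma vgeMx m x y : x != 0 -> vge m (y * x) <-> vge (m - v x) y.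
Proof.
move=> x0; split=> h.
  rewrite -[y](mulfK x0); apply: vge_div => //; apply: vge_le h; lia.
have hx : vge (v x) x by right.
by apply: (vgeMl h hx); lia.
Qed.

(** Representatives of the residue field; 0 is represented by 0, so that the
    trivial coset is represented by the identity matrix below. *)
Definition digit (a : residue K) : K :=
  if a == 0 then 0 else xget 0 [set x | vge 0 x /\ red x = a]%classic.

Lemma red0 : @red K 0 = 0.
Proof. by apply/red_eq0. Qed.

Lemma digitP a : vge 0 (digit a) /\ red (digit a) = a.
Proof.
rewrite /digit; case: eqVneq => [->|_]; first by rewrite red0.
have [x hx rx] := red_onto a.
by case: xgetP => [y -> //|/(_ x)]; case; split.
Qed.

Lemma digit_int a : vge 0 (digit a). Proof. by case: (digitP a). Qed.
Lemma digitK a : red (digit a) = a. Proof. by case: (digitP a). Qed.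
Lemma digit0 : digit 0 = 0. Proof. by rewrite /digit eqxx. Qed.

Lemma redN x : vge 0 x -> red (- x) = - red x :> residue K.
Proof.
move=> hx; apply/eqP; rewrite -addr_eq0 -redD//; last exact: vgeN.
by rewrite addNr red0.
Qed.

Lemma red_eq x y : vge 0 x -> vge 0 y -> (red x = red y :> residue K) <-> vge 1 (x - y).
Proof.
move=> hx hy; rewrite -(red_eq0 (vgeB hx hy)) redD ?redN//; last exact: vgeN.
by split=> [->|/eqP]; rewrite ?subrr// subr_eq0 => /eqP.
Qed.

Lemma digit_unit a : a != 0 -> integer_unit (digit a).
Proof.
move=> a0; apply/unitP; split; first exact: digit_int.
by move=> /(red_eq0 (digit_int a)); rewrite digitK; apply/eqP.
Qed.

Lemma uniformizer_vge (pi : K) k : uniformizer pi -> vge k (pi ^ k).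
Proof. by case=> p0 vp; right; rewrite valXz// vp mul1r. Qed.

Lemma val_pi (pi : K) k : uniformizer pi -> v (pi ^ k) = k.
Proof. by case=> p0 vp; rewrite valXz// vp mul1r. Qed.

Lemma pi_neq0 (pi : K) k : uniformizer pi -> pi ^ k != 0.
Proof. by case=> p0 vp; rewrite expfz_neq0. Qed.

End Valuation.
#[global] Hint Resolve vge0 vge1 : core.
#[global] Hint Resolve digit_int : core.

(** * The Iwahori subgroup *)

Section Determinant.
Variable K : localField.
Local Notation vge := (vge (@lf_val K)).

Lemma det_integer n (A : 'M[K]_n) :
  (forall i j, vge 0 (A i j)) -> vge 0 (\det A).
Proof.
move=> hA; apply: vge_sum => s _; apply: vge_sign.
by apply: vge_prod => i _; apply: hA.
Qed.

Lemma det_max_ideal n (A : 'M[K]_n) :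
  (forall i j, vge 0 (A i j)) ->
  (forall s : 'S_n, exists i, vge 1 (A i (s i))) -> vge 1 (\det A).
Proof.
move=> hA hs; apply: vge_sum => s _; apply: vge_sign.
by have [i hi] := hs s; apply: (vge_prod1 (i := i)).
Qed.

(** Determinants are controlled modulo the maximal ideal by the Leibniz formula:
    it is enough to find, in all the terms but one, a factor which is small. *)
Lemma det_one_term n (A : 'M[K]_n) (s0 : 'S_n) :
  (forall i j, vge 0 (A i j)) ->
  (forall s : 'S_n, s != s0 -> exists i, vge 1 (A i (s i))) ->
  vge 1 (\det A - (-1) ^+ s0 * \prod_i A i (s0 i)).
Proof.
move=> hA hs; rewrite /determinant (bigD1 s0)//= addrAC subrr add0r.
apply: vge_sum => s ns; apply: vge_sign.
by have [i hi] := hs s ns; apply: (vge_prod1 (i := i)).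
Qed.

Lemma sum_perm (V : nmodType) n (s : 'S_n) (f : 'I_n -> V) :
  \sum_i f (s i) = \sum_i f i.
Proof. by rewrite [RHS](reindex_inj (@perm_inj _ s)). Qed.

Lemma perm_le_eq n (s t : 'S_n) : (forall i, (t i <= s i)%N) -> s = t.
Proof.
move=> le; have [_] := @leqif_sum 'I_n predT (fun i => t i == s i :> nat)
  (fun i => t i : nat) (fun i => s i : nat) (fun i _ => leqif_eq (le i)).
have -> : (\sum_(i < n) t i = \sum_(i < n) s i)%N.
  rewrite -(reindex_inj (P := predT) (F := fun i : 'I_n => i : nat) (@perm_inj _ t)).
  by rewrite (reindex_inj (@perm_inj _ s)).
rewrite eqxx => /esym/forallP h; apply/permP => i.
by apply/val_inj/esym/eqP; exact: h.
Qed.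

(** Hence each term of the Leibniz formula but the diagonal one contains an
    entry strictly below the diagonal. *)
Lemma perm_neq1_descent n (s : 'S_n) : s != 1%g -> exists i, (s i < i)%N.
Proof.
move=> ns; apply/existsP; apply: contraNT ns; rewrite negb_exists => /forallP h.
by apply/eqP/perm_le_eq => i; rewrite perm1 leqNgt.
Qed.

End Determinant.


Section Subgroup.
Variables (K : localField) (n : nat) (A : set (GL K n)).
Hypothesis gA : is_subgroup A.

Lemma sg1 : A 1%g. Proof. by case: gA. Qed.
Lemma sgV g : A g -> A (g^-1)%g.
Proof. by move=> Ag; rewrite -[(_^-1)%g]mul1g; apply: gA.2 => //; exact: sg1. Qed.
Lemma sgM g h : A g -> A h -> A (g * h)%g.
Proof. by move=> Ag Ah; rewrite -[h]invgK; apply: gA.2 => //; exact: sgV. Qed.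
End Subgroup.

Section Iwahori.
Variables (K : localField) (n : nat).
Local Notation vge := (vge (@lf_val K)).
Local Notation v := (@lf_val K).
Local Notation G := (GL K n).
Local Notation Iw := (@Iwahori K n).
Implicit Types (g h k : G) (M : 'M[K]_n).

Lemma glME g h i j : (g * h)%g i j = \sum_l g i l * h l j.
Proof. by rewrite /= mxE. Qed.

Lemma gl1E i j : (1%g : G) i j = (i == j)%:R.
Proof. by rewrite /= mxE. Qed.

Lemma glP g h : (forall i j, g i j = h i j) -> g = h.
Proof. by move=> e; apply/val_inj/matrixP. Qed.

(** A total function, so that matrix expressions do not contain proofs of
    invertibility. *)
Definition toGL (M : 'M[K]_n) : G := insubd (1%g : G) M.

Lemma toGLE M : M \in unitmx -> gl_mx (toGL M) = M.
Proof. by move=> u; rewrite /toGL -[LHS]/(val _) insubdK. Qed.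

(** The entrywise description of the conjugates of the Iwahori subgroup under
    monomial matrices. *)
Definition bounded (m : 'I_n -> 'I_n -> int) (M : 'M[K]_n) : Prop :=
  (forall i j, vge (m i j) (M i j)) /\ forall i, integer_unit (M i i).

Definition iw_height (i j : 'I_n) : int := ((j < i)%N : nat)%:Z.

Lemma bounded_int M : bounded iw_height M -> forall i j, vge 0 (M i j).
Proof. by case=> h _ i j; apply: vge_le (h i j); rewrite /iw_height. Qed.

Lemma bounded_low M (i j : 'I_n) : bounded iw_height M -> (j < i)%N -> vge 1 (M i j).
Proof. by case=> h _ ji; have := h i j; rewrite /iw_height ji. Qed.

Lemma det_upper_mod M :
  (forall i j, vge (iw_height i j) (M i j)) -> vge 1 (\det M - \prod_i M i i).
Proof.
move=> h.
have := @det_one_term K n M 1%g.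
rewrite odd_perm1 expr0 mul1r; under eq_bigr do rewrite perm1.
apply=> [i j|s /perm_neq1_descent[i si]]; first by apply: vge_le (h i j).
by exists i; have := h i (s i); rewrite /iw_height si.
Qed.

Lemma bounded_det M : bounded iw_height M -> integer_unit (\det M).
Proof.
case=> h u; apply: unitD (det_upper_mod h).
by apply: unit_prod => i _; apply: u.
Qed.

Lemma bounded_unitmx M : bounded iw_height M -> M \in unitmx.
Proof. by move=> /bounded_det[d0 _]; rewrite unitmxE unitfE. Qed.

(** Modulo the maximal ideal the determinant is the product of the diagonal
    entries, so it is a unit if and only if these are units. *)
Lemma IwP g : Iw g <-> bounded iw_height g.
Proof.
split=> [[gi gd gl]|b]; last first.
  by split; [exact: bounded_int|exact: bounded_det|move=> i j; exact: bounded_low].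
have h i j : vge (iw_height i j) (g i j).
  by rewrite /iw_height; case: ltnP => [/gl//|_]; exact: gi.
split=> // i; apply/unitP; split=> [|gi1]; first exact: gi.
have /unitP[_ np] : integer_unit (\prod_j g j j).
  by apply: (unitD gd); rewrite -opprB; apply: vgeN; apply: det_upper_mod.
by apply: np; apply: (vge_prod1 (i := i)) => // j; exact: gi.
Qed.

Lemma Iw_int g i j : Iw g -> vge 0 (g i j).
Proof. by move/IwP/bounded_int. Qed.

Lemma Iw_low g (i j : 'I_n) : Iw g -> (j < i)%N -> vge 1 (g i j).
Proof. by move/IwP; exact: bounded_low. Qed.

Lemma Iw_diag g i : Iw g -> integer_unit (g i i).
Proof. by move/IwP => []. Qed.

Lemma Iw_toGL M : bounded iw_height M -> gl_mx (toGL M) = M /\ Iw (toGL M).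
Proof.
move=> b; have e := toGLE (bounded_unitmx b).
by split=> //; apply/IwP; rewrite e.
Qed.

Lemma Iw1 : Iw 1%g.
Proof.
apply/IwP; split=> [i j|i]; rewrite gl1E /iw_height ?eqxx; last exact: unit1.
by case: eqVneq => [->|_]; rewrite ?ltnn//; exact: vge0.
Qed.

Lemma IwM g h : Iw g -> Iw h -> Iw (g * h)%g.
Proof.
move=> hg hh; split=> [i j||i j ji].
- rewrite glME; apply: vge_sum => l _; rewrite -[0]addr0.
  by apply: vgeM; apply: Iw_int.
- by rewrite /= det_mulmx; apply: unitM; [case: hg|case: hh].
rewrite glME; apply: vge_sum => l _; case: (ltnP l i) => li.
  by rewrite -[1](addr0 1); apply: vgeM; [exact: Iw_low|exact: Iw_int].
rewrite -[1](add0r 1); apply: vgeM; first exact: Iw_int.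
by apply: Iw_low => //; apply: leq_trans li.
Qed.

Lemma IwV_int g i j : Iw g -> vge 0 ((g^-1)%g i j).
Proof.
move=> hg; have -> : gl_mx g^-1%g = invmx g by [].
rewrite /invmx gl_unit !mxE -[0]addr0; apply: vgeM.
  by apply: unit_vge; apply: unitV; case: hg.
rewrite /cofactor -signr_odd; apply: vge_sign.
by apply: det_integer => a b; rewrite !mxE; apply: Iw_int.
Qed.

(** The entries of the inverse below the diagonal are small: solve g * g^-1 = 1
    from the last row upwards. *)
Lemma IwV g : Iw g -> Iw (g^-1)%g.
Proof.
move=> hg; have gd : integer_unit (\det g) by case: hg.
split=> [i j||i j]; first exact: IwV_int.
  by rewrite [gl_mx _](_ : _ = invmx g)// det_inv; apply: unitV.
move: {-1}(n - i)%N (erefl (n - i)%N) => k ek; elim/ltn_ind: k i ek => k IH i ek ji.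
have e : (g * g^-1)%g i j = 0.
  by rewrite mulgV gl1E; case: eqVneq ji => // ->; rewrite ltnn.
rewrite glME (bigD1 i)//= in e; have [u0 u1] := Iw_diag i hg.
have {}e := canRL (addrK _) e; rewrite add0r in e.
rewrite -[(g^-1)%g i j](mulKf u0) e -[1](add0r 1); apply: vgeM.
  by apply/unit_vge/unitV.
apply/vgeN/vge_sum => l li; case: (ltngtP l i) => [l_i|i_l|/val_inj eli].
- by rewrite -[1](addr0 1); apply: vgeM; [exact: Iw_low|exact: IwV_int].
- rewrite -[1](add0r 1); apply: vgeM; first exact: Iw_int.
  apply: (IH (n - l)%N) => //; last exact: ltn_trans i_l.
  by rewrite -ek; have := ltn_ord i; have := ltn_ord l; lia.
by rewrite eli eqxx in li.
Qed.

Lemma Iw_subgroup : is_subgroup Iw.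
Proof. by split; [exact: Iw1|move=> g h hg /IwV; exact: IwM]. Qed.

Lemma Iw_close g h : Iw g -> (forall i j, vge 1 (h i j - g i j)) -> Iw h.
Proof.
move=> /IwP[gi gd] hh; apply/IwP; split=> [i j|i]; last exact: unitD (hh i i).
rewrite -(subrK (g i j) (h i j)); apply: vgeD => //; apply: vge_le (hh i j).
by rewrite /iw_height; case: ltnP.
Qed.

(** A basis of neighbourhoods of 1 by subgroups of finite index in the Iwahori
    subgroup. *)
Definition congruence (m : nat) : set G :=
  [set g | Iw g /\ forall i j, vge m%:Z (g i j - (i == j)%:R)]%classic.

(** Multiplying by integral matrices preserves congruences. *)
Lemma Iw_mul_close g (x y : G) (m : int) :
  Iw g -> (forall i j, vge m (x i j - y i j)) ->
  forall i j, vge m ((g * x)%g i j - (g * y)%g i j).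
Proof.
move=> hg hxy i j; rewrite !glME -sumrB; apply: vge_sum => l _.
by rewrite -mulrBr -[m]add0r; apply: vgeM => //; apply: Iw_int.
Qed.

Lemma congruence_close m g h : Iw g -> Iw h ->
  (forall i j, vge m%:Z (h i j - g i j)) <-> congruence m (g^-1 * h)%g.
Proof.
move=> hg hh; split=> [e|[_ e] i j].
  split=> [|i j]; first by apply: IwM => //; apply: IwV.
  by have := Iw_mul_close (IwV hg) e i j; rewrite mulVg gl1E.
have := @Iw_mul_close g (g^-1 * h)%g 1%g m hg.
by rewrite mulKVg mulg1; apply => a b; rewrite gl1E.
Qed.

Lemma congruence_subgroup m : is_subgroup (congruence m).
Proof.
split=> [|g h cg ch]; first by split=> [|i j]; [exact: Iw1|rewrite gl1E subrr].
have [hg eg] := cg; have [hh eh] := ch.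
have {}eh i j : vge m%:Z ((h^-1)%g i j - (i == j)%:R).
  rewrite -gl1E -(mulVg h) -{1}[(h^-1)%g]mulg1; apply: Iw_mul_close; first exact: IwV.
  by move=> a b; rewrite gl1E -opprB; apply: vgeN.
split=> [|i j]; first by apply: IwM => //; apply: IwV.
rewrite -(subrKA ((g * 1)%g i j)); apply: vgeD; last by rewrite mulg1.
by apply: Iw_mul_close => // a b; rewrite gl1E.
Qed.

End Iwahori.

(** * The extended affine Weyl group *)

Section AffineWeyl.
Variable n : nat.
Implicit Types (d : 'I_n -> int) (s : 'S_n).

(** An element w = (d, s) of the extended affine Weyl group stands for the
    monomial matrix diag(pi^d) s, and [height d s a b] is the least valuation
    of the (a, b) entries of w Iw w^-1.  In terms of alcoves, the [height d s]
    record the position of the alcove of w with respect to the affine root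
    hyperplanes. *)
Definition height d s (a b : 'I_n) : int :=
  d a - d b + ((s^-1%g b < s^-1%g a)%N : nat)%:Z.

Definition rot_perm : 'S_n := perm (@ordS_inj n).

(** Right multiplication by the generator (rot_shift 0 1, rot_perm) of the
    stabilizer of the base alcove. *)
Definition rot_shift d s : 'I_n -> int :=
  fun a => d a - ((s^-1%g a == 0%N :> nat) : nat)%:Z.

Lemma permVM s t a : ((t * s)^-1)%g a = (t^-1)%g ((s^-1)%g a).
Proof. by rewrite invMg permM. Qed.

Lemma rotV a : rot_perm^-1%g a = ord_pred a.
Proof. by apply: (@perm_inj _ rot_perm); rewrite permKV permE ord_predK. Qed.

Lemma ord_predE (a : 'I_n) : ord_pred a = (if a == 0%N :> nat then n.-1 else a.-1) :> nat.
Proof.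
case: a => -[|a] /= la; first by rewrite add0n modn_small ?prednK// ltn_predL.
by rewrite modnDr modn_small// ltnW.
Qed.

(** The rotation normalizes the Iwahori subgroup. *)
Lemma height_rot d s : height (rot_shift d s) (rot_perm * s)%g = height d s.
Proof.
apply/funext => a; apply/funext => b; rewrite /height /rot_shift !permVM !rotV.
rewrite !ord_predE; move: (s^-1%g a) (s^-1%g b) => p q.
have := ltn_ord p; have := ltn_ord q.
case: (eqVneq (p : nat) 0%N) => ?; case: (eqVneq (q : nat) 0%N) => ? /=.
all: lia.
Qed.

Lemma height_sym d s a b : a != b -> height d s b a = 1 - height d s a b.
Proof.
move=> nab; rewrite /height.
have : s^-1%g a != s^-1%g b :> nat by rewrite (inj_eq val_inj) (inj_eq perm_inj).
lia.
Qed.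

(** A simple reflection crosses one hyperplane. *)
Lemma height_step d s (i j a b : 'I_n) : j = i.+1 :> nat ->
  height d (tperm i j * s)%g a b = height d s a b
    + (((a == s i) && (b == s j)) : nat)%:Z - (((a == s j) && (b == s i)) : nat)%:Z.
Proof.
move=> ij; rewrite /height !permVM tpermV.
have e c k : (c == s k) = (s^-1%g c == k).
  by rewrite -(inj_eq (@perm_inj _ s^-1%g)) permK.
rewrite !e; move: (s^-1%g a) (s^-1%g b) => p q; rewrite -!val_eqE/=.
have tE k : tperm i j k = (if (k : nat) == i then j else if (k : nat) == j then i else k) :> nat.
  rewrite !val_eqE; case: tpermP => [->|->|/eqP/negPf-> /eqP/negPf->//]; rewrite ?eqxx//.
  by case: eqVneq => [->|].
rewrite !tE; case: (eqVneq (p : nat) i) => ?; case: (eqVneq (q : nat) i) => ?;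
  case: (eqVneq (p : nat) j) => ?; case: (eqVneq (q : nat) j) => ?; lia.
Qed.

(** The number of affine hyperplanes between the alcove of w and the base
    alcove. *)
Definition len d s : nat := \sum_(p : 'I_n * 'I_n | (p.1 < p.2)%N) `|height d s p.1 p.2|%N.

(** The length decreases along a descent because only one affine hyperplane
    separates the two alcoves. *)
Lemma len_step d s (i j : 'I_n) : j = i.+1 :> nat ->
  height d s (s i) (s j) < iw_height (s i) (s j) ->
  len d s = (len d (tperm i j * s)%g).+1.
Proof.
move=> ij; rewrite /iw_height => lt.
have nij : s i != s j by rewrite (inj_eq perm_inj) -val_eqE/= ij neq_ltn ltnSn.
have vij : s i != s j :> nat by rewrite val_eqE.
pose p0 := if (s i < s j)%N then (s i, s j) else (s j, s i).
have p0P : (p0.1 < p0.2)%N by rewrite /p0; case: (ltngtP (s i) (s j)) => //= e; rewrite e eqxx in vij.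
rewrite /len (bigD1 p0)//= [in RHS](bigD1 p0)//= -addSn; congr addn; last first.
  apply: eq_bigr => -[a b] /= /andP[ab]; rewrite height_step// /p0.
  by case: ltnP => sij; rewrite xpair_eqE -!val_eqE/= => h; congr absz; lia.
rewrite height_step// /p0; have hs := height_sym d s nij.
by move: lt hs; case: (boolP (s i < s j)%N) => sij /=; rewrite ?eqxx -!val_eqE/= => lt hs; lia.
Qed.

Lemma len_rot d s : len (rot_shift d s) (rot_perm * s)%g = len d s.
Proof. by rewrite /len height_rot. Qed.

Lemma sum_rot_shift (hn : (0 < n)%N) d s : \sum_i rot_shift d s i = \sum_i d i - 1.
Proof.
rewrite /rot_shift big_split/=; congr (_ + _); rewrite sumrN; congr (- _).
rewrite -(sum_perm s) (bigD1 (Ordinal hn))//= permK eqxx big1 ?addr0// => i.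
by rewrite permK -val_eqE => /negPf/= ->.
Qed.

Lemma iw_heightE (a b : 'I_n) : height (fun=> 0) 1%g a b = iw_height a b.
Proof. by rewrite /height invg1 !perm1 subrr add0r. Qed.

Lemma len1 : len (fun=> 0) 1%g = 0%N.
Proof.
rewrite /len big1// => p lt; rewrite iw_heightE /iw_height.
by rewrite ltnNge (ltnW lt).
Qed.

(** An element without descents at the positions (i, i+1), nor at (n-1, n), is
    in the stabilizer of the base alcove. *)
Lemma no_descent d s :
  (forall i j : 'I_n, j = i.+1 :> nat ->
     iw_height (s i) (s j) <= height d s (s i) (s j)) ->
  (forall i j : 'I_n, i = n.-1 :> nat -> j = 0%N :> nat ->
     iw_height (s i) (s j) <= height d s (s i) (s j)) ->
  height d s = @iw_height n.
Proof.
rewrite /height => h1 h2.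
have incr (p q : 'I_n) : (p < q)%N -> iw_height (s p) (s q) <= d (s p) - d (s q).
  move: {-1}(q : nat) (erefl (q : nat)) => k; elim: k q => [|k IH] q eq; first by lia.
  move=> pq; have lk : (k < n)%N by have := ltn_ord q; lia.
  pose r := Ordinal lk; have := h1 r q; rewrite !permK -eq => /(_ erefl) /=.
  have [epk|npk] := eqVneq (p : nat) k.
    by have -> : r = p; [apply/val_inj; rewrite /= epk|lia].
  have := IH r erefl; have -> : (p < r)%N by rewrite /=; lia.
  by rewrite /iw_height => /(_ isT); move: (s p) (s q) (s r) => [a la] [b lb] [c lc]/=; lia.
have decr (p q : 'I_n) : (p < q)%N -> iw_height (s q) (s p) <= d (s q) - d (s p) + 1.
  move=> pq; have ln : (n.-1 < n)%N by have := ltn_ord q; lia.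
  have l0 : (0 < n)%N by lia.
  pose r := Ordinal ln; pose o := Ordinal l0; have := h2 r o erefl erefl.
  rewrite !permK/=; have -> : (0 < n.-1)%N by have := ltn_ord q; lia.
  have : iw_height (s q) (s r) <= d (s q) - d (s r).
    have [->|nqr] := eqVneq q r; first by rewrite /iw_height ltnn subrr.
    by apply: incr; move: nqr; rewrite -val_eqE/=; have := ltn_ord q; lia.
  have : iw_height (s o) (s p) <= d (s o) - d (s p).
    have [->|nqr] := eqVneq o p; first by rewrite /iw_height ltnn subrr.
    by apply: incr; move: nqr; rewrite -val_eqE/=; lia.
  by rewrite /iw_height; move: (s p) (s q) (s r) (s o) => [a la] [b lb] [c lc] [e le]/=; lia.
apply/funext => a; apply/funext => b.
rewrite -[a](permKV s) -[b](permKV s) !permK.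
move: (s^-1%g a) (s^-1%g b) => p q.
case: (ltngtP p q) => [pq|qp|/val_inj->]; last by rewrite /iw_height ltnn subrr.
  have := incr _ _ pq; have := decr _ _ pq; rewrite /iw_height.
  have : s p != s q :> nat by rewrite (inj_eq val_inj) (inj_eq perm_inj) -val_eqE/=; lia.
  by lia.
have := incr _ _ qp; have := decr _ _ qp; rewrite /iw_height.
have : s p != s q :> nat by rewrite (inj_eq val_inj) (inj_eq perm_inj) -val_eqE/=; lia.
by lia.
Qed.

(** The stabilizer of the base alcove is cyclic, generated by the rotation, and
    the sum of the d_i identifies its elements. *)
Lemma base_alcove d s : height d s = @iw_height n -> \sum_i d i = 0 ->
  d = (fun=> 0) /\ s = 1%g.
Proof.
move=> h sd.
have dz : d = (fun=> 0).
  apply/funext => a.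
  have le1 c : d c - d a <= 1 /\ d a - d c <= 1.
    have := congr1 (fun f => f c a) h; have := congr1 (fun f => f a c) h.
    by rewrite /height /iw_height; lia.
  case: (ltgtP (d a) 0) => // da.
    suff : \sum_i d i < 0 by rewrite sd ltxx.
    rewrite (bigD1 a)//= ltr_wnDr//; apply: sumr_le0 => i _; have := le1 i; lia.
  suff : \sum_i d i > 0 by rewrite sd ltxx.
  rewrite (bigD1 a)//= ltr_wpDr//; apply: sumr_ge0 => i _; have := le1 i; lia.
split=> //; have incr (a b : 'I_n) : (s^-1%g b < s^-1%g a)%N = (b < a)%N.
  by have := congr1 (fun f => f a b) h; rewrite /height /iw_height dz; lia.
have : s^-1%g = 1%g.
  apply: perm_le_eq => -[i li]; rewrite perm1 /=; elim: i li => [//|i IH] li.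
  have li' := ltn_trans (ltnSn i) li; apply: leq_ltn_trans (IH li') _.
  by rewrite incr.
by move/(congr1 (@invg _)); rewrite invgK invg1.
Qed.

(** The extended affine Weyl group is reached from 1 by rotations and by
    simple reflections increasing the length, since the affine simple reflection
    is conjugate to a finite one under the rotation.  The induction is on the
    length, then on |sum_i d_i|. *)
Lemma affine_ind (hn : (0 < n)%N) (P : ('I_n -> int) -> 'S_n -> Prop) :
  P (fun=> 0) 1%g ->
  (forall d s, P d s <-> P (rot_shift d s) (rot_perm * s)%g) ->
  (forall d s (i j : 'I_n), j = i.+1 :> nat ->
     height d s (s i) (s j) < iw_height (s i) (s j) ->
     P d (tperm i j * s)%g -> P d s) ->
  forall d s, P d s.
Proof.
move=> P1 Prot Pstep.
have Plen m : (forall d s, (len d s < m)%N -> P d s) ->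
    forall d s, len d s = m -> (exists i j : 'I_n, j = i.+1 :> nat /\
      height d s (s i) (s j) < iw_height (s i) (s j)) -> P d s.
  move=> IH d s lm [i [j [ij lt]]]; apply: (Pstep d s i j) => //; apply: IH.
  by rewrite -lm (len_step ij lt).
move=> d s; move: {-1}(len d s) (erefl (len d s)) => m.
elim/ltn_ind: m d s => m IHm d s lm.
have IH d' s' : (len d' s' < m)%N -> P d' s' by move=> /IHm; apply.
have [[i [j [ij lt]]]|nd] := pselect (exists i j : 'I_n, j = i.+1 :> nat /\
      height d s (s i) (s j) < iw_height (s i) (s j)).
  by apply: Plen lm _ => //; exists i, j.
have [[i [j [i0 [j0 lt]]]]|nd'] := pselect (exists i j : 'I_n,
      i = n.-1 :> nat /\ j = 0%N :> nat /\
      height d s (s i) (s j) < iw_height (s i) (s j)).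
  apply/Prot; apply: Plen; [exact: IH|by rewrite len_rot|].
  have n1 : (1 < n)%N.
    case: (ltngtP n 1) hn => // n1 _; have eij : i = j by apply/val_inj; rewrite /= i0 j0 n1.
    by move: lt; rewrite eij /height /iw_height subrr !ltnn ltxx.
  exists (ord_pred i), (ord_pred j); rewrite !permM -!rotV !permKV height_rot.
  by split=> //; rewrite !rotV !ord_predE i0 j0 /=; have := n1; case: ifP; lia.
have hb : height d s = @iw_height n.
  apply: no_descent => i j => [ij|i0 j0]; rewrite leNgt; apply/negP => lt.
    by apply: nd; exists i, j.
  by apply: nd'; exists i, j.
move: {-1}(absz (\sum_i d i)) (erefl (absz (\sum_i d i))) => k ek.
elim: k d s {lm nd nd'} hb ek => [|k IHk] d s hb ek.
  have s0 : \sum_i d i = 0 by apply/eqP; rewrite -absz_eq0 ek.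
  by have [-> ->] := base_alcove hb s0.
have [sd|sd] := leP 0 (\sum_i d i).
  by apply/Prot; apply: IHk; rewrite ?height_rot// sum_rot_shift//; lia.
pose s' := (rot_perm^-1 * s)%g.
pose d' a := d a + ((s'^-1%g a == 0%N :> nat) : nat)%:Z.
have ed : rot_shift d' s' = d by apply/funext => a; rewrite /rot_shift /d' addrK.
have es : (rot_perm * s')%g = s by rewrite /s' mulKVg.
have sd' := sum_rot_shift hn d' s'; rewrite ed in sd'.
rewrite -ed -es -Prot; apply: IHk; last by lia.
by rewrite -height_rot ed es.
Qed.

End AffineWeyl.

(** * Monomial matrices *)

Section Monomial.
Variables (K : localField) (pi : K) (hpi : uniformizer pi) (n : nat).
Local Notation v := (@lf_val K).
Local Notation vge := (vge v).
Local Notation G := (GL K n).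
Local Notation Iw := (@Iwahori K n).
Implicit Types (d e : 'I_n -> int) (s t : 'S_n) (g h : G).

Definition monomial d s : G := (diag_pi hpi d * perm_gl K s)%g.

Lemma perm_glE s i j : perm_gl K s i j = (i == s j)%:R.
Proof. by rewrite /= !mxE eq_sym. Qed.

Lemma perm_glM s t : (perm_gl K s * perm_gl K t)%g = perm_gl K (t * s)%g.
Proof. by apply/val_inj; rewrite /= perm_mxM trmx_mul. Qed.

Lemma perm_gl1 : perm_gl K 1%g = 1%g :> G.
Proof. by apply/val_inj; rewrite /= perm_mx1 trmx1. Qed.

Lemma diag_piE d i j : diag_pi hpi d i j = pi ^ d i * (i == j)%:R.
Proof. by rewrite /= !mxE; case: eqVneq => [->|]; rewrite ?mulr1n ?mulr1 ?mulr0. Qed.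

Lemma monomialE d s i j : monomial d s i j = pi ^ d i * (i == s j)%:R.
Proof.
rewrite glME (bigD1 i)//= -[LHS]/(_ + _) big1 ?addr0 => [|l li].
  by rewrite -[_ i i]/(diag_pi hpi d i i) -[_ i j]/(perm_gl K s i j)
    diag_piE perm_glE eqxx mulr1.
by rewrite -[_ i l]/(diag_pi hpi d i l) diag_piE eq_sym (negPf li) mulr0 mul0r.
Qed.

Lemma mul_monomial g d s i j : (g * monomial d s)%g i j = g i (s j) * pi ^ d (s j).
Proof.
rewrite glME (bigD1 (s j))//= big1 ?addr0 => [|l li]; rewrite -[X in _ * X]/(monomial d s _ _) monomialE.
  by rewrite eqxx mulr1.
by rewrite (negPf li) !mulr0.
Qed.

Lemma monomial_mul h d s i j : (monomial d s * h)%g i j = pi ^ d i * h (s^-1%g i) j.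
Proof.
rewrite glME (bigD1 (s^-1%g i))//= big1 ?addr0 => [|l li]; rewrite -[X in X * _]/(monomial d s _ _) monomialE.
  by rewrite permKV eqxx mulr1.
rewrite -[l](permK s) (inj_eq perm_inj) in li.
by rewrite eq_sym (negPf li) mulr0 mul0r.
Qed.

Lemma monomialM d s e t :
  (monomial d s * monomial e t)%g = monomial (fun i => d i + e (s^-1%g i)) (t * s)%g.
Proof.
apply/glP => i j; rewrite monomial_mul !monomialE permM.
rewrite -(inj_eq (@perm_inj _ s)) permKV mulrA -expfzDr//.
by case: hpi.
Qed.

Lemma monomial1 : monomial (fun=> 0) 1%g = 1%g.
Proof. by apply/glP => i j; rewrite monomialE gl1E perm1 mul1r. Qed.

Lemma monomial_perm d s t : (monomial d s * perm_gl K t)%g = monomial d (t * s)%g.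
Proof. by rewrite /monomial -mulgA perm_glM. Qed.

Lemma perm_monomial s : perm_gl K s = monomial (fun=> 0) s.
Proof. by apply/glP => i j; rewrite monomialE perm_glE mul1r. Qed.

Definition rotation : G := monomial (rot_shift (fun=> 0) 1%g) (rot_perm n).

Lemma monomial_rot d s :
  (monomial d s * rotation)%g = monomial (rot_shift d s) (rot_perm n * s)%g.
Proof.
rewrite /rotation monomialM; congr monomial; apply/funext => i.
by rewrite /rot_shift invg1 perm1 add0r.
Qed.

Lemma monomial_conjE g d s i j :
  ((monomial d s)^-1 * g * monomial d s)%g i j
  = pi ^ (d (s j) - d (s i)) * g (s i) (s j).
Proof.
set h := (_^-1 * _ * _)%g; have e : (monomial d s * h)%g = (g * monomial d s)%g.
  by rewrite /h !mulgA mulgV mul1g.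
have := congr1 (fun x : G => x (s i) j) e; rewrite mul_monomial monomial_mul permK.
have p0 : pi != 0 by case: hpi.
move=> {}e; apply: (mulfI (expfz_neq0 (d (s i)) p0)).
by rewrite e mulrA -expfzDr// addrC subrK mulrC.
Qed.

Lemma monomial_conj_Iw g d s :
  Iw ((monomial d s)^-1 * g * monomial d s)%g <-> bounded (height d s) g.
Proof.
have vp k : v (pi ^ k) = k by exact: val_pi.
have p0 k : pi ^ k != 0 by exact: pi_neq0.
have hsh (m k : int) x : vge m (pi ^ k * x) <-> vge (m - k) x.
  by rewrite mulrC vgeMx// vp.
rewrite IwP; split=> -[h u].
  split=> [a b|a].
    have := h (s^-1%g a) (s^-1%g b); rewrite monomial_conjE !permKV hsh.
    by rewrite /height /iw_height opprB addrC.
  by have := u (s^-1%g a); rewrite monomial_conjE !permKV subrr mul1r.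
split=> [a b|a]; rewrite monomial_conjE; last by rewrite subrr mul1r.
by rewrite hsh opprB addrC; have := h (s a) (s b); rewrite /height !permK.
Qed.

Lemma rotation_conj_Iw g : Iw (rotation^-1 * g * rotation)%g <-> Iw g.
Proof.
rewrite monomial_conj_Iw IwP -[rot_perm n]mulg1 height_rot.
suff -> : height (fun=> 0) 1%g = @iw_height n by [].
by apply/funext => a; apply/funext => b; rewrite iw_heightE.
Qed.

Lemma elem_unit (i j : 'I_n) (x : K) : i != j -> 1%:M + x *: delta_mx i j \in unitmx.
Proof.
move=> ij; suff /mulmx1_unit[] : (1%:M + x *: delta_mx i j) *m
  (1%:M - x *: delta_mx i j) = 1%:M :> 'M[K]_n by [].
rewrite mulmxDl !mulmxBr !mul1mx mulmx1 -scalemxAl -scalemxAr.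
by rewrite mul_delta_mx_0 ?scaler0 ?subr0 ?subrK// eq_sym.
Qed.

Definition elem (i j : 'I_n) (x : K) : G := toGL (1%:M + x *: delta_mx i j).

Lemma elemE i j x : i != j ->
  forall a b, elem i j x a b = (a == b)%:R + x * ((a == i) && (b == j))%:R.
Proof. by move=> ij a b; rewrite /elem toGLE ?elem_unit// !mxE. Qed.

Lemma elem_mul i j x g : i != j ->
  forall a b, (elem i j x * g)%g a b = g a b + (a == i)%:R * (x * g j b).
Proof.
move=> ij a b.
have -> : gl_mx (elem i j x * g)%g = (1%:M + x *: delta_mx i j) *m g.
  by rewrite /= toGLE ?elem_unit.
rewrite mulmxDl mul1mx -scalemxAl mxE [X in _ + X]mxE; congr (_ + _).
rewrite mxE (bigD1 j)//= big1 => [|l lj]; last by rewrite mxE (negPf lj) andbF mul0r.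
by rewrite mxE eqxx andbT addr0; case: (a == i); rewrite ?mul1r// !mul0r mulr0.
Qed.

Lemma elem_Iw (i j : 'I_n) x : i != j -> vge (iw_height i j) x -> Iw (elem i j x).
Proof.
move=> ij hx; apply/IwP; split=> [a b|a]; rewrite elemE//.
  apply: vgeD; first by rewrite -gl1E; exact: ((IwP _).1 (@Iw1 K n)).1.
  have [/andP[/eqP-> /eqP->]|_] := boolP (_ && _); first by rewrite mulr1.
  by rewrite mulr0.
rewrite eqxx; have [/andP[/eqP e /eqP e']|_] := boolP (_ && _).
  by rewrite -e -e' eqxx in ij.
by rewrite mulr0 addr0; exact: unit1.
Qed.

Lemma monomial_conj_elem i j x d s : i != j ->
  (monomial d s * elem i j x)%g =
  (elem (s i) (s j) (pi ^ (d (s i) - d (s j)) * x) * monomial d s)%g.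
Proof.
move=> ij; have sij : s i != s j by rewrite (inj_eq perm_inj).
apply/glP => a b; rewrite mul_monomial monomial_mul !elemE//.
rewrite -(inj_eq (@perm_inj _ s)) permKV (inj_eq perm_inj).
have -> : (s^-1%g a == i) = (a == s i) by rewrite -(inj_eq (@perm_inj _ s)) permKV.
have p0 : pi != 0 by case: hpi.
rewrite mulrDr mulrDl; congr (_ + _).
  by case: eqVneq => [->|_]; rewrite ?mulr1 ?mul1r ?mulr0 ?mul0r.
have [/andP[/eqP-> /eqP->]|_] := boolP (_ && _); last by rewrite !mulr0 mul0r.
by rewrite !mulr1 mulrAC -expfzDr// subrK.
Qed.

End Monomial.

(** * Sums over finite coset spaces *)

Section CosetReps.
Variables (K : localField) (n : nat).
Local Notation G := (GL K n).
Implicit Types (H J : set G) (ys zs : seq G).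

(** Counting is more convenient than a unique existence statement: sums over
    two systems of representatives are compared by exchanging summations. *)
Definition coset_reps H J ys : Prop :=
  (forall y, y \in ys -> H y) /\
  forall h, H h -> count (fun y => `[< J (y^-1 * h)%g >]) ys = 1%N.

Lemma coset_sym J (x y : G) : is_subgroup J ->
  `[< J (x^-1 * y)%g >] = `[< J (y^-1 * x)%g >].
Proof.
move=> gJ; apply/asboolP/asboolP => /(sgV gJ); by rewrite invgM invgK.
Qed.

Lemma sum_coset_reps (V : nmodType) H J ys zs (f : G -> V) :
  is_subgroup J -> coset_reps H J ys -> coset_reps H J zs ->
  (forall g j, J j -> f (g * j)%g = f g) ->
  \sum_(y <- ys) f y = \sum_(z <- zs) f z.
Proof.
move=> gJ [Hy cy] [Hz cz] fJ.
have fE x : forall us, count (fun y => `[< J (y^-1 * x)%g >]) us = 1%N ->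
    f x = \sum_(u <- us | `[< J (u^-1 * x)%g >]) f u.
  move=> us c; rewrite (eq_bigr (fun=> f x)) => [|u /asboolP Ju].
    by rewrite big_const_seq c /= addr0.
  by rewrite -(fJ u _ Ju) mulVKg.
rewrite big_seq (eq_bigr (fun y => \sum_(z <- zs | `[< J (z^-1 * y)%g >]) f z)); last first.
  by move=> y yys; rewrite -fE//; apply/cz/Hy.
rewrite -big_seq (exchange_big_dep predT)//= [RHS]big_seq [LHS]big_seq.
apply: eq_bigr => z zzs; rewrite [RHS](fE z ys); last exact/cy/Hz.
under eq_bigl do rewrite coset_sym//.
apply: eq_bigr => y /asboolP Jy.
by have := fJ y _ Jy; rewrite mulVKg.
Qed.

Lemma coset_reps_mulr H J ys h : is_subgroup H -> coset_reps H J ys -> H h ->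
  coset_reps H J [seq (h * y)%g | y <- ys].
Proof.
move=> gH [Hy cy] Hh; split=> [_ /mapP[y /Hy Hy' ->]|k Hk]; first exact: sgM.
rewrite count_map -[RHS](cy (h^-1 * k)%g); last by apply: sgM => //; apply: sgV.
by apply: eq_count => y /=; rewrite invgM mulgA.
Qed.

Lemma sum_coset_reps_mulr (V : nmodType) H J ys (f : G -> V) x h :
  is_subgroup H -> is_subgroup J -> coset_reps H J ys ->
  (forall g j, J j -> f (g * j)%g = f g) -> H h ->
  \sum_(y <- ys) f (x * h * y)%g = \sum_(y <- ys) f (x * y)%g.
Proof.
move=> gH gJ ry fJ Hh; have := @sum_coset_reps V H J _ _ (fun y => f (x * y)%g) gJ
  (coset_reps_mulr gH ry Hh) ry.
rewrite big_map => e; rewrite -e => [|g j Jj]; last by rewrite mulgA; exact: (fJ (x * g)%g).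
by apply: eq_bigr => y _; rewrite mulgA.
Qed.

Lemma coset_reps_comp H J J' ys ts : is_subgroup H -> is_subgroup J ->
  (J' `<=` J)%classic -> (J `<=` H)%classic ->
  coset_reps H J ys -> coset_reps J J' ts ->
  coset_reps H J' [seq (y * t)%g | y <- ys, t <- ts].
Proof.
move=> gH gJ sJ sH [Hy cy] [Jt ct]; split=> [_ /allpairsP[[y t] /= [yy tt ->]]|h Hh].
  by apply: sgM => //; [exact: Hy|apply/sH/Jt].
rewrite -(cy h Hh) count_flatten -map_comp sumnE big_map -sum1_count [RHS]big_mkcond/=.
rewrite [LHS]big_seq [RHS]big_seq; apply: eq_bigr => y yys; rewrite count_map.
have e t : preim (fun t => y * t)%g (fun y0 : G => `[< J' (y0^-1 * h)%g >]) t =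
    `[< J' (t^-1 * (y^-1 * h))%g >] by rewrite /= invgM mulgA.
rewrite (eq_count e); case: asboolP => [/ct //|nJ].
apply/eqP; rewrite -leqn0 leqNgt -has_count; apply/hasPn => t tts.
apply/asboolPn => /sJ Jt'; apply: nJ; have := sgM gJ (Jt _ tts) Jt'.
by rewrite mulVKg.
Qed.

Lemma coset_reps_sub H J J' ys : is_subgroup J ->
  (J' `<=` J)%classic -> (J `<=` H)%classic -> coset_reps H J' ys ->
  coset_reps J J' [seq y <- ys | `[< J y >]].
Proof.
move=> gJ sJ sH [Hy cy]; split=> [y|j Jj]; first by rewrite mem_filter => /andP[/asboolP].
rewrite count_filter -(cy j (sH _ Jj)); apply: eq_count => y /=.
apply/andP/asboolP => [[/asboolP//]|J'y]; split; apply/asboolP => //.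
have := sgM gJ Jj (sgV gJ (sJ _ J'y)).
by rewrite invgM invgK mulVKg.
Qed.

(** Refining the subgroup multiplies the sum by the index. *)
Lemma sum_coset_reps_refine (V : nmodType) H J J' ys zs :
  is_subgroup H -> is_subgroup J -> is_subgroup J' ->
  (J' `<=` J)%classic -> (J `<=` H)%classic ->
  coset_reps H J ys -> coset_reps H J' zs ->
  exists N, forall f : G -> V, (forall g j, J j -> f (g * j)%g = f g) ->
    \sum_(z <- zs) f z = (\sum_(y <- ys) f y) *+ N.
Proof.
move=> gH gJ gJ' sJ sH ry rz; have rt := coset_reps_sub gJ sJ sH rz.
move: [seq _ <- _ | _] rt => ts rt; exists (size ts) => f fJ.
rewrite (sum_coset_reps (ys := zs) gJ' rz (coset_reps_comp gH gJ sJ sH ry rt)); last first.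
  by move=> g j /sJ; exact: fJ.
rewrite big_allpairs_dep/= -sumrMnl; apply: eq_bigr => y _.
rewrite big_seq (eq_bigr (fun=> f y)) => [|t tts]; last by rewrite fJ//; apply: rt.1.
by rewrite -big_seq big_const_seq count_predT -[LHS]/(iter _ _ _) iter_addr_0.
Qed.

Lemma coset_reps_conj H J ys k : is_subgroup H -> H k -> coset_reps H J ys ->
  coset_reps H [set g | J (k^-1 * g * k)%g]%classic [seq (k * y * k^-1)%g | y <- ys].
Proof.
move=> gH Hk [Hy cy]; split=> [_ /mapP[y /Hy Hy' ->]|h Hh].
  by apply: sgM; [|exact: sgM|exact: sgV].
rewrite count_map -[RHS](cy (k^-1 * h * k)%g); last by apply: sgM => //; apply: sgM => //; apply: sgV.
apply: eq_count => y /=; congr `[< J _ >].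
by rewrite !invgM invgK !mulgA mulVg mul1g.
Qed.

(** A map c with finitely many values separating the cosets shows that the
    index is finite; one representative per value is chosen, and then made
    independent of the value. *)
Lemma coset_reps_exists (T : finType) H J (c : G -> T) :
  is_subgroup H -> is_subgroup J -> (J `<=` H)%classic ->
  (forall g h, H g -> H h -> c g = c h -> J (g^-1 * h)%g) ->
  exists ys, coset_reps H J ys.
Proof.
move=> gH gJ sJ hc.
pose rep g := xget (1%g : G) [set h | H h /\ J (g^-1 * h)%g]%classic.
have repP g : H g -> H (rep g) /\ J (g^-1 * rep g)%g.
  move=> Hg; rewrite /rep; case: xgetP => [x _ //|/(_ g)[]].
  by split=> //; rewrite mulVg; exact: sg1.
have rep_eq g h : J (g^-1 * h)%g -> rep g = rep h.
  move=> Jgh; rewrite /rep; congr xget; apply/seteqP; split=> x [Hx Jx]; split=> //.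
    have := sgM gJ (sgV gJ Jgh) Jx; by rewrite invgM invgK mulgA mulgK.
  by have := sgM gJ Jgh Jx; rewrite mulgA mulgK.
pose col (t : T) := xget (1%g : G) [set h | H h /\ c h = t]%classic.
have colH t : H (col t) by rewrite /col; case: xgetP => [x _ []//|_]; exact: sg1.
pose ys := undup [seq rep (col t) | t <- enum T].
have repin g : H g -> rep g \in ys.
  move=> Hg; rewrite mem_undup; apply/mapP; exists (c g); first by rewrite mem_enum.
  apply: rep_eq; apply: hc => //; rewrite /col; case: xgetP => [x _ []//|/(_ g)[]//].
exists ys; split=> [y|h Hh].
  by rewrite mem_undup => /mapP[t _ ->]; have [] := repP _ (colH t).
have -> : count (fun y => `[< J (y^-1 * h)%g >]) ys = count_mem (rep h) ys.
  apply: eq_in_count => y; rewrite mem_undup => /mapP[t _ ->].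
  have [H1 J1] := repP _ (colH t); have [H2 J2] := repP _ Hh.
  apply/asboolP/eqP => [Jh|->].
    by apply: rep_eq; have := sgM gJ J1 Jh; rewrite mulgA mulgK.
  by have := sgV gJ J2; rewrite invgM invgK.
by rewrite count_uniq_mem ?undup_uniq// repin.
Qed.

End CosetReps.

(** * Cosets of the Iwahori subgroup *)

Section IwahoriCosets.
Variables (K : localField) (pi : K) (hpi : uniformizer pi) (n : nat).
Local Notation v := (@lf_val K).
Local Notation vge := (vge v).
Local Notation G := (GL K n).
Local Notation Iw := (@Iwahori K n).
Local Notation monomial := (monomial hpi).
Local Notation rotation := (rotation hpi n).
Implicit Types (d e : 'I_n -> int) (s t : 'S_n) (g h : G).

(** The coefficients of the pi-adic expansion. *)
Fixpoint digits (k : nat) (x : K) : residue K :=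
  if k is k'.+1 then digits k' ((x - digit (red x)) / pi) else red x.

Lemma digits_eq m x y : vge 0 x -> vge 0 y ->
  (forall k, (k < m)%N -> digits k x = digits k y) -> vge m%:Z (x - y).
Proof.
have [p0 vp] := hpi.
have hdiv z : vge 0 z -> vge 0 ((z - digit (red z)) / pi).
  move=> hz; apply: vge_div => //; rewrite vp addr0; apply/red_eq => //.
  by rewrite digitK.
elim: m x y => [|m IH] x y hx hy e; first exact: vgeB.
have := IH _ _ (hdiv x hx) (hdiv y hy) (fun k lk => e k.+1 lk).
have /= exy := e 0%N isT; rewrite exy -mulrBl opprB addrA subrK.
move=> h; have hp : vge 1 pi by right; rewrite vp.
by rewrite -[x - y](divfK p0); apply: (vgeMl h hp); rewrite -addn1 PoszD.
Qed.

Lemma congruence_reps m : exists ys, coset_reps Iw (@congruence K n m) ys.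
Proof.
pose c (g : G) := [ffun p : 'I_n * 'I_n * 'I_m => digits p.2 (g p.1.1 p.1.2)].
apply: (coset_reps_exists (c := c)); [exact: Iw_subgroup|exact: congruence_subgroup|by move=> g []|].
move=> g h hg hh /ffunP e; apply/congruence_close => // i j.
apply: digits_eq => [||k lk]; try exact: Iw_int.
by have := e (i, j, Ordinal lk); rewrite !ffunE.
Qed.

(** The stabilizer of the coset x Iw in Iw, so that representatives of
    Iw / stab x give the decomposition of Iw x Iw into cosets of Iw. *)
Definition stab (x : G) : set G := [set g | Iw g /\ Iw (x^-1 * g * x)%g]%classic.

Lemma stab_subgroup x : is_subgroup (stab x).
Proof.
have gI := @Iw_subgroup K n.
split=> [|g h [hg hg'] [hh hh']]; first by split; rewrite ?mulg1 ?mulVg; exact: Iw1.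
split; first by apply: gI.2.
have -> : (x^-1 * (g * h^-1) * x = (x^-1 * g * x) * (x^-1 * h * x)^-1)%g.
  by rewrite !invgM invgK !mulgA mulgK.
exact: gI.2.
Qed.

Lemma stab_sub x : (stab x `<=` Iw)%classic. Proof. by move=> g []. Qed.

Section Step.
Variables (i j : 'I_n).
Hypothesis ij : j = i.+1 :> nat.

Let nij : i != j. Proof. by rewrite -val_eqE/= ij neq_ltn ltnSn. Qed.
Let iw_ij : iw_height i j = 0.
Proof. by rewrite /iw_height ij ltnNge leqnSn. Qed.

Definition refl_rep (x : residue K) : G := elem i j (digit x).

Lemma refl_rep_Iw x : Iw (refl_rep x).
Proof. by apply: elem_Iw => //; rewrite iw_ij. Qed.

Lemma stab_refl g :
  stab (perm_gl K (tperm i j)) g <-> Iw g /\ vge 1 (g i j).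
Proof.
rewrite /stab/= (perm_monomial hpi); split=> -[hg]; last move=> gij.
  move=> /(monomial_conj_Iw hpi)[/(_ i j)]; rewrite -(mulg1 (tperm i j)) height_step//.
  rewrite iw_heightE iw_ij !perm1 !eqxx/= (negPf nij) => h _; split=> //.
split=> //; apply/monomial_conj_Iw; split=> [a b|a]; last exact: Iw_diag.
rewrite -(mulg1 (tperm i j)) height_step// iw_heightE !perm1.
have [hab _] := (IwP g).1 hg.
case: (boolP ((a == i) && (b == j))) => [/andP[/eqP-> /eqP->]|_].
  by rewrite iw_ij (negPf nij)/= subr0 add0r.
by rewrite addr0; apply: vge_le (hab a b); rewrite gerBl; case: (_ && _).
Qed.

(** The q cosets in the double coset of a simple reflection: the residue class
    of h_ij / h_jj selects the coset of h. *)
Lemma coset_reps_refl :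
  coset_reps Iw (stab (perm_gl K (tperm i j))) [seq refl_rep x | x <- enum (residue K)].
Proof.
split=> [_ /mapP[x _ ->]|h hh]; first exact: refl_rep_Iw.
have hjj := Iw_diag j hh; have [jj0 _] := hjj.
have hx : vge 0 (h i j / h j j).
  rewrite -[0]addr0; apply: vgeM; first exact: Iw_int.
  by apply/unit_vge/unitV.
rewrite count_map (eq_count (a2 := pred1 (red (h i j / h j j)))); last first.
  move=> x /=; have -> : ((refl_rep x)^-1 = elem i j (- digit x))%g.
    apply: mulg1_eq; apply/glP => a b; rewrite elem_mul// elemE// gl1E.
    rewrite elemE// (eq_sym j i) (negPf nij)/= mulr0 addr0.
    have [->|] := eqVneq a i; last by rewrite /= mul0r mulr0 !addr0.
    by rewrite /= mul1r (eq_sym b j); case: (j == b); rewrite ?mulr1 ?mulr0 ?addr0// -addrA addNr addr0.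
  have key : vge 1 (h i j - digit x * h j j) <-> vge 1 (h i j / h j j - digit x).
    by rewrite -{1}(divfK jj0 (h i j)) -mulrBl vgeMx// hjj.2 subr0.
  have eij : (elem i j (- digit x) * h)%g i j = h i j - digit x * h j j.
    by rewrite elem_mul// eqxx mul1r mulNr.
  apply/asboolP/eqP => [/stab_refl[_]|ex].
    by rewrite eij key => /red_eq -> //; rewrite digitK.
  apply/stab_refl; split.
    by apply: IwM => //; apply: elem_Iw => //; rewrite iw_ij; apply: vgeN.
  by rewrite eij key ex; apply/red_eq => //; rewrite digitK.
by rewrite count_uniq_mem ?enum_uniq// mem_enum.
Qed.

(** If the length of w increases under the simple reflection, w conjugates the q
    representatives [refl_rep] into the Iwahori subgroup, whence the
    factorization Iw w s Iw = Iw w Iw s Iw with multiplicity one. *)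
Lemma coset_reps_step d s ys :
  iw_height (s i) (s j) <= height d s (s i) (s j) ->
  coset_reps Iw (stab (monomial d s)) ys ->
  coset_reps Iw (stab (monomial d (tperm i j * s)%g))
    [seq (y * u)%g | y <- ys, u <- [seq (monomial d s * refl_rep x * (monomial d s)^-1)%g
       | x <- enum (residue K)]].
Proof.
move=> asc ry.
have [w wE] : exists w, w = monomial d s by eexists.
have [w' w'M] : exists w', w' = monomial d (tperm i j * s)%g by eexists.
rewrite -wE -w'M in ry *.
have w'E : w' = (w * perm_gl K (tperm i j))%g by rewrite wE w'M monomial_perm.
have cIw x : Iw (w * refl_rep x * w^-1)%g.
  rewrite wE monomial_conj_elem// mulgK.
  have nsij : s i != s j by rewrite (inj_eq perm_inj).
  apply: elem_Iw => //; have hd := uniformizer_vge (d (s i) - d (s j)) hpi.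
  apply: (vgeMl hd (digit_int x)); rewrite addr0; apply: le_trans asc _.
  by rewrite /height !permK ij ltnNge leqnSn addr0.
have gI := @Iw_subgroup K n; have gS x := @stab_subgroup x.
apply: (coset_reps_comp (J := stab w)) => //.
- move=> g [hg]; rewrite w'E => hg'; split=> //; move: hg'; rewrite -w'E w'M wE.
  move=> /monomial_conj_Iw[h u]; apply/monomial_conj_Iw; split=> // a b.
  have := h a b; rewrite height_step//.
  have [/andP[/eqP ea /eqP eb]|_] := boolP ((a == s j) && (b == s i)).
    move=> _; rewrite ea eb; have [hij _] := (IwP g).1 hg; apply: vge_le (hij _ _).
    have nsij : s i != s j by rewrite (inj_eq perm_inj).
    rewrite (height_sym _ _ nsij); move: asc; rewrite /iw_height.
    have : s i != s j :> nat by rewrite val_eqE.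
    lia.
  by rewrite subr0; apply: vge_le; rewrite lerDl.
- exact: stab_sub.
have [hR cR] := coset_reps_refl; split=> [_ /mapP[x _ ->]|k [hk hk']].
  by split=> //; rewrite -!mulgA mulVg mulg1 mulKg; exact: refl_rep_Iw.
rewrite -[RHS](cR _ hk') !count_map; apply: eq_count => x /=.
have e : ((perm_gl K (tperm i j))^-1 * ((refl_rep x)^-1 * (w^-1 * k * w)) * perm_gl K (tperm i j) =
  w'^-1 * ((w * refl_rep x * w^-1)^-1 * k) * w')%g.
  by rewrite w'E !invgM invgK !mulgA mulgVK.
apply/asboolP/asboolP => -[h1 h2].
  by split; [apply: IwM => //; apply/IwV/refl_rep_Iw|rewrite e].
by split; [apply: IwM => //; apply: IwV|rewrite -e].
Qed.

End Step.

(** A vector on which the double cosets of simple reflections act by -1 and the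
    rotation by a scalar is an eigenvector of all double cosets.  The first two
    conclusions compute the index of [stab w]. *)
Lemma sign_vector_eigen (hn : (0 < n)%N) (C : fieldType) (f : G -> C) (c : C) :
  c != 0 ->
  (forall (i j : 'I_n), j = i.+1 :> nat -> forall g,
     \sum_(x : residue K) f (g * refl_rep i j x * perm_gl K (tperm i j))%g = - f g) ->
  (forall g, f (g * rotation)%g = c * f g) ->
  forall d s, exists ys, [/\ coset_reps Iw (stab (monomial d s)) ys,
    size ys = (#|residue K| ^ len d s)%N &
    forall g, \sum_(y <- ys) f (g * y * monomial d s)%g
      = (-1) ^+ len d s * c ^ (- \sum_i d i) * f g].
Proof.
move=> c0 fT fR; apply: affine_ind => //.
- exists [:: 1%g]; split.
  + split=> [y|h hh]; first by rewrite inE => /eqP->; exact: Iw1.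
    rewrite /= addn0 invg1 mul1g; case: asboolP => // -[]; split=> //.
    by rewrite monomial1 invg1 mul1g mulg1.
  + by rewrite len1.
  move=> g; rewrite big_seq1 monomial1 !mulg1 [X in c ^ (- X)]big1// oppr0 expr0z mulr1.
  by rewrite len1 expr0 mul1r.
- move=> d s.
  have eS : stab (monomial (rot_shift d s) (rot_perm n * s)%g) = stab (monomial d s).
    have [w wE] : exists w, w = monomial d s by eexists.
    have [w' w'E] : exists w', w' = monomial (rot_shift d s) (rot_perm n * s)%g by eexists.
    have ww' : w' = (w * rotation)%g by rewrite w'E wE monomial_rot.
    have cM (g : G) : (w'^-1 * g * w' = rotation^-1 * (w^-1 * g * w) * rotation)%g.
      by rewrite ww' invgM !mulgA.
    rewrite -wE -w'E; apply/seteqP; split=> g [hg].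
      by rewrite cM => /rotation_conj_Iw hg'; split.
    by move=> hg'; split=> //; rewrite cM; apply/rotation_conj_Iw.
  have fE ys g : \sum_(y <- ys) f (g * y * monomial (rot_shift d s) (rot_perm n * s)%g)%g
      = c * \sum_(y <- ys) f (g * y * monomial d s)%g.
    rewrite mulr_sumr; apply: eq_bigr => y _; rewrite -fR -monomial_rot.
    by move: (monomial d s) => a; rewrite mulgA.
  rewrite eS len_rot sum_rot_shift//.
  split=> -[ys [ry sy ey]]; exists ys; split=> // g.
    by rewrite fE ey opprB addrC expfzDr// expr1z; move: (c ^ _) ((-1) ^+ _) (f g) => x y z; ring.
  apply: (mulfI c0); rewrite -fE ey.
  by rewrite opprB addrC expfzDr// expr1z; move: (c ^ _) ((-1) ^+ _) (f g) => x y z; ring.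
move=> d s i j ij desc [ys [ry sy ey]].
have nij : i != j by rewrite -val_eqE/= ij neq_ltn ltnSn.
pose s' := (tperm i j * s)%g.
have es : s = (tperm i j * s')%g by rewrite /s' mulgA tperm2 mul1g.
have s'i : s' i = s j by rewrite permM tpermL.
have s'j : s' j = s i by rewrite permM tpermR.
have asc : iw_height (s' i) (s' j) <= height d s' (s' i) (s' j).
  have nsij : s i != s j by rewrite (inj_eq perm_inj).
  rewrite s'i s'j height_step// !eqxx (eq_sym (s j)) (negPf nsij)/= height_sym//.
  move: desc; rewrite /iw_height; have : s i != s j :> nat by rewrite val_eqE.
  lia.
have rs := coset_reps_step ij asc ry; rewrite -es in rs.
eexists; split; first exact: rs.
  by rewrite size_allpairs sy size_map -cardE (len_step ij desc) expnSr.
move=> g; rewrite big_allpairs_dep/= (len_step ij desc) exprS mulN1r !mulNr -ey -sumrN.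
apply: eq_bigr => y _; rewrite big_map -(fT i j ij) big_enum/=; apply: eq_bigr => x _.
have -> : monomial d s = (monomial d s' * perm_gl K (tperm i j))%g by rewrite monomial_perm -es.
congr f; rewrite -/s'; by move: (monomial d s') (refl_rep _ _ _) (perm_gl _ _) => a b k; rewrite !mulgA mulgVK.
Qed.

End IwahoriCosets.

(** * Bruhat and Iwasawa decompositions *)

Section Decomposition.
Variables (K : localField) (pi : K) (hpi : uniformizer pi) (n : nat).
Local Notation v := (@lf_val K).
Local Notation vge := (vge v).
Local Notation G := (GL K n).
Local Notation Iw := (@Iwahori K n).
Local Notation monomial := (monomial hpi).
Implicit Types (d : 'I_n -> int) (s : 'S_n) (g h k : G) (p q : 'I_n -> K).

Lemma sum_delta (c : 'I_n) (f : 'I_n -> K) : \sum_l f l * (l == c)%:R = f c.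
Proof. by rewrite (bigD1 c)//= eqxx mulr1 big1 ?addr0// => l /negPf->; rewrite mulr0. Qed.

Lemma sum_deltal (c : 'I_n) (f : 'I_n -> K) : \sum_l (l == c)%:R * f l = f c.
Proof. by under eq_bigr do rewrite mulrC; rewrite sum_delta. Qed.

(** The matrices 1 + p q with q p = 0: they contain both the column operations
    and the row operations of one elimination step. *)
Definition shear p q : G := toGL (1%:M + (\col_i p i) *m (\row_j q j)).

Lemma shear_unit p q : \sum_i q i * p i = 0 ->
  1%:M + (\col_i p i) *m (\row_j q j) \in unitmx.
Proof.
move=> qp; set N := _ *m _; suff /mulmx1_unit[] : (1%:M + N) *m (1%:M - N) = 1%:M by [].
suff N2 : N *m N = 0 by rewrite mulmxDl !mulmxBr !mul1mx mulmx1 N2 subr0 subrK.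
rewrite /N mulmxA -[X in X *m _](mulmxA _ (\row_j q j)).
have -> : (\row_j q j) *m (\col_i p i) = 0.
  by apply/matrixP => a b; rewrite !mxE -[RHS]qp; apply: eq_bigr => l _; rewrite !mxE.
by rewrite mulmx0 mul0mx.
Qed.

Lemma shearE p q : \sum_i q i * p i = 0 ->
  forall i j, shear p q i j = (i == j)%:R + p i * q j.
Proof.
by move=> qp i j; rewrite /shear toGLE ?shear_unit// !mxE big_ord1 !mxE.
Qed.

Lemma shearM p q g : \sum_i q i * p i = 0 ->
  forall i j, (shear p q * g)%g i j = g i j + p i * \sum_l q l * g l j.
Proof.
move=> qp i j; rewrite glME.
under eq_bigr do rewrite shearE// mulrDl.
rewrite big_split/= mulr_sumr; congr (_ + _); last by apply: eq_bigr => l _; rewrite mulrA.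
rewrite (bigD1 i)//= eqxx mul1r big1 ?addr0// => l li.
by rewrite eq_sym (negPf li) mul0r.
Qed.

Lemma mul_shear p q g : \sum_i q i * p i = 0 ->
  forall i j, (g * shear p q)%g i j = g i j + (\sum_l g i l * p l) * q j.
Proof.
move=> qp i j; rewrite glME.
under eq_bigr do rewrite shearE// mulrDr.
rewrite big_split/= mulr_suml; congr (_ + _); last by apply: eq_bigr => l _; rewrite mulrA.
rewrite (bigD1 j)//= eqxx mulr1 big1 ?addr0// => l li.
by rewrite (negPf li) mulr0.
Qed.

Lemma shearN p q : \sum_i q i * p i = 0 -> \sum_i q i * - p i = 0.
Proof. by move=> qp; under eq_bigr do rewrite mulrN; rewrite sumrN qp oppr0. Qed.

Lemma shearV p q : \sum_i q i * p i = 0 -> (shear p q)^-1%g = shear (fun i => - p i) q.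
Proof.
move=> qp; apply: mulg1_eq; apply/glP => i j; have qp' := shearN qp.
rewrite shearM// shearE// gl1E mulNr.
suff -> : \sum_l q l * shear (fun i0 => - p i0) q l j = q j by rewrite subrK.
under eq_bigr do rewrite shearE// mulrDr mulrA.
by rewrite big_split/= sum_delta -mulr_suml qp' mul0r addr0.
Qed.

Definition pivotal (A : set G) (M : G) (R C : {set 'I_n}) (r c : 'I_n) : Prop :=
  [/\ M r c != 0,
      forall c', c' \in C -> vge (v (M r c) + iw_height c c') (M r c') &
      forall a : G, (forall i j, a i j = (i == j)%:R +
        (if (i \in R) && (i != r) then M i c / M r c else 0) * (j == r)%:R) -> A a].

(** Gaussian elimination, with row operations in A and column operations in
    the Iwahori subgroup; the pivot condition says which operations these groups
    allow. *)
Lemma monomialize (A : set G) : A 1%g -> (forall g h, A g -> A h -> A (g * h)%g) ->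
  (forall (M : G) (R C : {set 'I_n}), R != finset.set0 ->
     (forall r, r \in R -> exists2 c, c \in C & M r c != 0) ->
     exists r c, [/\ r \in R, c \in C & pivotal A M R C r c]) ->
  forall g, exists a M k, [/\ A a, Iw k, g = (a * M * k)%g &
    forall r c c', M r c != 0 -> M r c' != 0 -> c = c'].
Proof.
move=> A1 AM piv.
(* R and C are the rows and the columns which are still to be treated *)
suff main m : forall (R C : {set 'I_n}) (g : G), #|R| = m ->
    (forall r c, r \notin R -> c \in C -> g r c = 0) ->
    (forall r c, r \in R -> c \notin C -> g r c = 0) ->
    (forall r c c', r \notin R -> g r c != 0 -> g r c' != 0 -> c = c') ->
    exists a M k, [/\ A a, Iw k, g = (a * M * k)%g &
      forall r c c', M r c != 0 -> M r c' != 0 -> c = c'].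
  move=> g; apply: (main _ finset.setT finset.setT g erefl) => r c.
  - by rewrite !inE.
  - by rewrite !inE.
  - by move=> c'; rewrite inE.
elim: m => [|m IH] R C g.
  move/eqP; rewrite cards_eq0 => /eqP-> _ _ h3.
  exists 1%g, g, 1%g; split=> //; [exact: Iw1|by rewrite mul1g mulg1|].
  by move=> r c c'; apply: h3; rewrite inE.
move=> cR h1 h2 h3.
have R0 : R != finset.set0 by rewrite -card_gt0 cR.
have hrow r : r \in R -> exists2 c, c \in C & g r c != 0.
  move=> rR; have : exists c, g r c != 0.
    apply: contrapT => ne.
    have z l : g r l = 0 by apply/eqP/negPn/negP => h; apply: ne; exists l.
    have := congr1 (fun x : G => x r r) (mulgV g); rewrite glME gl1E eqxx big1.
      by move/eqP; rewrite eq_sym oner_eq0.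
    by move=> l _; rewrite z mul0r.
  move=> [c gc]; exists c => //; apply: contraNT gc => cC.
  by rewrite h2.
have [r [c [rR cC [rc0 hc hA]]]] := piv g R C R0 hrow.
pose u i := if (i \in R) && (i != r) then g i c / g r c else 0.
pose er (j : 'I_n) : K := (j == r)%:R.
pose ec (j : 'I_n) : K := (j == c)%:R.
pose w j := if (j \in C) && (j != c) then g r j / g r c else 0.
have u0 : \sum_i er i * u i = 0 by rewrite sum_deltal /u eqxx andbF.
have w0 : \sum_i w i * ec i = 0 by rewrite sum_delta /w eqxx andbF.
pose a := shear u er; pose k := shear ec w.
have Aa : A a by apply: hA => i j; rewrite shearE.
have Ik : Iw k.
  apply/IwP; split=> [i j|i]; rewrite shearE//.
    apply: vgeD.
      by rewrite -gl1E; exact: ((IwP _).1 (@Iw1 K n)).1.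
    rewrite /ec; case: eqVneq => [->|_]; last by rewrite mul0r.
    rewrite mul1r /w; case: ifP => [/andP[jC jc]|//].
    by apply: vge_div => //; exact: hc.
  rewrite eqxx /ec /w; case: eqVneq => [->|_]; last by rewrite mul0r addr0; exact: unit1.
  by rewrite andbF mulr0 addr0; exact: unit1.
pose g1 := (g * k^-1)%g; pose g2 := (a^-1 * g1)%g.
have eg : g = (a * g2 * k)%g by rewrite /g2 /g1 mulKVg mulgVK.
have g1E i j : g1 i j = g i j - g i c * w j.
  rewrite /g1 /k shearV// mul_shear; last exact: shearN.
  under eq_bigr do rewrite mulrN; rewrite sumrN sum_delta.
  by rewrite mulNr.
have g1r j : g1 r j = (j == c)%:R * g r c.
  rewrite g1E /w; have [->|jc] := eqVneq j c; first by rewrite andbF mulr0 subr0 mul1r.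
  rewrite andbT mul0r; case: ifP => [_|/negbT jC]; last by rewrite h2// mulr0 subr0.
  by rewrite mulrC divfK// subrr.
have g2E i j : g2 i j = g1 i j - u i * ((j == c)%:R * g r c).
  rewrite /g2 /a shearV// shearM; last exact: shearN.
  by rewrite sum_deltal g1r mulNr.
have [a' [M [k' [Aa' Ik' e' mM]]]] : exists a M k, [/\ A a, Iw k, g2 = (a * M * k)%g &
      forall r c c', M r c != 0 -> M r c' != 0 -> c = c'].
  have uE i : i \notin R -> u i = 0 by rewrite /u => /negPf->.
  have g2R i j : i \notin R -> g2 i j = g i j.
    by move=> iR; rewrite g2E uE// mul0r subr0 g1E (h1 i c)// mul0r subr0.
  apply: (IH (R :\ r)%SET (C :\ c)%SET) => [|i j|i j|i j j'].
  - by have := cardsD1 r R; rewrite cR rR; lia.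
  - rewrite !inE negb_and negbK => /orP[/eqP->|iR] /andP[jc jC].
      by rewrite g2E g1r (negPf jc) /u eqxx andbF !mul0r subrr.
    by rewrite g2R// h1.
  - rewrite !inE negb_and negbK => /andP[ir iR] /orP[/eqP->|jC].
      rewrite g2E eqxx mul1r /u iR ir/= divfK// g1E /w eqxx andbF mulr0 subr0.
      by rewrite subrr.
    have jc : (j == c) = false by apply/eqP => e; rewrite e cC in jC.
    by rewrite g2E jc mul0r mulr0 subr0 g1E h2// /w (negPf jC) mulr0 subrr.
  rewrite !inE negb_and negbK => /orP[/eqP->|iR]; last by rewrite !g2R//; exact: h3.
  have e l : g2 r l = (l == c)%:R * g r c.
    by rewrite g2E g1r /u eqxx andbF mul0r subr0.
  rewrite !e; have [->|_] := eqVneq j c; last by rewrite mul0r eqxx.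
  by have [->|_] := eqVneq j' c; rewrite // mul0r eqxx.
exists (a * a')%g, M, (k' * k)%g; split=> //.
- exact: AM.
- exact: IwM.
- by rewrite eg e' !mulgA.
Qed.

Lemma monomial_normal_form (M : G) :
  (forall r c c', M r c != 0 -> M r c' != 0 -> c = c') ->
  exists d s k, Iw k /\ M = (monomial d s * k)%g.
Proof.
move=> hM.
have hcol c : {r | M r c != 0}.
  apply: cid; apply: contrapT => ne.
  have z l : M l c = 0 by apply/eqP/negPn/negP => h; apply: ne; exists l.
  have := congr1 (fun x : G => x c c) (mulVg M); rewrite glME gl1E eqxx big1.
    by move/eqP; rewrite eq_sym oner_eq0.
  by move=> l _; rewrite z mulr0.
have inj : injective (fun c => sval (hcol c)).
  move=> c c' /= e; apply: (hM (sval (hcol c))); first exact: svalP (hcol c).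
  by rewrite e; exact: svalP (hcol c').
pose s := perm inj.
have sM j : M (s j) j != 0 by rewrite permE; exact: svalP (hcol j).
have sM0 i j : i != s j -> M i j = 0.
  move=> ij; apply/eqP/negPn/negP => Mij; rewrite -[i](permKV s) in ij Mij.
  by rewrite (hM _ _ _ (sM _) Mij) eqxx in ij.
pose d i := v (M i (s^-1%g i)).
pose k0 : 'M[K]_n := \matrix_(i, j) ((i == j)%:R * (pi ^ (- d (s j)) * M (s j) j)).
have u j : integer_unit (pi ^ (- d (s j)) * M (s j) j).
  have p0 := pi_neq0 (- d (s j)) hpi; split; first by rewrite mulf_neq0.
  by rewrite lf_valM// val_pi// /d permK addNr.
have bk : bounded (@iw_height n) k0.
  split=> [i j|i]; rewrite mxE; last by rewrite eqxx mul1r.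
  have [->|_] := eqVneq i j; last by rewrite mul0r.
  by rewrite mul1r /iw_height ltnn; exact: unit_vge.
have [ek Ik] := Iw_toGL bk.
exists d, s, (toGL k0); split=> //; apply/glP => i j; rewrite monomial_mul ek mxE.
have [<-|nij] := eqVneq (s^-1%g i) j; last first.
  rewrite mul0r mulr0 sM0//; apply: contraNN nij => /eqP->; by rewrite permK.
have [p0 _] := hpi.
by rewrite mul1r permKV mulrA -expfzDr// subrr expr0z mul1r.
Qed.

Lemma key_le (N a b : nat) (x y : int) : (a < N)%N -> (b < N)%N ->
  N%:Z * x + a%:Z <= N%:Z * y + b%:Z -> x + ((b < a)%N : nat)%:Z <= y.
Proof.
move=> aN bN h; rewrite leNgt; apply/negP => lt.
have : N%:Z * (y + 1) <= N%:Z * (x + ((b < a)%N : nat)%:Z) by rewrite ler_wpM2l//; lia.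
rewrite !mulrDr mulr1; case: (ltnP b a) => ba; rewrite ?mulr1 ?mulr0; lia.
Qed.

(** The pivot is an entry of minimal valuation; ties are broken so that the
    entries to its left and below it have a strictly larger valuation, as the
    Iwahori subgroup requires. *)
Lemma affine_bruhat g : exists k d s k', [/\ Iw k, Iw k' & g = (k * monomial d s * k')%g].
Proof.
suff [a [M [k [Ia Ik -> /monomial_normal_form[d [s [k' [Ik' ->]]]]]]]] :
    exists a M k, [/\ Iw a, Iw k, g = (a * M * k)%g &
    forall r c c', M r c != 0 -> M r c' != 0 -> c = c'].
  exists a, d, s, (k' * k)%g; split=> //; first exact: IwM.
  by move: (monomial d s) => w; rewrite !mulgA.
move: g; apply: monomialize => [||M R C R0 hR]; [exact: Iw1|exact: IwM|].
have [r0 r0R] : exists r, r \in R by apply/finset.set0Pn.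
have [c0 c0C rc0] := hR r0 r0R.
pose P (p : 'I_n * 'I_n) := [&& p.1 \in R, p.2 \in C & M p.1 p.2 != 0].
have P0 : P (r0, c0) by rewrite /P /= r0R c0C.
(* |c - r| < n, so n * v dominates and c - r breaks the ties *)
pose key (p : 'I_n * 'I_n) : int := n%:Z * v (M p.1 p.2) + (p.2 : nat)%:Z - (p.1 : nat)%:Z.
case: (Order.TotalTheory.arg_minP key P0) => -[r c] /and3P[/= rR cC rc] hmin.
exists r, c; split=> //; split=> //= [c' c'C|a ha].
  have [->|rc'] := eqVneq (M r c') 0; first exact: vge0.
  right; have := hmin (r, c'); rewrite /P /= rR c'C rc' /key/= => /(_ isT).
  by rewrite lerD2r => /key_le; apply.
apply/IwP; split=> [i j|i]; rewrite ha; last first.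
  rewrite eqxx; have [->|_] := eqVneq i r; last by rewrite mulr0 addr0; exact: unit1.
  by rewrite andbF mul0r addr0; exact: unit1.
apply: vgeD; first by rewrite -gl1E; exact: ((IwP _).1 (@Iw1 K n)).1.
have [->|_] := eqVneq j r; last by rewrite mulr0.
rewrite mulr1; case: ifP => [/andP[iR ir]|//]; apply: vge_div => //.
have [->|ic] := eqVneq (M i c) 0; first exact: vge0.
right; have := hmin (i, c); rewrite /P /= iR cC ic /key/= => /(_ isT) h.
by apply: (key_le (ltn_ord i) (ltn_ord r)); move: h; clear; lia.
Qed.

Lemma unipotentM (u u' : G) : unipotent u -> unipotent u' -> unipotent (u * u')%g.
Proof.
move=> [hu u1] [hu' u1']; split=> [i j ji|i]; rewrite glME.
  apply: big1 => l _; case: (ltnP l i) => li; first by rewrite hu// mul0r.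
  by rewrite hu' ?mulr0//; apply: leq_trans li.
rewrite (bigD1 i)//= u1 u1' mulr1 big1 ?addr0// => l li.
case: (ltngtP l i) => [l_i|i_l|/val_inj e]; last by rewrite e eqxx in li.
  by rewrite hu// mul0r.
by rewrite hu' ?mulr0.
Qed.

Lemma unipotent1 : unipotent (1%g : G).
Proof.
split=> [i j ji|i]; rewrite gl1E ?eqxx//.
by case: eqVneq ji => // ->; rewrite ltnn.
Qed.

(** Rows are treated from the last to the first, so that the row operations
    are upper triangular. *)
Lemma iwasawa g : exists u d s k, [/\ unipotent u, Iw k & g = (u * monomial d s * k)%g].
Proof.
suff [a [M [k [Ia Ik -> /monomial_normal_form[d [s [k' [Ik' ->]]]]]]]] :
    exists a M k, [/\ unipotent a, Iw k, g = (a * M * k)%g &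
    forall r c c', M r c != 0 -> M r c' != 0 -> c = c'].
  exists a, d, s, (k' * k)%g; split=> //; first exact: IwM.
  by move: (monomial d s) => w; rewrite !mulgA.
move: g; apply: (@monomialize (@unipotent K n)) => [||M R C R0 hR]; [exact: unipotent1|exact: unipotentM|].
have [r0 r0R] : exists r, r \in R by apply/finset.set0Pn.
case: (arg_maxnP (fun r : 'I_n => r : nat) r0R) => r rR rmax.
have [c0 c0C rc0] := hR r rR.
pose P (c : 'I_n) := (c \in C) && (M r c != 0).
have P0 : P c0 by rewrite /P c0C.
pose key (c : 'I_n) : int := n%:Z * v (M r c) + (c : nat)%:Z.
case: (Order.TotalTheory.arg_minP key P0) => c /andP[/= cC rc] hmin.
exists r, c; split=> //; split=> //= [c' c'C|a ha].
  have [->|rc'] := eqVneq (M r c') 0; first exact: vge0.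
  right; have := hmin c'; rewrite /P /= c'C rc' /key/= => /(_ isT).
  by move=> /key_le; apply.
split=> [i j ji|i]; rewrite ha; last first.
  rewrite eqxx; have [->|_] := eqVneq i r; last by rewrite mulr0 addr0.
  by rewrite andbF mul0r addr0.
have -> : (i == j) = false by apply/eqP => e; rewrite e ltnn in ji.
have [ej|_] := eqVneq j r; last by rewrite mulr0 addr0.
case: ifP => [/andP[iR _]|]; last by rewrite mul0r addr0.
by have : (i <= r)%N := rmax i iR; rewrite -ej leqNgt ji.
Qed.

End Decomposition.

(** * Minors of the last rows *)

Section Minors.
Variables (K : localField) (pi : K) (hpi : uniformizer pi) (n : nat).
Local Notation v := (@lf_val K).
Local Notation vge := (vge v).
Local Notation G := (GL K n).
Local Notation Iw := (@Iwahori K n).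
Implicit Types (d : 'I_n -> int) (s t : 'S_n) (g h k b : G) (p : 'I_n -> 'I_n) (m : nat).

(** The determinant of this matrix is, up to sign, the minor of the rows of
    index at least m and of the columns outside of p(0), ..., p(m-1). *)
Definition last_rows m p (M : 'M[K]_n) : 'M[K]_n :=
  \matrix_(i, j) if (i < m)%N then (j == p i)%:R else M i j.

Lemma last_rowsE m p (M : 'M[K]_n) i j :
  last_rows m p M i j = if (i < m)%N then (j == p i)%:R else M i j.
Proof. by rewrite mxE. Qed.

(** The minors of the last rows are semi-invariants under upper triangular
    matrices; their valuations recover the cell and the diagonal part. *)
Lemma det_last_rows_upper m p b g : upper_triangular b ->
  \det (last_rows m p (b * g)%g) =
  (\prod_(i : 'I_n | (m <= i)%N) b i i) * \det (last_rows m p g).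
Proof.
move=> ub; pose B : 'M[K]_n := \matrix_(i, j) if (i < m)%N then (i == j)%:R else b i j.
have -> : last_rows m p (b * g)%g = B *m last_rows m p g.
  apply/matrixP => i j; rewrite !mxE; case: ifP => im.
    rewrite (bigD1 i)//= !mxE im eqxx mul1r big1 ?addr0// => l li.
    by rewrite !mxE im eq_sym (negPf li) mul0r.
  apply: eq_bigr => l _; rewrite !mxE im; case: ifP => // lm.
  by rewrite ub ?mul0r//; apply: leq_trans lm _; rewrite leqNgt im.
rewrite det_mulmx; congr (_ * _); rewrite -det_tr det_trig; last first.
  apply/is_trig_mxP => i j ij; rewrite !mxE; case: ifP => _; last exact: ub.
  by case: eqVneq ij => // ->; rewrite ltnn.
rewrite [RHS]big_mkcond; apply: eq_bigr => i _; rewrite !mxE ltnNge eqxx.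
by case: (m <= i)%N.
Qed.

Lemma det_last_rows_diag m p d g :
  \det (last_rows m p g) * \prod_i pi ^ d i =
  (\prod_(i : 'I_n | (i < m)%N) pi ^ d (p i)) *
    \det (last_rows m p (g * monomial hpi d 1)%g).
Proof.
have <- : \det (diag_mx (\row_i pi ^ d i)) = \prod_i pi ^ d i :> K.
  by rewrite det_diag; apply: eq_bigr => i _; rewrite mxE.
pose D := diag_mx (\row_(i < n) if (i < m)%N then pi ^ d (p i) else 1).
have -> : \prod_(i : 'I_n | (i < m)%N) pi ^ d (p i) = \det D.
  by rewrite det_diag big_mkcond; apply: eq_bigr => i _; rewrite mxE.
rewrite -!det_mulmx; congr (\det _); apply/matrixP => i j.
have -> : (last_rows m p g *m diag_mx (\row_i pi ^ d i)) i j = last_rows m p g i j * pi ^ d j.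
  by rewrite mul_mx_diag [LHS]mxE [X in _ * X]mxE.
have -> : (D *m last_rows m p (g * monomial hpi d 1)%g) i j =
    (if (i < m)%N then pi ^ d (p i) else 1) * last_rows m p (g * monomial hpi d 1)%g i j.
  by rewrite mul_diag_mx [LHS]mxE [X in X * _]mxE.
rewrite 2!last_rowsE; case: ifP => im.
  by case: eqVneq => [->|_]; rewrite ?mul1r ?mulr1 ?mul0r ?mulr0.
by rewrite mul_monomial perm1 mul1r.
Qed.

Lemma perm_glM_E s g i j : (perm_gl K s * g)%g i j = g (s^-1%g i) j.
Proof. by rewrite (perm_monomial hpi) monomial_mul expr0z mul1r. Qed.

Lemma last_rows_int m p s k : Iw k ->
  forall i j, vge 0 (last_rows m p (perm_gl K s * k)%g i j).
Proof.
move=> hk i j; rewrite mxE; case: ifP => _; first by case: eqP => _; [exact: vge1|exact: vge0].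
by rewrite perm_glM_E; exact: Iw_int.
Qed.

Lemma last_rows_term m p s k (t : 'S_n) : Iw k ->
  (exists i, vge 1 (last_rows m p (perm_gl K s * k)%g i (t i))) \/
  (forall i : 'I_n, (i < m)%N -> t i = p i) /\
  (forall i : 'I_n, (m <= i)%N -> (s^-1%g i <= t i)%N).
Proof.
move=> hk; have [h|nh] := pselect (exists i, vge 1 (last_rows m p (perm_gl K s * k)%g i (t i))).
  by left.
right; split=> i im.
  apply/eqP/negPn/negP => tp; apply: nh; exists i.
  by rewrite mxE im (negPf tp); exact: vge0.
rewrite leqNgt; apply/negP => lt; apply: nh; exists i.
by rewrite mxE ltnNge im perm_glM_E; exact: Iw_low.
Qed.

(** The minor of the cell of s is dominated by the term of s^-1 alone. *)
Lemma det_last_rows_unit m s k : Iw k ->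
  integer_unit (\det (last_rows m s^-1%g (perm_gl K s * k)%g)).
Proof.
move=> hk; have hI := @last_rows_int m s^-1%g s k hk.
apply: unitD (_ : vge 1 (_ - (-1) ^+ (s^-1)%g * \prod_i
    last_rows m s^-1%g (perm_gl K s * k)%g i (s^-1%g i))).
  apply: unitMsign; apply: unit_prod => i _; rewrite mxE eqxx.
  by case: ifP => _; [exact: unit1|rewrite perm_glM_E; exact: Iw_diag].
apply: det_one_term => // t nts.
have [//|[h1 h2]] := last_rows_term m s^-1%g s t hk.
case/eqP: nts; apply: perm_le_eq => i.
by case: (ltnP i m) => im; [rewrite h1|exact: h2].
Qed.

Lemma det_last_rows_int m p s k : Iw k ->
  vge 0 (\det (last_rows m p (perm_gl K s * k)%g)).
Proof. by move=> hk; apply/det_integer/last_rows_int. Qed.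

(** Modulo the maximal ideal, the minors of an upper triangular matrix are
    supported on the pairs of index sets comparable for the Bruhat order. *)
Lemma det_last_rows_small m s t k : Iw k ->
  (\sum_(i : 'I_n | (m <= i)%N) t^-1%g i < \sum_(i : 'I_n | (m <= i)%N) s^-1%g i)%N ->
  vge 1 (\det (last_rows m t^-1%g (perm_gl K s * k)%g)).
Proof.
move=> hk lt; apply: det_max_ideal; first exact: last_rows_int.
move=> u; have [//|[h1 h2]] := last_rows_term m t^-1%g s u hk.
have tot (w : 'S_n) : (\sum_(i < n | (i < m)%N) w i + \sum_(i < n | (m <= i)%N) w i
    = \sum_(i < n) i)%N.
  rewrite [RHS](reindex_inj (@perm_inj _ w))/= [RHS](bigID (fun i : 'I_n => (i < m)%N))/=.
  by congr (_ + _)%N; apply: eq_bigl => i; rewrite -leqNgt.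
have le : (\sum_(i < n | (m <= i)%N) s^-1%g i <= \sum_(i < n | (m <= i)%N) u i)%N.
  exact: leq_sum.
have e : (\sum_(i < n | (i < m)%N) u i = \sum_(i < n | (i < m)%N) t^-1%g i)%N.
  by apply: eq_bigr => i /h1->.
by have := tot u; have := tot t^-1%g; move: lt le; rewrite e; lia.
Qed.

(** Differences of consecutive tail sums recover the terms. *)
Lemma tail_sums (f g : 'I_n -> int) :
  (forall m, \sum_(i : 'I_n | (m <= i)%N) f i = \sum_(i : 'I_n | (m <= i)%N) g i) ->
  f =1 g.
Proof.
move=> h i; have := h i; rewrite (bigD1 i)//= [in RHS](bigD1 i)//=.
have e (F : 'I_n -> int) : \sum_(j < n | (i <= j)%N && (j != i)) F j
    = \sum_(j : 'I_n | (i.+1 <= j)%N) F j.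
  by apply: eq_bigl => j; rewrite ltn_neqAle andbC eq_sym.
by rewrite !e h => /addIr.
Qed.

Lemma upper_diag_neq0 b i : upper_triangular b -> b i i != 0.
Proof.
move=> ub; have := gl_unit b; rewrite unitmxE unitfE -det_tr det_trig.
  by move/prodf_neq0 => /(_ i isT); rewrite mxE.
by apply/is_trig_mxP => a c ac; rewrite mxE; exact: ub.
Qed.

Lemma val_prod_upper m b : upper_triangular b ->
  \prod_(i : 'I_n | (m <= i)%N) b i i != 0 /\
  v (\prod_(i : 'I_n | (m <= i)%N) b i i) = \sum_(i : 'I_n | (m <= i)%N) v (b i i).
Proof.
move=> ub; have b0 i : b i i != 0 by exact: upper_diag_neq0.
split; last by rewrite val_prod.
by apply/prodf_neq0.
Qed.

Lemma last_rows_val m p b s k : Iw k -> upper_triangular b ->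
  vge (\sum_(i : 'I_n | (m <= i)%N) v (b i i))
    (\det (last_rows m p (b * (perm_gl K s * k))%g)).
Proof.
move=> hk ub; rewrite det_last_rows_upper//; have [p0 <-] := val_prod_upper m ub.
rewrite -[X in vge X]addr0; apply: vgeM; last exact: det_last_rows_int.
by right.
Qed.

Lemma last_rows_val_eq m b s k : Iw k -> upper_triangular b ->
  \det (last_rows m s^-1%g (b * (perm_gl K s * k))%g) != 0 /\
  v (\det (last_rows m s^-1%g (b * (perm_gl K s * k))%g)) =
  \sum_(i : 'I_n | (m <= i)%N) v (b i i).
Proof.
move=> hk ub; rewrite det_last_rows_upper//; have [p0 vp] := val_prod_upper m ub.
have [d0 vd] := det_last_rows_unit m s hk.
by rewrite mulf_neq0// lf_valM// vd addr0 vp.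
Qed.

Lemma sum_posz (P : pred 'I_n) (f : 'I_n -> nat) :
  \sum_(i | P i) (f i)%:Z = (\sum_(i | P i) f i)%N%:Z.
Proof. by rewrite (big_morph Posz PoszD (erefl _)). Qed.

(** Uniqueness in the Iwasawa decomposition: among the minors of the last rows of
    b s k, the one of the cell of s has the least valuation, namely the one of
    the diagonal part of b. *)
Lemma upper_cell_unique b b' s s' k k' : Iw k -> Iw k' ->
  upper_triangular b -> upper_triangular b' ->
  (b * (perm_gl K s * k) = b' * (perm_gl K s' * k'))%g ->
  s = s' /\ forall i, v (b i i) = v (b' i i).
Proof.
move=> hk hk' ub ub' e.
have ve m : \sum_(i : 'I_n | (m <= i)%N) v (b i i) = \sum_(i : 'I_n | (m <= i)%N) v (b' i i).
  have := last_rows_val m s'^-1%g s hk ub; rewrite e.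
  have [d0 vd] := last_rows_val_eq m s' hk' ub'; rewrite vge_neq0// vd => le1.
  have := last_rows_val m s^-1%g s' hk' ub'; rewrite -e.
  have [d0' vd'] := last_rows_val_eq m s hk ub; rewrite vge_neq0// vd' => le2.
  by apply/eqP; rewrite eq_le le1 le2.
split; last exact: tail_sums.
have ge (b1 b2 : G) s1 s2 k1 k2 m : Iw k1 -> Iw k2 -> upper_triangular b1 -> upper_triangular b2 ->
    (b1 * (perm_gl K s1 * k1) = b2 * (perm_gl K s2 * k2))%g ->
    \sum_(i : 'I_n | (m <= i)%N) v (b1 i i) = \sum_(i : 'I_n | (m <= i)%N) v (b2 i i) ->
    (\sum_(i : 'I_n | (m <= i)%N) s2^-1%g i <= \sum_(i : 'I_n | (m <= i)%N) s1^-1%g i)%N.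
  move=> h1 h2 u1 u2 e12 v12; rewrite leqNgt; apply/negP => lt.
  have := det_last_rows_small h2 lt.
  have [d0 vd] := last_rows_val_eq m s1 h1 u1; rewrite e12 det_last_rows_upper// in d0 vd.
  have [p0 vp] := val_prod_upper m u2.
  have l0 : \det (last_rows m s1^-1%g (perm_gl K s2 * k2)%g) != 0.
    by apply: contraNneq d0 => ->; rewrite mulr0.
  by rewrite lf_valM// vp v12 in vd; rewrite vge_neq0//; lia.
suff : s^-1%g = s'^-1%g by move/(congr1 (@invg _)); rewrite !invgK.
apply/permP => i; apply/val_inj.
have := @tail_sums (fun i => (s^-1%g i : nat)%:Z) (fun i => (s'^-1%g i : nat)%:Z).
move=> h; suff /h /(_ i) [] : forall m, \sum_(i : 'I_n | (m <= i)%N) (s^-1%g i : nat)%:Z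
    = \sum_(i : 'I_n | (m <= i)%N) (s'^-1%g i : nat)%:Z by [].
move=> m; rewrite !sum_posz; congr Posz; apply/eqP; rewrite eqn_leq.
by rewrite (ge _ _ _ _ _ _ m hk hk' ub ub' e)// (ge _ _ _ _ _ _ m hk' hk ub' ub (esym e)).
Qed.

(** Compare the minors of s y diag(d) for the two cells, at the largest m where
    s^-1 and t^-1 differ.  If t^-1(m) < s^-1(m), the minor of s y for the cell
    of t is small, and this forces d to increase strictly from t^-1(m) to
    s^-1(m), a contradiction. *)
Lemma cell_mul_dominant d y k b s t : Iw y -> Iw k -> upper_triangular b ->
  (forall i j : 'I_n, (i <= j)%N -> d j <= d i) ->
  (perm_gl K s * y * monomial hpi d 1 = b * (perm_gl K t * k))%g ->
  (t = s /\ forall i, v (b i i) = d (s^-1%g i)) \/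
  exists m : 'I_n, (forall i : 'I_n, (m < i)%N -> t^-1%g i = s^-1%g i) /\
    (s^-1%g m < t^-1%g m)%N.
Proof.
move=> hy hk ub dd e.
have key m p : \det (last_rows m p (perm_gl K s * y)%g) * \prod_i pi ^ d i =
    (\prod_(i : 'I_n | (i < m)%N) pi ^ d (p i)) *
      ((\prod_(i : 'I_n | (m <= i)%N) b i i) * \det (last_rows m p (perm_gl K t * k)%g)).
  by rewrite det_last_rows_diag e det_last_rows_upper.
have p0 (P : pred 'I_n) (f : 'I_n -> int) : \prod_(i | P i) pi ^ f i != 0 /\
    v (\prod_(i | P i) pi ^ f i) = \sum_(i | P i) f i.
  split; first by apply/prodf_neq0 => i _; exact: pi_neq0.
  rewrite val_prod => [|i _]; last exact: pi_neq0.
  by apply: eq_bigr => i _; rewrite val_pi.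
have tot (w : 'S_n) m (f : 'I_n -> int) : \sum_(i < n | (i < m)%N) f (w i)
    = \sum_i f i - \sum_(i < n | (m <= i)%N) f (w i).
  rewrite -(sum_perm w) [in RHS](bigID (fun i : 'I_n => (i < m)%N))/=.
  by rewrite [X in _ = _ + X - _](eq_bigl (fun i : 'I_n => (m <= i)%N)) ?addrK// => i; rewrite -leqNgt.
have [pd0 vpd] : \prod_i pi ^ d i != 0 /\ v (\prod_i pi ^ d i) = \sum_i d i := p0 predT d.
have [ets|nts] := eqVneq t s.
  left; split=> //; rewrite ets in key; apply: tail_sums => m.
  have [d0 vd] := det_last_rows_unit m s hy.
  have [d0' vd'] := det_last_rows_unit m s hk.
  have [pm0 vpm] := p0 (fun i : 'I_n => (i < m)%N) (fun i => d (s^-1%g i)).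
  have [pb0 vpb] := val_prod_upper m ub.
  have := congr1 v (key m s^-1%g); rewrite !lf_valM ?mulf_neq0// vpd vd vd' vpm vpb.
  rewrite (tot s^-1%g) add0r addr0 => E; lia.
right.
have [m0 m0P] : exists m : 'I_n, t^-1%g m != s^-1%g m.
  apply: contrapT => ne; case/eqP: nts; apply: (can_inj (@invgK _)); apply/permP => i.
  by apply/eqP/negPn/negP => h; apply: ne; exists i.
case: (@arg_maxnP _ m0 (fun r : 'I_n => t^-1%g r != s^-1%g r) (fun r : 'I_n => r : nat) m0P) => m mP mmax.
exists m; have tl (i : 'I_n) : (m < i)%N -> t^-1%g i = s^-1%g i.
  move=> mi; apply/eqP/negPn/negP => /mmax h; have : (i <= m)%N := h.
  by rewrite leqNgt mi.
split=> //; case: (ltngtP (s^-1%g m) (t^-1%g m)) => // [lt|/val_inj/esym/eqP]; last by rewrite (negPf mP).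
have split_m (V : nmodType) (F : 'I_n -> V) : \sum_(i < n | (m <= i)%N) F i
   = F m + \sum_(i < n | (m < i)%N) F i.
  rewrite (bigD1 m)//=; congr (_ + _); apply: eq_bigl => i.
  by rewrite ltn_neqAle andbC eq_sym.
have tailE (V : nmodType) (F : 'I_n -> V) : \sum_(i < n | (m < i)%N) F (t^-1%g i)
   = \sum_(i < n | (m < i)%N) F (s^-1%g i).
  by apply: eq_bigr => i /tl->.
have small : vge 1 (\det (last_rows m t^-1%g (perm_gl K s * y)%g)).
  apply: det_last_rows_small => //; rewrite -ltz_nat -!sum_posz !split_m.
  by rewrite (tailE int (fun i => (i : nat)%:Z)) ltrD2r ltz_nat.
have [dt0 vdt] := det_last_rows_unit m t hk.
have [ds0 vds] := det_last_rows_unit m s hy.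
have [pt0 vpt] := p0 (fun i : 'I_n => (i < m)%N) (fun i => d (t^-1%g i)).
have [ps0 vps] := p0 (fun i : 'I_n => (i < m)%N) (fun i => d (s^-1%g i)).
have [pb0 vpb] := val_prod_upper m ub.
have kt := key m t^-1%g; have ks := key m s^-1%g.
have l0 : \det (last_rows m t^-1%g (perm_gl K s * y)%g) != 0.
  by apply: contraTneq (mulf_neq0 pt0 (mulf_neq0 pb0 dt0)) => z; rewrite -kt z mul0r eqxx.
have r0 : \det (last_rows m s^-1%g (perm_gl K t * k)%g) != 0.
  by apply: contraTneq (mulf_neq0 ds0 pd0) => z; rewrite ks z !mulr0 eqxx.
move/(congr1 v): kt; move/(congr1 v): ks; rewrite !lf_valM ?mulf_neq0//.
rewrite vpd vds vdt vpt vps vpb !(tot _ m d).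
move: small; rewrite vge_neq0// => small.
have := det_last_rows_int m s^-1%g t hk; rewrite vge_neq0// => big.
rewrite !split_m (tailE int d) => E1 E2.
have := dd _ _ (ltnW lt); move: E1 E2 small big.
move: (d (s^-1%g m)) (d (t^-1%g m)) (\sum_i d i) (\sum_(i < n | (m < i)%N) d (s^-1%g i)).
move: (v (b m m)) (\sum_(i < n | (m < i)%N) v (b i i)) (v _) (v _).
by clear; lia.
Qed.

End Minors.

(** * The Iwahori-fixed vector of sign type *)

Lemma prod_expz (C : fieldType) (I : Type) (r : seq I) (P : pred I) (q : C) (f : I -> int) :
  q != 0 -> \prod_(i <- r | P i) q ^ f i = q ^ (\sum_(i <- r | P i) f i).
Proof.
by move=> q0; elim/big_rec2: _ => // i y1 y2 _ ->; rewrite expfzDr.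
Qed.

Lemma res_card_gt1 (K : localField) : (1 < #|residue K|)%N.
Proof. exact: finNzRing_gt1. Qed.

Lemma res_card_neq0 (K : localField) (C : fieldType) : [pchar C] =i pred0 ->
  res_card K C != 0.
Proof.
move=> hC; rewrite /res_card; have /pcharf0P -> := hC.
by rewrite -lt0n (ltn_trans _ (res_card_gt1 K)).
Qed.

Section SignVector.
Variables (K : localField) (pi : K) (hpi : uniformizer pi) (n : nat) (hn : (0 < n)%N).
Variables (C : fieldType) (hC : [pchar C] =i pred0).
Variables (lambda : C) (hlambda : lambda != 0).
Local Notation v := (@lf_val K).
Local Notation vge := (vge v).
Local Notation G := (GL K n).
Local Notation Iw := (@Iwahori K n).
Local Notation monomial := (monomial hpi).
Local Notation rotation := (rotation hpi n).
Local Notation q := (res_card K C).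
Local Notation delta := (delta lambda).
Implicit Types (d : 'I_n -> int) (s : 'S_n) (g h k b : G).

Let q0 : q != 0. Proof. exact: res_card_neq0. Qed.

Lemma deltaE b : delta b = lambda ^ (\sum_i v (b i i)) *
  q ^ (- \sum_(p : 'I_n * 'I_n | (p.1 < p.2)%N) (v (b p.1 p.1) - v (b p.2 p.2))).
Proof. by rewrite /Defs.delta prod_expz// sumrN. Qed.

Lemma delta_eq b b' : (forall i, v (b i i) = v (b' i i)) -> delta b = delta b'.
Proof.
by move=> e; rewrite !deltaE; congr (_ ^ _ * _ ^ (- _)); apply: eq_bigr => i _; rewrite !e.
Qed.

Lemma delta_unit b : (forall i, integer_unit (b i i)) -> delta b = 1.
Proof.
move=> u; have e i : v (b i i) = 0 by case: (u i).
rewrite deltaE [\sum_i _]big1 ?[\sum_(_ | _) _]big1 ?oppr0 ?expr0z ?mulr1// => i *; rewrite !e//.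
Qed.

Lemma upperM b b' : upper_triangular b -> upper_triangular b' -> upper_triangular (b * b')%g.
Proof.
move=> hb hb' i j ji; rewrite glME big1// => l _.
by case: (ltnP l i) => li; [rewrite hb ?mul0r|rewrite hb' ?mulr0//; apply: leq_trans li].
Qed.

Lemma upperM_diag b b' i : upper_triangular b -> upper_triangular b' ->
  (b * b')%g i i = b i i * b' i i.
Proof.
move=> hb hb'; rewrite glME (bigD1 i)//= big1 ?addr0// => l li.
case: (ltngtP l i) => [l_i|i_l|/val_inj e]; last by rewrite e eqxx in li.
  by rewrite hb// mul0r.
by rewrite hb' ?mulr0.
Qed.

Lemma deltaM b b' : upper_triangular b -> upper_triangular b' ->
  delta (b * b')%g = delta b * delta b'.
Proof.
move=> hb hb'; rewrite !deltaE.
have e i : v ((b * b')%g i i) = v (b i i) + v (b' i i).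
  by rewrite upperM_diag// lf_valM// upper_diag_neq0.
under eq_bigr do rewrite e; under [X in _ ^ (- X)]eq_bigr do rewrite !e opprD addrACA.
rewrite !big_split/= opprD !expfzDr//.
by rewrite mulrACA.
Qed.

(** The value of the sign vector, and of the Whittaker function on its support,
    at diag(pi^d) s.  Written with heights, it visibly changes by -1/q under a
    simple reflection and by a scalar under the rotation. *)
Definition cell_value d s : C := (-1) ^+ s * lambda ^ (\sum_i d i) *
  q ^ (- \sum_(p : 'I_n * 'I_n | (p.1 < p.2)%N) height d s p.1 p.2).

Lemma cell_value_step d s (i j : 'I_n) : j = i.+1 :> nat -> (s i < s j)%N ->
  cell_value d (tperm i j * s)%g = - q^-1 * cell_value d s.
Proof.
move=> ij lt; rewrite /cell_value odd_mul_tperm.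
have -> : i != j by rewrite -val_eqE/= ij neq_ltn ltnSn.
have -> : \sum_(p : 'I_n * 'I_n | (p.1 < p.2)%N) height d (tperm i j * s)%g p.1 p.2 =
    \sum_(p : 'I_n * 'I_n | (p.1 < p.2)%N) height d s p.1 p.2 + 1.
  rewrite (bigD1 (s i, s j))//= [in RHS](bigD1 (s i, s j))//= height_step// !eqxx/=.
  have -> : (s i == s j) = false by apply/eqP => e; rewrite e ltnn in lt.
  rewrite subr0 addrAC; congr (_ + _ + _); apply: eq_bigr => -[a b] /= /andP[ab].
  rewrite xpair_eqE => nab; rewrite height_step// (negPf nab) addr0.
  case: eqP => // ea; case: eqP => // eb; rewrite ?subr0//=.
  by move: ab; rewrite ea eb ltnNge (ltnW lt).
rewrite signr_addb expr1 mulN1r.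
set N := \sum_(p | _) _; set L := lambda ^ _.
rewrite opprD expfzDr// exprN1.
move: (q ^ (- N)) (q^-1) ((-1) ^+ s) L => x y z t; ring.
Qed.

Definition rot_eigenvalue : C := (-1) ^+ rot_perm n * lambda^-1.

Lemma cell_value_rot d s :
  cell_value (rot_shift d s) (rot_perm n * s)%g = rot_eigenvalue * cell_value d s.
Proof.
rewrite /cell_value height_rot sum_rot_shift// odd_permM signr_addb expfzDr// exprN1.
rewrite /rot_eigenvalue.
set N := q ^ _; set L := lambda ^ _; move: N L (lambda^-1) ((-1) ^+ _) ((-1) ^+ _).
by move=> x y z t u; ring.
Qed.

(** The Iwahori-fixed vectors of the induced representation; being fixed by a
    compact open subgroup, they are automatically smooth. *)
Definition equivariant (f : G -> C) : Prop :=
  Iwahori_invariant f /\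
  forall b g, upper_triangular b -> f (b * g)%g = delta b * f g.

Lemma monomial_upper d : upper_triangular (monomial d 1).
Proof.
move=> i j ji; rewrite monomialE perm1.
by case: eqVneq ji => [->|]; rewrite ?ltnn ?mulr0.
Qed.

Lemma iwasawa_upper g : exists b s k, [/\ upper_triangular b, Iw k & g = (b * (perm_gl K s * k))%g].
Proof.
have [u [d [s [k [[hu _] Ik ->]]]]] := iwasawa hpi g.
exists (u * monomial d 1)%g, s, k; split=> //.
  apply: (upperM hu); exact: monomial_upper.
have -> : monomial d s = (monomial d 1 * perm_gl K s)%g by rewrite monomial_perm mulg1.
by move: (monomial d 1) => w; rewrite !mulgA.
Qed.

(** There is one Iwahori-fixed vector for each cell, by the Iwasawa
    decomposition. *)
Lemma equivariant_ext (f1 f2 : G -> C) : equivariant f1 -> equivariant f2 ->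
  (forall s, f1 (perm_gl K s) = f2 (perm_gl K s)) -> f1 = f2.
Proof.
move=> [i1 b1] [i2 b2] e; apply/funext => g.
by have [b [s [k [ub Ik ->]]]] := iwasawa_upper g; rewrite b1// b2// i1// i2// e.
Qed.

(** The vector of the induced representation on which the finite Hecke algebra
    acts by its sign character. *)
Definition sign_vector (g : G) : C :=
  xget 0 [set x | exists b s k, [/\ upper_triangular b, Iw k,
    g = (b * (perm_gl K s * k))%g & x = delta b * cell_value (fun=> 0) s]]%classic.

Lemma sign_vector_cell b s k : upper_triangular b -> Iw k ->
  sign_vector (b * (perm_gl K s * k))%g = delta b * cell_value (fun=> 0) s.
Proof.
move=> ub Ik; rewrite /sign_vector; case: xgetP => [x _|]; last first.
  by move=> /(_ (delta b * cell_value (fun=> 0) s))[]; exists b, s, k.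
move=> [b' [s' [k' [ub' Ik' e ->]]]].
by have [-> /delta_eq ->] := upper_cell_unique hpi Ik Ik' ub ub' e.
Qed.

Lemma upper1 : upper_triangular (1%g : G).
Proof. by case: (@unipotent1 K n). Qed.

Lemma sign_vector_equivariant : equivariant sign_vector.
Proof.
split=> [g k Ik|b g ub]; have [b' [s [k' [ub' Ik' ->]]]] := iwasawa_upper g.
  have -> : (b' * (perm_gl K s * k') * k = b' * (perm_gl K s * (k' * k)))%g by rewrite !mulgA.
  by rewrite !sign_vector_cell//; exact: IwM.
have -> : (b * (b' * (perm_gl K s * k')) = b * b' * (perm_gl K s * k'))%g by rewrite !mulgA.
by rewrite !sign_vector_cell ?deltaM// ?mulrA//; exact: upperM.
Qed.

Lemma equivariant_unipotent f u g : equivariant f -> unipotent u -> f (u * g)%g = f g.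
Proof.
move=> [_ fb] [uu u1]; rewrite fb// delta_unit ?mul1r// => i.
by rewrite u1; exact: unit1.
Qed.

Lemma unipotent_elem (i j : 'I_n) x : (i < j)%N -> unipotent (elem i j x : G).
Proof.
move=> ij; have nij : i != j by rewrite -val_eqE neq_ltn ij.
split=> [a b ba|a]; rewrite elemE//.
  have -> : (a == b) = false by apply/eqP => e; rewrite e ltnn in ba.
  case: eqP => [ea|]; last by rewrite mulr0 addr0.
  case: eqP => [eb|]; last by rewrite mulr0 addr0.
  by move: ba; rewrite ea eb ltnNge (ltnW ij).
rewrite eqxx; case: eqP => [ea|]; last by rewrite mulr0 addr0.
case: eqP => [eb|]; last by rewrite mulr0 addr0.
by rewrite -ea -eb eqxx in nij.
Qed.

Lemma sign_vector_perm s : sign_vector (perm_gl K s) = cell_value (fun=> 0) s.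
Proof.
have := @sign_vector_cell 1%g s 1%g upper1 (@Iw1 K n).
rewrite mul1g mulg1 delta_unit ?mul1r// => i.
by rewrite gl1E eqxx; exact: unit1.
Qed.

Lemma delta_monomial d : delta (monomial d 1) = lambda ^ (\sum_i d i) *
  q ^ (- \sum_(p : 'I_n * 'I_n | (p.1 < p.2)%N) (d p.1 - d p.2)).
Proof.
have e i : v (monomial d 1 i i) = d i by rewrite monomialE perm1 eqxx mulr1 val_pi.
by rewrite deltaE; congr (_ ^ _ * _ ^ (- _)); apply: eq_bigr => i _; rewrite !e.
Qed.

Lemma sign_vector_monomial d s : sign_vector (monomial d s) = cell_value d s.
Proof.
have -> : monomial d s = (monomial d 1 * perm_gl K s)%g by rewrite monomial_perm mulg1.
have [_ ->] := sign_vector_equivariant; last exact: monomial_upper.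
rewrite sign_vector_perm delta_monomial /cell_value [\sum_(i < n) 0]big1// expr0z mulr1.
have -> : \sum_(p : 'I_n * 'I_n | (p.1 < p.2)%N) height d s p.1 p.2 =
    \sum_(p : 'I_n * 'I_n | (p.1 < p.2)%N) (d p.1 - d p.2) +
    \sum_(p : 'I_n * 'I_n | (p.1 < p.2)%N) height (fun=> 0) s p.1 p.2.
  by rewrite -big_split/=; apply: eq_bigr => p _; rewrite /height subrr add0r.
rewrite opprD expfzDr//.
set N := q ^ _; set M := q ^ _; set L := lambda ^ _; move: N M L ((-1) ^+ s).
by move=> x y z t; ring.
Qed.

Lemma equivariant_sum (I : finType) (f : I -> G -> C) :
  (forall i b g, upper_triangular b -> f i (b * g)%g = delta b * f i g) ->
  forall b g, upper_triangular b -> \sum_i f i (b * g)%g = delta b * \sum_i f i g.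
Proof.
by move=> h b g ub; rewrite mulr_sumr; apply: eq_bigr => i _; rewrite h.
Qed.

Section Reflection.
Variables (i j : 'I_n).
Hypothesis ij : j = i.+1 :> nat.

Let nij : i != j. Proof. by rewrite -val_eqE/= ij neq_ltn ltnSn. Qed.

(** In rank one: (1 x; 0 1)(0 1; 1 0) = (1 0; 1/x 1)(x 1; 0 -1/x). *)
Lemma refl_rep_opposite (x : residue K) : x != 0 -> exists k, Iw k /\
  (refl_rep i j x * perm_gl K (tperm i j) = elem j i (digit x)^-1 * k)%g.
Proof.
move=> x0; have ux := digit_unit x0; have [dx0 _] := ux; have nji : j != i by rewrite eq_sym.
set y := (digit x)^-1; have uy : integer_unit y := unitV ux.
pose A := (refl_rep i j x * perm_gl K (tperm i j))%g.
pose k := (elem j i (- y) * A)%g.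
have AE (a b : 'I_n) : A a b = if a == i then (b == j)%:R + digit x * (b == i)%:R
    else if a == j then (b == i)%:R else (a == b)%:R.
  have tE c : (c == tperm i j b) = (b == tperm i j c).
    by rewrite -(inj_eq (@perm_inj _ (tperm i j))) tpermK eq_sym.
  rewrite /A elem_mul// !perm_glE !tE tpermR.
  have [->|ai] := eqVneq a i; first by rewrite tpermL mul1r.
  rewrite mul0r addr0; have [->|aj] := eqVneq a j; first by rewrite tpermR.
  by rewrite tpermD 1?eq_sym// eq_sym.
have kE (a b : 'I_n) : k a b = if a == i then (b == j)%:R + digit x * (b == i)%:R
    else if a == j then - y * (b == j)%:R else (a == b)%:R.
  rewrite /k elem_mul// !AE eqxx; have [->|ai] := eqVneq a i.
    by rewrite (negPf nij) mul0r addr0.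
  have [_|aj] := eqVneq a j; last by rewrite mul0r addr0.
  by rewrite mul1r mulrDr mulrA [X in X * (b == i)%:R]mulNr mulVf// mulN1r addrCA subrr addr0.
exists k; split; last first.
  have -> : (elem j i y = (elem j i (- y))^-1)%g; last by rewrite /k mulKg.
  apply/esym/mulg1_eq/glP => a b; rewrite elem_mul// !elemE// gl1E (negPf nij) /= mulr0 addr0.
  rewrite (eq_sym i b); case: (a == j); case: (b == i); rewrite /= ?mulr1 ?mulr0 ?mul0r ?addr0 ?mul1r//.
  by rewrite -addrA subrr addr0.
apply/IwP; split=> [a b|a]; rewrite kE; last first.
  have [->|ai] := eqVneq a i; first by rewrite (negPf nij) add0r mulr1.
  have [_|aj] := eqVneq a j; last by rewrite eqxx; exact: unit1.
  by rewrite mulr1 -mulN1r; apply: (unitMsign true uy).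
rewrite /iw_height; have [->|ai] := eqVneq a i.
  have [->|bj] := eqVneq b j; first by rewrite eq_sym (negPf nij) mulr0 addr0 ij ltnNge leqnSn; exact: vge1.
  by rewrite add0r; have [->|bi] := eqVneq b i; rewrite ?mulr1 ?ltnn ?mulr0.
have [->|aj] := eqVneq a j.
  have [->|bj] := eqVneq b j; last by rewrite mulr0.
  by rewrite mulr1 ltnn; apply/vgeN/unit_vge.
by have [->|ab] := eqVneq a b; rewrite ?ltnn.
Qed.

(** By equivariance it is enough to evaluate at permutation matrices s.  If the
    root (i, j) is sent by s to a positive root, the q terms are equal; if not,
    the term of x = 0 is in the cell of s (i j), and the q - 1 others are moved
    by [refl_rep_opposite] into the cell of s. *)
Lemma sign_vector_refl g :
  \sum_(x : residue K) sign_vector (g * refl_rep i j x * perm_gl K (tperm i j))%g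
  = - sign_vector g.
Proof.
have [svI svB] := sign_vector_equivariant.
pose f g := \sum_(x : residue K) sign_vector (g * refl_rep i j x * perm_gl K (tperm i j))%g.
suff : f = (fun g => - sign_vector g) by move/(congr1 (fun F => F g)).
have pU s x : (s i < s j)%N -> exists2 u, unipotent u &
    (perm_gl K s * refl_rep i j x * perm_gl K (tperm i j) = u * perm_gl K (tperm i j * s))%g.
  move=> lt; exists (elem (s i) (s j) (pi ^ (0 - 0) * digit x)); first exact: unipotent_elem.
  rewrite (perm_monomial hpi s) (monomial_conj_elem hpi (digit x) (fun=> 0) s nij).
  by rewrite -mulgA monomial_perm -perm_monomial.
apply: equivariant_ext; first split.
- move=> h k Ik; rewrite /f.
  have inv (y u : G) : stab (perm_gl K (tperm i j)) u ->
      sign_vector (y * u * perm_gl K (tperm i j))%g = sign_vector (y * perm_gl K (tperm i j))%g.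
    move=> [_ Iu]; rewrite -[RHS](svI _ _ Iu); congr sign_vector.
    by rewrite !mulgA mulgK.
  have := sum_coset_reps_mulr h (@Iw_subgroup K n) (stab_subgroup _)
    (coset_reps_refl hpi ij) inv Ik.
  have bE (F : residue K -> C) : \sum_(x <- enum (residue K)) F x = \sum_x F x.
    by rewrite big_enum.
  by move=> e; rewrite /f -!bE; move: e; rewrite big_map => ->; rewrite big_map.
- apply: equivariant_sum => x b h ub; rewrite -svB//; congr sign_vector.
  by rewrite !mulgA.
- by split=> [h k Ik|b h ub]; [rewrite (svI _ _ Ik)|rewrite svB// mulrN].
have fasc s : (s i < s j)%N -> f (perm_gl K s) = q * cell_value (fun=> 0) (tperm i j * s)%g.
  move=> lt; rewrite /f (eq_bigr (fun=> cell_value (fun=> 0) (tperm i j * s)%g)) => [|x _].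
    by rewrite sumr_const -mulr_natl.
  have [u uu ->] := pU s x lt.
  by rewrite (equivariant_unipotent _ sign_vector_equivariant uu) sign_vector_perm.
move=> s; rewrite sign_vector_perm.
have sij : s i != s j :> nat by rewrite val_eqE (inj_eq perm_inj).
case: (ltngtP (s i) (s j)) sij => // [lt|gt] _.
  by rewrite fasc// cell_value_step// mulNr mulrN mulrA divff// mul1r.
pose s' := (tperm i j * s)%g.
have s's : s = (tperm i j * s')%g by rewrite /s' mulgA tperm2 mul1g.
have e1 : cell_value (fun=> 0) s = - q^-1 * cell_value (fun=> 0) s'.
  by rewrite {1}s's cell_value_step// /s' !permM tpermL tpermR.
rewrite /f (bigD1 0)//= (eq_bigr (fun=> cell_value (fun=> 0) s)); last first.
  move=> x x0; rewrite -mulgA; have [k [Ik ->]] := refl_rep_opposite x0.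
  rewrite mulgA (svI _ _ Ik); have nji : j != i by rewrite eq_sym.
  rewrite (perm_monomial hpi s) (monomial_conj_elem hpi _ (fun=> 0) s nji).
  rewrite (equivariant_unipotent _ sign_vector_equivariant); last exact: unipotent_elem.
  by rewrite -perm_monomial sign_vector_perm.
have -> : refl_rep i j (0 : residue K) = 1%g.
  by apply: glP => a b; rewrite elemE// digit0 mul0r addr0 gl1E.
rewrite mulg1 perm_glM sign_vector_perm -/s'.
rewrite sumr_const; have -> : #|[pred x : residue K | x != 0]| = #|residue K|.-1.
  by rewrite -(cardC1 (0 : residue K)); apply: eq_card.
have -> : cell_value (fun=> 0) s' = - q * cell_value (fun=> 0) s.
  by rewrite e1 mulrA mulrNN divff// mul1r.
rewrite -mulr_natl -subn1 natrB; last exact: ltnW (res_card_gt1 K).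
by rewrite /res_card; ring.
Qed.

End Reflection.

Lemma sign_vector_rot g : sign_vector (g * rotation)%g = rot_eigenvalue * sign_vector g.
Proof.
have [svI svB] := sign_vector_equivariant.
suff : (fun g => sign_vector (g * rotation)%g) = (fun g => rot_eigenvalue * sign_vector g).
  by move/(congr1 (fun F => F g)).
apply: equivariant_ext.
- split=> [h k Ik|b h ub]; last first.
    by move: rotation => r; rewrite -mulgA (svB b).
  have Ik' : Iw (rotation^-1 * k * rotation)%g by apply/rotation_conj_Iw.
  rewrite -[RHS](svI _ _ Ik'); congr sign_vector.
  by move: rotation => r; rewrite !mulgA mulgK.
- by split=> [h k Ik|b h ub]; [rewrite (svI _ _ Ik)|rewrite svB// mulrCA].
move=> s; rewrite {1}(perm_monomial hpi s) monomial_rot sign_vector_monomial cell_value_rot.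
by rewrite sign_vector_perm.
Qed.

End SignVector.

(** * Iwahori-fixed vectors in subrepresentations *)

Section FixedVectors.
Variables (K : localField) (pi : K) (hpi : uniformizer pi) (n : nat).
Variables (C : fieldType) (hC : [pchar C] =i pred0).
Variables (lambda : C) (hlambda : lambda != 0).
Local Notation v := (@lf_val K).
Local Notation vge := (vge v).
Local Notation G := (GL K n).
Local Notation Iw := (@Iwahori K n).
Local Notation monomial := (monomial hpi).
Local Notation delta := (delta lambda).
Implicit Types (d : 'I_n -> int) (s : 'S_n) (g h k b : G).

Lemma smooth_level (f : G -> C) : smooth f ->
  exists m, forall g u, congruence m u -> f (g * u)%g = f g.
Proof.
move=> [U [[U1 _] _ oU fU]]; have [m hm] := oU _ U1.
exists `|m|%N => g u [_ hu]; apply: fU; apply: hm => i j; rewrite gl1E.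
by apply: vge_le (hu i j); rewrite abszE ler_norm.
Qed.

Lemma congruence_le m m' g : (m <= m')%N -> congruence m' g -> congruence m g.
Proof. by move=> le [Ig h]; split=> // i j; apply: vge_le (h i j); rewrite lez_nat. Qed.

Lemma subrep_sum (V S : set (G -> C)) (I : Type) (r : seq I) (f : I -> G -> C) :
  subrepresentation V S -> (forall i, S (f i)) -> S (fun g => \sum_(i <- r) f i g).
Proof.
move=> [_ S0 SD _] hf; elim: r => [|i r IH].
  by rewrite (_ : (fun _ => _) = (fun=> 0))//; apply/funext => g; rewrite big_nil.
have := SD 1 _ _ (hf i) IH; congr S; apply/funext => g.
by rewrite big_cons mul1r.
Qed.

Lemma subrepZ (V S : set (G -> C)) a f :
  subrepresentation V S -> S f -> S (fun g => a * f g).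
Proof.
move=> [_ S0 SD _] hf; have := SD a _ _ hf S0; congr S; apply/funext => g.
by rewrite addr0.
Qed.

Lemma shear_col_unipotent (r : 'I_n) (p : 'I_n -> K) :
  (forall i : 'I_n, (r <= i)%N -> p i = 0) -> (forall i, vge 0 (p i)) ->
  \sum_i (i == r)%:R * p i = 0 /\
  unipotent (shear p (fun i => (i == r)%:R)) /\ Iw (shear p (fun i => (i == r)%:R)).
Proof.
move=> p0 hp; have qp : \sum_i (i == r)%:R * p i = 0 by rewrite sum_deltal p0.
have off (i j : 'I_n) : (j <= i)%N -> p i * (j == r)%:R = 0.
  move=> ji; have [ej|_] := eqVneq j r; last by rewrite mulr0.
  by rewrite p0 ?mul0r// -ej.
split=> //; split.
  split=> [i j ji|i]; rewrite shearE//; last by rewrite off// eqxx addr0.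
  by rewrite off 1?ltnW// addr0; case: eqVneq ji => // ->; rewrite ltnn.
apply/IwP; split=> [i j|i]; rewrite shearE//; last by rewrite off// eqxx addr0; exact: unit1.
apply: vgeD; first by rewrite -gl1E; exact: ((IwP _).1 (@Iw1 K n)).1.
rewrite /iw_height; case: (ltnP j i) => [ji|_]; first by rewrite off// ltnW.
by case: eqVneq => _; rewrite ?mulr1 ?mulr0.
Qed.

(** One half of the Iwahori factorization, by clearing the columns from the last
    to the first; the pivots are units. *)
Lemma Iw_lower z : Iw z -> exists u z' : G, [/\ unipotent u, Iw z',
  forall i j : 'I_n, (i < j)%N -> z' i j = 0 & z = (u * z')%g].
Proof.
suff main m : (m <= n)%N -> forall z : G, Iw z ->
    (forall i j : 'I_n, (i < j)%N -> (m <= j)%N -> z i j = 0) ->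
    exists u z' : G, [/\ unipotent u, Iw z',
      forall i j : 'I_n, (i < j)%N -> z' i j = 0 & z = (u * z')%g].
  move=> Iz; apply: (main n) => // i j _; by rewrite leqNgt ltn_ord.
elim: m => [|m IH] lm {}z Iz hz.
  exists 1%g, z; split=> //; [exact: unipotent1|by move=> i j ij; exact: hz|by rewrite mul1g].
pose r := Ordinal lm; have [r0 _] := Iw_diag r Iz.
pose p (i : 'I_n) : K := if (i < r)%N then z i r / z r r else 0.
have [|i|qp [uS IS]] := @shear_col_unipotent r p.
- by move=> i ri; rewrite /p ltnNge ri.
- rewrite /p; case: ifP => // _; rewrite -[0]addr0; apply: vgeM; first exact: Iw_int.
  exact/unit_vge/unitV/Iw_diag.
pose z1 := ((shear p (fun i => (i == r)%:R))^-1 * z)%g.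
have z1E i j : z1 i j = z i j - p i * z r j.
  by rewrite /z1 shearV// shearM; [rewrite sum_deltal mulNr|exact: shearN].
have [||i j ij mj|u [z' [hu Iz' lz' ez]]] := IH _ z1.
- exact: ltnW.
- by apply: IwM => //; apply: IwV.
- rewrite z1E; have [ej|nej] := eqVneq (j : nat) m.
    have ejr : j = r by apply/val_inj.
    by rewrite ejr /p; rewrite ejr in ij; rewrite ij divfK// subrr.
  have mj' : (m < j)%N by rewrite ltn_neqAle eq_sym nej.
  by rewrite hz// (hz r)// mulr0 subr0.
exists (shear p (fun i => (i == r)%:R) * u)%g, z'; split=> //; first exact: unipotentM.
by rewrite -mulgA -ez /z1 mulVKg.
Qed.

(** Averaging a translate of f by a very dominant diagonal matrix gives a
    nonzero Iwahori-fixed vector: all the terms of the sum at 1 are equal. *)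
Lemma fixed_vector (S : set (G -> C)) f :
  subrepresentation (induced_delta lambda) S -> S f -> f 1%g != 0 ->
  exists f', [/\ S f', equivariant lambda f' & f' 1%g != 0].
Proof.
move=> sS Sf f1; have [/(_ _ Sf)[sf fb] _ _ SR] := sS.
have [m0 fm0] := smooth_level sf.
pose m := m0.+1; have fm g u : congruence m u -> f (g * u)%g = f g.
  by move=> /(congruence_le (leqnSn _)); exact: fm0.
(* conjugation by t^-1 sends the lower triangular part of Iw to level m *)
pose d (i : 'I_n) : int := ((n - i) * m)%N%:Z; pose t := monomial d 1.
have dlt (i j : 'I_n) : (i < j)%N -> m%:Z <= d i - d j.
  by move=> ij; rewrite /d; have := ltn_ord j; nia.
have dM (i j : 'I_n) : d i - d j <= (n * m)%N%:Z by rewrite /d; have := ltn_ord j; nia.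
(* t conjugates level m onto a subgroup containing level M *)
pose M := (m + n * m)%N.
have [zs rz] := congruence_reps hpi n M; have [hz cz] := rz.
pose f' x := \sum_(z <- zs) f (x * z * t)%g.
have tE u i j : (t^-1 * u * t)%g i j = pi ^ (d j - d i) * u i j.
  by rewrite /t monomial_conjE !perm1.
have close1 (u : G) : (forall i j, vge m%:Z (u i j - (i == j)%:R)) -> congruence m u.
  move=> hu; split=> //; apply: (Iw_close (@Iw1 K n)) => i j.
  by rewrite gl1E; apply: vge_le (hu i j).
have FI x u : congruence M u -> f (x * u * t)%g = f (x * t)%g.
  move=> [Iu hu]; have -> : (x * u * t = x * t * (t^-1 * u * t))%g.
    by rewrite /t; move: (monomial _ _) => w; rewrite !mulgA mulgK.
  apply/fm/close1 => i j; rewrite tE; have [->|nij] := eqVneq i j.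
    rewrite subrr mul1r; have := hu j j; rewrite eqxx; apply: vge_le.
    by rewrite /M lez_nat leq_addr.
  rewrite subr0; have := hu i j; rewrite (negPf nij) subr0.
  move=> hM; apply: (vgeMl (uniformizer_vge _ hpi) hM).
  by have := dM i j; rewrite /M PoszD; lia.
have Sf' : S f'.
  apply: (subrep_sum _ sS) => z; have := SR (z * t)%g f Sf; congr S; apply/funext => x.
  by rewrite /right_translate mulgA.
exists f'; split=> //.
- split=> [x k Ik|b x ub].
    exact: (sum_coset_reps_mulr x (@Iw_subgroup K n) (@congruence_subgroup K n M) rz FI Ik).
  rewrite /f' mulr_sumr; apply: eq_bigr => z _; rewrite -fb//; congr f.
  by move: (t) => t'; rewrite !mulgA.
have term z : Iw z -> f (1 * z * t)%g = delta t * f 1%g.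
  move=> /Iw_lower[u [z' [hu Iz' lz' ->]]]; rewrite mul1g.
  have -> : (u * z' * t = u * (t * (t^-1 * z' * t)))%g.
    by move: (t) => t'; rewrite !mulgA mulgK.
  have ut : upper_triangular t by exact: monomial_upper.
  rewrite (fb u); last by case: hu.
  rewrite (fb t)// (delta_unit hC) ?mul1r; last by move=> i; case: hu => _ ->; exact: unit1.
  congr (_ * _); set y := (t^-1 * z' * t)%g.
  pose b0 : 'M[K]_n := \matrix_(i, j) ((i == j)%:R * z' i i).
  have bb : bounded (@iw_height n) b0.
    split=> [i j|i]; rewrite mxE; last by rewrite eqxx mul1r; exact: Iw_diag.
    have [->|_] := eqVneq i j; last by rewrite mul0r.
    by rewrite mul1r /iw_height ltnn; exact: Iw_int.
  have [eb Ib] := Iw_toGL bb; pose b := toGL b0.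
  have bE i j : b i j = (i == j)%:R * z' i i by rewrite eb mxE.
  have yb i j : vge m%:Z (y i j - b i j).
    rewrite tE bE; case: (ltngtP i j) => [ij|ji|/val_inj ->].
    - by rewrite lz'// mulr0 -val_eqE/= ltn_eqF// mul0r subr0.
    - rewrite -val_eqE/= gtn_eqF// mul0r subr0 -[m%:Z]addr0.
      apply: vgeM; last exact: Iw_int.
      by apply: vge_le (uniformizer_vge _ hpi); exact: dlt.
    by rewrite subrr eqxx expr0z subrr.
  have Iy : Iw y by apply: (Iw_close Ib) => i j; apply: vge_le (yb i j).
  have -> : y = (b * (b^-1 * y))%g by rewrite mulVKg.
  rewrite fb; last first.
    by move=> i j ji; rewrite bE -val_eqE/= gtn_eqF// mul0r.
  rewrite (delta_unit hC) ?mul1r => [|i]; last by rewrite bE eqxx mul1r; exact: Iw_diag.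
  by rewrite -[(_^-1 * _)%g]mul1g fm//; apply/congruence_close.
rewrite /f' big_seq (eq_bigr (fun=> delta t * f 1%g)) => [|z /hz Iz]; last exact: term.
rewrite -big_seq big_const_seq count_predT iter_addr_0 -mulr_natl.
apply: mulf_neq0; last apply: mulf_neq0 => //.
  have /pcharf0P -> := hC; have := cz _ (@Iw1 K n); by case: (zs).
have q0 : res_card K C != 0 by exact: res_card_neq0.
by rewrite deltaE// mulf_neq0// expfz_neq0.
Qed.

End FixedVectors.

(** * The sign vector lies in every nonzero subrepresentation *)

Section PermOrder.
Variable n : nat.
Implicit Types s t : 'S_n.

(** The order in which the cells are met by the Hecke operators below. *)
Definition precedes t s := exists m : 'I_n,
  (forall i : 'I_n, (m < i)%N -> t^-1%g i = s^-1%g i) /\ (s^-1%g m < t^-1%g m)%N.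

Lemma precedes_total s t : s != t -> precedes s t \/ precedes t s.
Proof.
move=> nst; have [m0 m0P] : exists m : 'I_n, t^-1%g m != s^-1%g m.
  apply: contrapT => ne; case/eqP: nst; apply: (can_inj (@invgK _)); apply/permP => i.
  by apply/esym/eqP/negPn/negP => h; apply: ne; exists i.
case: (@arg_maxnP _ m0 (fun r : 'I_n => t^-1%g r != s^-1%g r) (fun r : 'I_n => r : nat) m0P)
  => m mP mmax.
have tl (i : 'I_n) : (m < i)%N -> t^-1%g i = s^-1%g i.
  move=> mi; apply/eqP/negPn/negP => /mmax h; have : (i <= m)%N := h.
  by rewrite leqNgt mi.
case: (ltngtP (s^-1%g m) (t^-1%g m)) => [lt|gt|/val_inj/esym/eqP].
- by right; exists m.
- by left; exists m; split=> // i /tl.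
by rewrite (negPf mP).
Qed.

Lemma one_precedes s : s != 1%g -> precedes 1%g s.
Proof.
move=> /precedes_total[[m [h lt]]|//].
move: lt; rewrite invg1 perm1 ltnNge; case/negP; rewrite leqNgt; apply/negP => lt.
have : s^-1%g (s^-1%g m) = s^-1%g m by rewrite h// invg1 perm1.
by move/perm_inj => e; rewrite e ltnn in lt.
Qed.

(** The base n number of digits t^-1(0), ..., t^-1(n-1). *)
Definition rank s : nat := \sum_(i < n) s^-1%g i * n ^ i.

Lemma sum_digits_lt (f : 'I_n -> 'I_n) m :
  (m <= n)%N -> (\sum_(i < n | (i < m)%N) f i * n ^ i < n ^ m)%N.
Proof.
elim: m => [|m IH] lm; first by rewrite big1.
rewrite (bigD1 (Ordinal lm))//=.
rewrite (eq_bigl (fun i : 'I_n => (i < m)%N)); last first.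
  by move=> i; rewrite -val_eqE/= ltnS andbC -ltn_neqAle.
have := IH (ltnW lm); have := ltn_ord (f (Ordinal lm)); rewrite expnS => h1 h2.
apply: leq_trans (leq_mul h1 (leqnn (n ^ m))); rewrite mulSn addnC.
by rewrite -addSn leq_add2r.
Qed.

Lemma precedes_rank s t : precedes t s -> (rank s < rank t)%N.
Proof.
move=> [m [h lt]]; rewrite /rank (bigID (fun i : 'I_n => (i < m)%N))/=.
rewrite [X in (_ < X)%N](bigID (fun i : 'I_n => (i < m)%N))/=.
have split_m (F : 'I_n -> nat) : (\sum_(i < n | ~~ (i < m)) F i
    = F m + \sum_(i < n | (m < i)) F i)%N.
  rewrite (bigD1 m) ?ltnn//=; congr addn; apply: eq_bigl => i.
  by rewrite -leqNgt [RHS]ltn_neqAle andbC eq_sym.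
rewrite !split_m [X in (_ < _ + (_ + X))%N](eq_bigr (fun i : 'I_n => s^-1%g i * n ^ i)%N); last first.
  by move=> i /h->.
have := sum_digits_lt (fun i => s^-1%g i) (ltnW (ltn_ord m)).
have := leq_mul lt (leqnn (n ^ m)); rewrite mulSn /=.
move: (\sum_(i < n | (i < m)%N) s^-1%g i * n ^ i)%N => A.
move: (\sum_(i < n | (i < m)%N) t^-1%g i * n ^ i)%N => B.
move: (\sum_(i < n | (m < i)%N) s^-1%g i * n ^ i)%N => D.
move: (s^-1%g m * n ^ m)%N (t^-1%g m * n ^ m)%N (n ^ m)%N => *; lia.
Qed.

Lemma rank_inj : injective rank.
Proof.
move=> s t e; apply/eqP/negPn/negP => /precedes_total[] /precedes_rank;
  by rewrite e ltnn.
Qed.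

End PermOrder.

Lemma sum_indicator (T : finType) (P : pred T) :
  \sum_p (P p : nat)%:Z = #|P|%:Z.
Proof.
rewrite -sum1_card (big_morph Posz PoszD (erefl _)) [RHS]big_mkcond/=.
by apply: eq_bigr => p _; rewrite unfold_in; case: (P p).
Qed.

Lemma natr_inj_pchar0 (C : fieldType) : [pchar C] =i pred0 ->
  injective (fun m : nat => m%:R : C).
Proof.
move=> /pcharf0P P0 m p; wlog le : m p / (m <= p)%N.
  by move=> h e; case: (leqP m p) => [/h|/ltnW/h]; [exact|move=> ->].
move=> /esym/eqP; rewrite -subr_eq0 -natrB// P0 subn_eq0 => le'.
by apply/eqP; rewrite eqn_leq le.
Qed.

Section MinusculeOperator.
Variables (K : localField) (pi : K) (hpi : uniformizer pi) (n : nat).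
Variables (C : fieldType) (hC : [pchar C] =i pred0).
Variables (lambda : C) (hlambda : lambda != 0).
Local Notation v := (@lf_val K).
Local Notation vge := (vge v).
Local Notation G := (GL K n).
Local Notation Iw := (@Iwahori K n).
Local Notation monomial := (monomial hpi).
Local Notation delta := (delta lambda).
Local Notation q := (res_card K C).
Local Notation equivariant := (equivariant lambda).
Local Notation sign_vector := (@sign_vector K n C lambda).
Implicit Types (s t : 'S_n) (g h k b : G).

Let q0 : q != 0. Proof. exact: res_card_neq0. Qed.

Variable c0 : nat.

(** The Hecke operators of the fundamental coweights; for them the cosets with a
    given cell are counted by block unipotent matrices over the residue field,
    which commute. *)
Definition coweight (i : 'I_n) : int := ((i < c0)%N : nat)%:Z.
Local Notation d := coweight.
Local Notation t0 := (monomial coweight 1).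

Lemma coweight_dec (i j : 'I_n) : (i <= j)%N -> d j <= d i.
Proof. by rewrite /d; lia. Qed.

Definition in_cell s g := exists b k, [/\ upper_triangular b, Iw k & g = (b * (perm_gl K s * k))%g].

Definition cell_count s (ys : seq G) := count (fun y => `[< in_cell s (perm_gl K s * y * t0)%g >]) ys.

Definition cell_weight s : C := lambda ^ (\sum_i d i) *
  q ^ (- \sum_(p : 'I_n * 'I_n | (p.1 < p.2)%N) (d (s^-1%g p.1) - d (s^-1%g p.2))).

(** By [cell_mul_dominant], the value at s of the transform depends on f only
    through its values at s and at the cells that precede s. *)
Lemma minuscule_triangular (ys : seq G) (f : G -> C) s :
  (forall y, y \in ys -> Iw y) -> equivariant f ->
  (forall t, (rank s < rank t)%N -> f (perm_gl K t) = 0) ->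
  \sum_(y <- ys) f (perm_gl K s * y * t0)%g
  = (cell_count s ys)%:R * cell_weight s * f (perm_gl K s).
Proof.
move=> hy [fI fB] f0; rewrite /cell_count -sum1_count natr_sum -mulrA mulr_suml.
rewrite [RHS]big_mkcond/= !big_seq; apply: eq_bigr => y yys.
have cellE b k t : upper_triangular b -> Iw k ->
    (perm_gl K s * y * t0 = b * (perm_gl K t * k))%g ->
    (t = s /\ forall i, v (b i i) = d (s^-1%g i)) \/ precedes t s.
  by move=> ub Ik e; apply: (cell_mul_dominant (hy y yys) Ik ub coweight_dec e).
case: asboolP => [[b [k [ub Ik e]]]|nc].
  rewrite mul1r e fB// (fI _ _ Ik); congr (_ * _).
  have [[_ vb]|/precedes_rank] := cellE b k s ub Ik e; last by rewrite ltnn.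
  rewrite deltaE// /cell_weight (eq_bigr _ (fun i _ => vb i)) (sum_perm s^-1%g d).
  by congr (_ * _ ^ (- _)); apply: eq_bigr => p _; rewrite !vb.
have [b [t [k [ub Ik e]]]] := iwasawa_upper hpi (perm_gl K s * y * t0)%g.
rewrite e fB// (fI _ _ Ik); have [[ets _]|/precedes_rank lt] := cellE b k t ub Ik e.
  by case: nc; exists b, k; split=> //; rewrite e ets.
by rewrite f0// mulr0.
Qed.

Section Count.
Variables (s : 'S_n) (ys : seq G).
Hypothesis rys : coset_reps Iw (stab t0) ys.

Definition ascents : pred ('I_n * 'I_n) :=
  fun p => [&& (p.1 < c0)%N, (c0 <= p.2)%N & (s p.1 < s p.2)%N].

Definition block_rep (X : {ffun 'I_n * 'I_n -> residue K}) : G :=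
  toGL (\matrix_(i, j) ((i == j)%:R + if ascents (i, j) then digit (X (i, j)) else 0)).

Lemma ascents_lt i j : ascents (i, j) -> (i < j)%N.
Proof. by move=> /and3P[/= h1 h2 _]; apply: leq_trans h2. Qed.

Lemma block_repP X : Iw (block_rep X) /\ forall i j, block_rep X i j =
   (i == j)%:R + if ascents (i, j) then digit (X (i, j)) else 0.
Proof.
have [|e I] := @Iw_toGL K n
    (\matrix_(i, j) ((i == j)%:R + if ascents (i, j) then digit (X (i, j)) else 0)).
  split=> [i j|i]; rewrite mxE; last first.
    case: ifP => [/ascents_lt|_]; first by rewrite ltnn.
    by rewrite eqxx addr0; exact: unit1.
  apply: vgeD; first by rewrite -gl1E; exact: ((IwP _).1 (@Iw1 K n)).1.
  case: ifP => // /ascents_lt ij; rewrite /iw_height ltnNge (ltnW ij); exact: digit_int.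
by split=> // i j; rewrite e mxE.
Qed.

Lemma block_rep_cell X : in_cell s (perm_gl K s * block_rep X * t0)%g.
Proof.
have [IX XE] := block_repP X.
pose u := (perm_gl K s * block_rep X * (perm_gl K s)^-1)%g.
have eu : (perm_gl K s * block_rep X = u * perm_gl K s)%g by rewrite /u mulgVK.
have uE i j : u i j = block_rep X (s^-1%g i) (s^-1%g j).
  have := congr1 (fun g : G => g i (s^-1%g j)) eu.
  rewrite (perm_monomial hpi) mul_monomial monomial_mul !expr0z mul1r mulr1 permKV.
  by move=> ->.
exists (u * monomial (fun i => d (s^-1%g i)) 1)%g, 1%g; split; last 1 first.
- have e : (perm_gl K s * t0 = monomial (fun i => d (s^-1%g i)) 1 * perm_gl K s)%g.
    rewrite (perm_monomial hpi) !monomialM; congr monomial; last by rewrite mul1g mulg1.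
    by apply/funext => i; rewrite add0r addr0.
  rewrite eu mulg1; move: e; move: (u) (t0) (monomial (fun i => d (s^-1%g i)) 1) (perm_gl K s) => x a b c e.
  by rewrite -!mulgA e.
- suff uu : upper_triangular u by apply: (upperM uu); exact: monomial_upper.
  move=> i j ji; rewrite uE XE.
  rewrite (inj_eq perm_inj) -val_eqE/= gtn_eqF// add0r; case: ifP => // /and3P[_ _] /=.
  by rewrite !permKV ltnNge (ltnW ji).
exact: Iw1.
Qed.

(** Reduction of the product modulo the maximal ideal is addition of blocks. *)
Lemma block_rep_inj X X' : stab t0 ((block_rep X)^-1 * block_rep X')%g ->
  forall p, ascents p -> X p = X' p.
Proof.
have [z zE] : exists z, z = ((block_rep X)^-1 * block_rep X')%g by eexists.
rewrite -zE => -[_ /monomial_conj_Iw[hz _]] [a b] pab.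
have [_ XE] := block_repP X; have [_ XE'] := block_repP X'.
have ez : block_rep X' = (block_rep X * z)%g by rewrite zE mulVKg.
have low (l c : 'I_n) : (c0 <= l)%N -> z l c = (l == c)%:R.
  move=> cl; have na j : ascents (l, j) = false by rewrite /ascents/= ltnNge cl.
  have : block_rep X' l c = (block_rep X * z)%g l c by rewrite -ez.
  rewrite XE' na addr0 => ->.
  rewrite glME (bigD1 l)//= XE eqxx na addr0 mul1r big1 ?addr0// => j jl.
  by rewrite XE na addr0 eq_sym (negPf jl) mul0r.
have ab := ascents_lt pab; have /and3P[/= ac cb _] := pab.
have e : digit (X' (a, b)) = z a b + digit (X (a, b)).
  have : block_rep X' a b = (block_rep X * z)%g a b by rewrite -ez.
  rewrite XE' pab -val_eqE/= ltn_eqF// add0r => ->.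
  rewrite glME; under eq_bigr do rewrite XE mulrDl.
  rewrite big_split/=; congr (_ + _).
    rewrite (bigD1 a)//= eqxx mul1r big1 ?addr0// => j ja.
    by rewrite eq_sym (negPf ja) mul0r.
  rewrite (bigD1 b)//= pab low// eqxx mulr1 big1 ?addr0// => j jb.
  case: ifP => [/and3P[_ /= cj _]|_]; last by rewrite mul0r.
  by rewrite low// (negPf jb) mulr0.
rewrite -[X _]digitK -[X' _]digitK; apply/esym/red_eq => //.
rewrite e addrK; have := hz a b; rewrite /height /d ac ltnNge cb invg1 !perm1.
by rewrite ltnNge (ltnW ab).
Qed.

(** The unipotent matrices above the diagonal which s keeps above the diagonal
    give distinct cosets in the cell of s. *)
Lemma cell_count_ge : (#|residue K| ^ #|ascents| <= cell_count s ys)%N.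
Proof.
have [hy cy] := rys.
have ex X : {y | y \in ys /\ stab t0 (y^-1 * block_rep X)%g}.
  apply: cid; have [IX _] := block_repP X.
  have : has (fun y => `[< stab t0 (y^-1 * block_rep X)%g >]) ys by rewrite has_count cy.
  by move=> /hasP[y yy /asboolP hs]; exists y.
pose A := pffun_on (0 : residue K) ascents predT.
have <- : #|A| = (#|residue K| ^ #|ascents|)%N by rewrite card_pffun_on.
pose F X := sval (ex X).
rewrite /cell_count -size_filter cardE -(size_map F).
apply: uniq_leq_size; last first.
  move=> _ /mapP[X _ ->]; have [yy [Is Is']] := svalP (ex X); rewrite mem_filter yy andbT.
  apply/asboolP; have [b [k [ub Ik e]]] := block_rep_cell X.
  exists b, (k * (t0^-1 * ((F X)^-1 * block_rep X) * t0)^-1)%g; split=> //.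
    by apply: IwM => //; exact: IwV.
  move: e; move: (t0) (F X) (block_rep X) (perm_gl K s) => t y x p e.
  rewrite [RHS](_ : _ = (b * (p * k)) * (t^-1 * (y^-1 * x) * t)^-1)%g; last by rewrite !mulgA.
  by rewrite -e !invgM !invgK !mulgA !mulgK.
rewrite map_inj_in_uniq ?enum_uniq// => X X'; rewrite !mem_enum => XA XA' eF.
have [_ h1] := svalP (ex X); have [_ h2] := svalP (ex X').
rewrite -/(F X) in h1; rewrite -/(F X') -eF in h2.
have gS := stab_subgroup t0.
have := sgM gS (sgV gS h1) h2; rewrite invgM invgK -mulgA mulVKg => /block_rep_inj h.
apply/ffunP => p; case: (boolP (ascents p)) => [/h//|np].
move: XA XA' => /pffun_onP[/supportP s1 _] /pffun_onP[/supportP s2 _].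
by rewrite s1// s2.
Qed.

Definition descents : pred ('I_n * 'I_n) :=
  fun p => [&& (p.1 < c0)%N, (c0 <= p.2)%N & (s p.2 < s p.1)%N].

(** The modulus character at the conjugate of the coweight under s counts the
    ascents of s across the block minus its descents. *)
Lemma sum_coweight_perm :
  \sum_(p : 'I_n * 'I_n | (p.1 < p.2)%N) (d (s^-1%g p.1) - d (s^-1%g p.2))
  = #|ascents|%:Z - #|descents|%:Z.
Proof.
pose h (p : 'I_n * 'I_n) := (s p.1, s p.2).
have hi : injective h by move=> [a b] [a' b'] [/perm_inj-> /perm_inj->].
rewrite (reindex_inj hi)/=.
under eq_bigr do rewrite !permK.
have -> : \sum_(p : 'I_n * 'I_n | (s p.1 < s p.2)%N) (d p.1 - d p.2)
    = \sum_(p : 'I_n * 'I_n | (s p.1 < s p.2)%N) ((ascents p : nat)%:Z - (descents (p.2, p.1) : nat)%:Z).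
  apply: eq_bigr => -[a b] /= lt; rewrite /d /ascents /descents /= lt !andbT; lia.
rewrite big_split/= sumrN; congr (_ - _).
  rewrite -sum_indicator big_mkcond; apply: eq_bigr => -[a b] _ /=.
  by rewrite /ascents /=; case: ltnP => //; rewrite !andbF.
rewrite -sum_indicator (reindex_inj (h := fun p : 'I_n * 'I_n => (p.2, p.1))); last first.
  by move=> [a b] [a' b'] [-> ->].
rewrite big_mkcond; apply: eq_bigr => -[a b] _ /=.
by rewrite /descents /=; case: ltnP => //; rewrite !andbF.
Qed.

(** After division by lambda^(sum_i d_i), the diagonal coefficient at s is
    [cell_count] q^(descents - ascents), which by [cell_count_ge] is at least
    q^descents > 1, whereas e becomes 1 or -1. *)
Lemma cell_eigenvalue_neq (e : C) : e ^+ 2 = (lambda ^ (\sum_i d i)) ^+ 2 ->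
  (0 < #|descents|)%N -> e != (cell_count s ys)%:R * cell_weight s.
Proof.
move=> e2 D0; apply/eqP => ee; have L0 : lambda ^ (\sum_i d i) != 0 by rewrite expfz_neq0.
have := e2; rewrite ee /cell_weight sum_coweight_perm opprB expfzDr// mulrCA exprMn.
rewrite -[RHS]mulr1 => /(mulfI (expf_neq0 2 L0)).
have := cell_count_ge; move: (cell_count s ys) D0 => N; move: (#|descents|) (#|ascents|) => D A D0 NA h.
have {}h : (N%:R * q ^+ D) ^+ 2 = (q ^+ A) ^+ 2 :> C.
  have qA : q ^+ A != 0 by rewrite expf_neq0.
  apply/eqP; rewrite -subr_eq0; apply/eqP.
  have -> : N%:R * q ^+ D = (N%:R * (q ^ D%:Z * q ^ - A%:Z)) * q ^+ A :> C.
    by rewrite -!mulrA -!exprnP -exprnN mulVf ?mulr1.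
  by rewrite exprMn h mul1r subrr.
have {}h : ((N * #|residue K| ^ D) ^ 2 = (#|residue K| ^ A) ^ 2)%N.
  by apply: (natr_inj_pchar0 hC); rewrite !natrX natrM !natrX.
have {}h : (N * #|residue K| ^ D = #|residue K| ^ A)%N by apply/eqP; rewrite -(eqn_exp2r _ _ (e := 2))// h.
have q1 := res_card_gt1 K.
have : (#|residue K| ^ A * #|residue K| ^ D <= #|residue K| ^ A)%N by rewrite -{2}h leq_mul.
rewrite -expnD leq_exp2l//; lia.
Qed.

End Count.
End MinusculeOperator.

Section SocleVector.
Variables (K : localField) (pi : K) (hpi : uniformizer pi) (n : nat) (hn : (0 < n)%N).
Variables (C : fieldType) (hC : [pchar C] =i pred0).
Variables (lambda : C) (hlambda : lambda != 0).
Local Notation G := (GL K n).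
Local Notation Iw := (@Iwahori K n).
Local Notation equivariant := (equivariant lambda).
Local Notation sign_vector := (@sign_vector K n C lambda).
Implicit Types (s t : 'S_n) (g h k b : G).

Lemma rot_eigenvalue_neq0 : rot_eigenvalue n lambda != 0.
Proof. by rewrite mulf_neq0 ?invr_eq0// signr_eq0. Qed.

Lemma rot_eigenvalue_sqr : rot_eigenvalue n lambda ^+ 2 = lambda ^- 2.
Proof. by rewrite exprMn sqrr_sign mul1r exprVn. Qed.

Lemma sign_vector1 : sign_vector 1%g = 1.
Proof.
rewrite -(monomial1 hpi) (sign_vector_monomial hpi hC hlambda) /cell_value odd_perm1 mul1r.
rewrite big1// expr0z mul1r big1 ?oppr0 ?expr0z// => p lt.
by rewrite iw_heightE /iw_height ltnNge (ltnW lt).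
Qed.

Lemma equivariantB (f1 f2 : G -> C) a : equivariant f1 -> equivariant f2 ->
  equivariant (fun g => f1 g - a * f2 g).
Proof.
move=> [i1 b1] [i2 b2]; split=> [g k Ik|b g ub]; first by rewrite (i1 _ _ Ik) (i2 _ _ Ik).
by rewrite b1// b2// mulrBr mulrCA.
Qed.

(** Start from a fixed vector f with f(1) <> 0 and consider f - a sign_vector,
    which vanishes at 1 for a = f(1).  Going through the other cells s in the
    order [precedes], apply T - c where T is the operator of a coweight at a
    descent of s and c its diagonal coefficient at s: this kills the value at s,
    keeps the values already killed, and multiplies sign_vector by a nonzero
    scalar.  In the end a nonzero multiple of sign_vector remains in S. *)
Lemma sign_vector_in (S : set (G -> C)) f g :
  subrepresentation (induced_delta lambda) S -> S f -> f g != 0 -> S sign_vector.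
Proof.
move=> sS Sf fg; have [_ _ SD SR] := sS.
have [f' [Sf' f'E f'1]] : exists f', [/\ S f', equivariant f' & f' 1%g != 0].
  apply: (fixed_vector hpi hC hlambda sS (SR g f Sf)).
  by rewrite /right_translate mul1g.
have svE := sign_vector_equivariant hpi n hC hlambda.
suff main r : (r <= rank (1%g : 'S_n))%N -> exists f a, [/\ S f, equivariant f, a != 0 &
    forall s, (rank (1%g : 'S_n) - r <= rank s)%N -> f (perm_gl K s) - a * sign_vector (perm_gl K s) = 0].
  have [h [a [Sh hE a0 hs]]] := main _ (leqnn _).
  have eh : h = (fun x => a * sign_vector x).
    apply: (equivariant_ext hpi hE) => [|s].
      by split=> [x k Ik|b x ub]; [rewrite (svE.1 _ _ Ik)|rewrite svE.2// mulrCA].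
    by apply/eqP; rewrite -subr_eq0 hs// subnn.
  have := subrepZ a^-1 sS Sh; rewrite eh; congr S; apply/funext => x.
  by rewrite mulrA mulVf// mul1r.
elim: r => [|r IH] lr.
  exists f', (f' 1%g); split=> // s; rewrite subn0 => ls.
  have -> : s = 1%g.
    by apply/eqP/negPn/negP => /one_precedes/precedes_rank; rewrite ltnNge ls.
  by rewrite perm_gl1 sign_vector1 mulr1 subrr.
have [h [a [Sh hE a0 hs]]] := IH (ltnW lr).
have [[s rs]|nex] := pselect (exists s : 'S_n, rank s = (rank (1%g : 'S_n) - r.+1)%N); last first.
  exists h, a; split=> // s ls; apply: hs; have [e|ne] := eqVneq (rank s) (rank (1%g : 'S_n) - r.+1)%N.
    by case: nex; exists s.
  by lia.
have ns1 : s != 1%g by apply/eqP => e; rewrite e in rs; lia.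
have [i [j [ij sji]]] : exists i j : 'I_n, j = i.+1 :> nat /\ (s j < s i)%N.
  apply: contrapT => ne; case/eqP: ns1; apply: perm_le_eq => -[m lm]; rewrite perm1 /=.
  elim: m lm => [//|m IHm] lm; have lm' := ltn_trans (ltnSn m) lm.
  apply: leq_ltn_trans (IHm lm') _; rewrite ltn_neqAle; apply/andP; split.
    by rewrite val_eqE (inj_eq perm_inj) -val_eqE/= ltn_eqF.
  rewrite leqNgt; apply/negP => lt; apply: ne.
  by exists (Ordinal lm'), (Ordinal lm).
pose d := @coweight n j; pose t0 := monomial hpi d 1.
have [ys [rys _ eys]] := sign_vector_eigen hn rot_eigenvalue_neq0
  (sign_vector_refl hpi hC hlambda) (sign_vector_rot hpi hn hC hlambda) d 1%g.
set e := (_ * _) in eys.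
pose cw := (cell_count hpi j s ys)%:R * @cell_weight K n C lambda j s.
pose T (F : G -> C) x := \sum_(y <- ys) F (x * y * t0)%g.
have TE F : equivariant F -> equivariant (T F).
  move=> [FI FB]; split=> [x k Ik|b x ub].
    apply: (sum_coset_reps_mulr (f := fun y => F (y * t0)%g) x (@Iw_subgroup K n) (stab_subgroup _) rys _ Ik).
    move=> y u [_ Iu]; rewrite -[RHS](FI _ _ Iu); congr F.
    by rewrite -/t0; move: (t0) => t; rewrite !mulgA mulgK.
  rewrite /T mulr_sumr; apply: eq_bigr => y _; rewrite -FB//; congr F.
  by move: (t0) => t; rewrite !mulgA.
have TS F : S F -> S (T F).
  move=> SF; apply: (subrep_sum _ sS) => y; have := SR (y * t0)%g F SF; congr S; apply/funext => x.
  by rewrite /right_translate mulgA.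
have e_cw : e != cw.
  apply: (cell_eigenvalue_neq hC hlambda rys (s := s) (e := e)); last first.
    apply/card_gt0P; exists (i, j); rewrite unfold_in /descents /= sji leqnn.
    by rewrite ij ltnSn.
  rewrite /e exprMn -exprM mulnC exprM sqrrN expr1n expr1n mul1r.
  have zsqr (x : C) (N : int) : (x ^ N) ^+ 2 = (x ^+ 2) ^ N by rewrite !exprnP exprzAC.
  by rewrite !zsqr rot_eigenvalue_sqr exprz_inv opprK.
pose a' := (e - cw) * a.
exists (fun x => T h x - cw * h x), a'; split.
- have := SD (- cw) _ _ Sh (TS _ Sh); congr S; apply/funext => x.
  by rewrite mulNr addrC.
- by apply: equivariantB => //; exact: TE.
- by rewrite mulf_neq0// subr_eq0.
move=> t lt; pose psi := (fun x => h x - a * sign_vector x).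
have psiE : equivariant psi by exact: equivariantB.
have Tpsi : T psi (perm_gl K t) = T h (perm_gl K t) - a * (e * sign_vector (perm_gl K t)).
  by rewrite -eys /T mulr_sumr -sumrB.
have lt_rank t' : (rank t < rank t')%N -> psi (perm_gl K t') = 0.
  by move=> lt'; apply: hs; lia.
have Tt : T psi (perm_gl K t) = (cell_count hpi j t ys)%:R * @cell_weight K n C lambda j t * psi (perm_gl K t).
  apply: minuscule_triangular => //; exact: rys.1.
rewrite Tpsi in Tt.
have [ets|nts] := eqVneq t s.
  rewrite ets in Tt *; rewrite -/cw in Tt.
  move: Tt; rewrite /psi /a'; move: (sign_vector _) (T h _) (h _) => x y z E.
  have -> : y = cw * (z - a * x) + a * (e * x) by rewrite -E subrK.
  by ring.
have ht : psi (perm_gl K t) = 0.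
  apply: hs; have : rank t != rank s by rewrite (inj_eq (@rank_inj n)).
  by rewrite rs; lia.
move: Tt ht; rewrite /psi /a'; move: (sign_vector _) (T h _) (h _) => x y z.
move=> E /eqP; rewrite subr_eq0 => /eqP ez; move: E; rewrite ez subrr mulr0 => /eqP.
by rewrite subr_eq0 => /eqP->; ring.
Qed.

End SocleVector.

(** * Multiplicity one *)

Section MultiplicityOne.
Variables (K : localField) (pi : K) (hpi : uniformizer pi) (n : nat) (hn : (0 < n)%N).
Variables (C : fieldType) (hC : [pchar C] =i pred0).
Variables (lambda : C) (hlambda : lambda != 0).
Local Notation v := (@lf_val K).
Local Notation vge := (vge v).
Local Notation G := (GL K n).
Local Notation Iw := (@Iwahori K n).
Local Notation monomial := (monomial hpi).
Local Notation sign_vector := (@sign_vector K n C lambda).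
Implicit Types (s t : 'S_n) (g h k b : G).

(** By the affine Bruhat decomposition, averaging any translate of sign_vector
    over the Iwahori subgroup gives a multiple of sign_vector. *)
Lemma sign_vector_bruhat g : exists ys a, coset_reps Iw (stab g) ys /\
  forall x, \sum_(y <- ys) sign_vector (x * y * g)%g = a * sign_vector x.
Proof.
have [svI _] := sign_vector_equivariant hpi n hC hlambda.
have [k [d [s [k' [Ik Ik' ->]]]]] := affine_bruhat hpi g.
have [ys [rys _ eys]] := sign_vector_eigen hn (rot_eigenvalue_neq0 n hlambda)
  (sign_vector_refl hpi hC hlambda) (sign_vector_rot hpi hn hC hlambda) d s.
move: eys rys; move: (_ * _) (monomial d s) => a w eys rys.
have eS : stab (k * w * k')%g = [set g | stab w (k^-1 * g * k)%g]%classic.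
  have e x : ((k * w * k')^-1 * x * (k * w * k') = k'^-1 * (w^-1 * (k^-1 * x * k) * w) * k')%g.
    by rewrite !invgM !mulgA.
  apply/seteqP; split=> x; rewrite /stab/= e => -[h1 h2]; split.
  - by apply: IwM => //; apply: IwM => //; apply: IwV.
  - have : Iw (k' * (k'^-1 * (w^-1 * (k^-1 * x * k) * w) * k') * k'^-1)%g.
      by apply: IwM; [exact: IwM|exact: IwV].
    by rewrite -!(mulgA k'^-1%g) mulVKg mulgK.
  - have : Iw (k * (k^-1 * x * k) * k^-1)%g by apply: IwM; [exact: IwM|exact: IwV].
    by rewrite -!(mulgA k^-1%g) mulVKg mulgK.
  - by apply: IwM => //; apply: IwM => //; apply: IwV.
exists [seq (k * y * k^-1)%g | y <- ys], a; split.
  by rewrite eS; apply: coset_reps_conj => //; exact: Iw_subgroup.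
move=> x; rewrite big_map -(svI x k Ik) -eys; apply: eq_bigr => y _.
rewrite -[RHS](svI _ _ Ik'); congr sign_vector.
by rewrite !mulgA mulgVK.
Qed.

Lemma entry_bound g : exists B : int, forall i j, vge (- B) (g i j).
Proof.
exists (\sum_i \sum_j `|v (g i j)|) => i j.
right; rewrite lerNl; set B := \sum_(i | _) _; have : `|v (g i j)| <= B.
  rewrite /B (bigD1 i)//= (bigD1 j)//= -addrA lerDl addr_ge0 ?sumr_ge0// => l _.
  by apply: sumr_ge0.
by move=> le; apply: le_trans le; rewrite -normrN ler_norm.
Qed.

Lemma congruence_stab g : exists m, forall M, (m <= M)%N ->
  (congruence M `<=` stab g)%classic.
Proof.
have [B hB] := entry_bound g; have [B' hB'] := entry_bound g^-1%g.
exists (`|B|%N + `|B'|%N).+1 => M lM u [Iu hu]; split=> //.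
apply: (Iw_close (@Iw1 K n)) => i j.
have -> : (g^-1 * u * g)%g i j - (1%g : G) i j
    = \sum_l (\sum_l' (g^-1)%g i l' * (u l' l - (l' == l)%:R)) * g l j.
  rewrite -(mulVg g) !glME -sumrB; apply: eq_bigr => l _.
  rewrite -mulrBl; congr (_ * _); rewrite glME.
  under [in RHS]eq_bigr do rewrite mulrBr.
  rewrite sumrB; congr (_ - _); rewrite (bigD1 l)//= eqxx mulr1 big1 ?addr0// => l' /negPf->.
  by rewrite mulr0.
apply: vge_sum => l _; apply: (vgeMl (m := M%:Z - B')) (hB l j) _; last first.
  by move: lM; rewrite -ltz_nat PoszD !abszE; lia.
by apply: vge_sum => l' _; apply: (vgeMl (hB' i l') (hu l' l)); rewrite addrC.
Qed.

(** The vectors all of whose translates are projected onto multiples of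
    sign_vector by averaging over the Iwahori subgroup form a subrepresentation
    Z, which contains sign_vector; by irreducibility Z = S. *)
Lemma fixed_vector_unique (S : set (G -> C)) f :
  is_steinberg lambda S -> S f -> Iwahori_invariant f ->
  exists a, f = (fun g => a * sign_vector g).
Proof.
move=> [sS [[f0 Sf0 [g0 f0g0]] irr]] Sf fI.
have Ssv : S sign_vector by apply: (sign_vector_in hpi hn hC hlambda sS Sf0 (g := g0)); apply/eqP.
have [svI _] := sign_vector_equivariant hpi n hC hlambda.
have [sub S0 SD SR] := sS.
pose zs M := sval (cid (congruence_reps hpi n M)).
have rz M : coset_reps Iw (@congruence K n M) (zs M) := svalP (cid (congruence_reps hpi n M)).
(* the averages are taken over all small enough congruence subgroups, so that
   this property is stable under sums *)
pose P f := exists m, forall M, (m <= M)%N -> exists a, forall x,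
   \sum_(z <- zs M) f (x * z)%g = a * sign_vector x.
pose Z := [set f | S f /\ forall g, P (right_translate g f)]%classic.
have sZ : subrepresentation S Z.
  split.
  - by move=> h [].
  - split=> // g; exists 0%N => M _; exists 0 => x.
    by rewrite big1 ?mul0r.
  - move=> a f1 f2 [S1 P1] [S2 P2]; split; first exact: SD.
    move=> g; have [m1 h1] := P1 g; have [m2 h2] := P2 g.
    exists (maxn m1 m2) => M; rewrite geq_max => /andP[le1 le2].
    have [a1 e1] := h1 M le1; have [a2 e2] := h2 M le2; exists (a * a1 + a2) => x.
    by rewrite big_split/= -mulr_sumr e1 e2 mulrDl mulrA.
  - move=> h F [SF PF]; split; first exact: SR.
    move=> g; have := PF (g * h)%g; congr P; apply/funext => x.
    by rewrite /right_translate mulgA.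
have Zsv : Z sign_vector.
  split=> // g; have [ys [a [rys eys]]] := sign_vector_bruhat g.
  have [m hm] := congruence_stab g; exists m => M le.
  have inv x u : stab g u -> sign_vector (x * u * g)%g = sign_vector (x * g)%g.
    move=> [_ Iu]; rewrite -[RHS](svI _ _ Iu); congr sign_vector.
    by rewrite !mulgA mulgK.
  have [N eN] := sum_coset_reps_refine C (@Iw_subgroup K n) (stab_subgroup g)
    (@congruence_subgroup K n M) (hm M le) (@stab_sub K n g) rys (rz M).
  exists (a *+ N) => x; rewrite mulrnAl -eys.
  rewrite /right_translate (eN (fun z => sign_vector (x * z * g)%g))// => z u ju.
  by rewrite mulgA; exact: inv.
have svn0 : sign_vector 1%g != 0 by rewrite (sign_vector1 hpi n hC hlambda) oner_neq0.
have ZS : Z = S.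
  have [Z0|//] := irr _ sZ; move: Zsv; rewrite Z0 => /(congr1 (fun F : G -> C => F 1%g))/eqP.
  by rewrite (negPf svn0).
have [_ /(_ 1%g)[m hm]] : Z f by rewrite ZS.
have [a ea] := hm m (leqnn m).
have N0 : (size (zs m))%:R != 0 :> C.
  have /pcharf0P -> := hC; have := (rz m).2 _ (@Iw1 K n); by case: (zs m).
exists (a / (size (zs m))%:R); apply/funext => x.
apply: (mulfI N0); rewrite mulrA mulrCA divff// mulr1 -ea.
rewrite big_seq (eq_bigr (fun=> f x)) => [|z /(rz m).1 Iz].
  by rewrite -big_seq big_const_seq count_predT iter_addr_0 mulr_natl.
by rewrite /right_translate mulg1 (fI _ _ Iz).
Qed.

End MultiplicityOne.

(** * Residues *)

Section Residue.
Variables (K : localField) (pi : K) (hpi : uniformizer pi) (w : K) (hw : integer_unit w).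
Local Notation v := (@lf_val K).
Local Notation vge := (vge v).
Local Notation q := #|residue K|.

Lemma frobeniusD (x y : K) : (x + y) ^+ q = x ^+ q + y ^+ q.
Proof.
apply: exprDn_pchar; have [p pr_p pF] := finPcharP (residue K).
have [k ->] : exists k, q = (p ^ k)%N by have := card_pprimeChar pF; eexists; eassumption.
by rewrite pnatX pnatE// equal_char pF.
Qed.

Lemma frobeniusB k (x y : K) : (x - y) ^+ (q ^ k) = x ^+ (q ^ k) - y ^+ (q ^ k).
Proof.
elim: k x y => [|k IH] x y; first by rewrite !expr1.
have frobB : (x - y) ^+ q = x ^+ q - y ^+ q.
  by apply: (canRL (addrK _)); rewrite -frobeniusD subrK.
by rewrite expnS !exprM frobB IH.
Qed.

Lemma vgeX m k (x : K) : vge m x -> vge (m * k%:Z) (x ^+ k).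
Proof.
move=> hx; elim: k => [|k IH]; first by rewrite mulr0.
by rewrite exprS; apply: (vgeMl hx IH); rewrite -addn1 PoszD; lia.
Qed.

Lemma redX k (x : K) : vge 0 x -> red (x ^+ k) = red x ^+ k :> residue K.
Proof.
move=> hx; elim: k => [|k IH]; first exact: red1.
rewrite !exprS redM// ?IH//.
by have := vgeX k hx; rewrite mul0r.
Qed.

(** The limit of the powers x^(q^k) of a lift x of a; the sequence is Cauchy
    since x -> x^q is additive in equal characteristic. *)
Lemma teichmuller (a : residue K) : exists c : K, [/\ c ^+ q = c, vge 0 c & red c = a].
Proof.
pose u k := digit a ^+ (q ^ k).
have u0 k : vge 0 (u k) by have := vgeX (q ^ k) (digit_int a); rewrite mul0r.
have redu k : red (u k) = a.
  rewrite /u redX// digitK; elim: k => [|k IH]; first exact: expr1.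
  by rewrite expnS exprM expf_card.
have uS k : u k.+1 = u k ^+ q by rewrite /u expnSr exprM.
have step k : vge k%:Z (u k.+1 - u k).
  have -> : u k.+1 - u k = (u 1%N - u 0%N) ^+ (q ^ k).
    by rewrite frobeniusB /u -!exprM expn0 mul1n expn1 expnS.
  have h1 : vge 1 (u 1%N - u 0%N) by apply/red_eq => //; rewrite !redu.
  apply: vge_le (vgeX (q ^ k) h1); rewrite mul1r lez_nat.
  exact: ltnW (ltn_expl _ (res_card_gt1 K)).
have cau i k : vge i%:Z (u (i + k)%N - u i).
  elim: k => [|k IH]; first by rewrite addn0 subrr.
  rewrite addnS -(subrKA (u (i + k)%N)); apply: vgeD => //.
  by apply: vge_le (step _); rewrite lez_nat leq_addr.
have cau2 i j m : (m <= i)%N -> (m <= j)%N -> vge m%:Z (u i - u j).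
  move=> mi mj; rewrite -(subrKA (u m)); apply: vgeD.
    by rewrite -(subnKC mi).
  by rewrite -opprB -(subnKC mj); apply: vgeN.
have [m|l hl] := lf_complete (u := u).
  exists `|m|%N => i j hi hj; apply: vge_le (cau2 i j _ hi hj).
  by rewrite abszE ler_norm.
have l0 : vge 0 l.
  have [N /(_ N (leqnn N)) h] := hl 0; rewrite -(subKr (u N) l).
  exact: vgeB.
exists l; split=> //; last first.
  have [N /(_ N (leqnn N)) h] := hl 1; rewrite -(redu N).
  by apply/esym/red_eq.
apply/eqP; rewrite -subr_eq0; apply/eqP.
have [//|nz] := eqVneq (l ^+ q - l) 0.
have small m : vge m%:Z (l ^+ q - l).
  have [N hN] := hl m%:Z.
  have -> : l ^+ q - l = - (u N - l) ^+ q + (u N.+1 - l).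
    have := frobeniusB 1 (u N) l; rewrite expn1 => ->.
    by rewrite uS opprB addrA subrK.
  apply: vgeD; last exact: hN.
  apply: vgeN; apply: vge_le (vgeX q (hN N (leqnn N))).
  have := res_card_gt1 K; nia.
by have := small (absz (v (l ^+ q - l) + 1)); rewrite vge_neq0//; lia.
Qed.

Lemma teichmuller_val (c : K) : c ^+ q = c -> c != 0 -> v c = 0.
Proof.
move=> e c0; have := congr1 v e; rewrite valX//; have := res_card_gt1 K.
by rewrite -mulr_natr natz => h1 h2; nia.
Qed.

(** Nonzero Teichmueller representatives are units, so that the term of the
    highest pole dominates the others. *)
Lemma polar_part_eq0 m (e : nat -> K) : (forall i, e i ^+ q = e i) ->
  vge 0 (\sum_(i < m) e i * pi ^- i.+1) -> forall i, (i < m)%N -> e i = 0.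
Proof.
move=> he; have [p0 vp] := hpi; elim: m => [//|m IH].
rewrite big_ord_recr/= => hS.
have vterm i : e i != 0 -> v (e i * pi ^- i.+1) = - i.+1%:Z.
  move=> ei; rewrite lf_valM ?invr_eq0 ?expf_neq0// valV ?expf_neq0// valX// vp.
  by rewrite (teichmuller_val (he i) ei) add0r -[1 *+ _]/(i.+1%:R) natz.
have em : e m = 0.
  have [//|em] := eqVneq (e m) 0.
  have : vge (- m%:Z) (e m * pi ^- m.+1).
    rewrite -[_ * _](addKr (\sum_(i < m) e i * pi ^- i.+1)) addrC.
    apply: vgeB; first by apply: vge_le hS; lia.
    apply: vge_sum => i _; have [->|ei] := eqVneq (e i) 0; first by rewrite mul0r.
    by right; rewrite vterm//; have := ltn_ord i; lia.
  by rewrite vge_neq0 ?mulf_neq0 ?invr_eq0 ?expf_neq0// vterm//; lia.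
move=> i; rewrite ltnS leq_eqVlt => /orP[/eqP->//|]; apply: IH.
by move: hS; rewrite em mul0r addr0.
Qed.

(** The coefficient of 1/pi is well defined since two polar parts with
    Teichmueller coefficients differ by another one. *)
Lemma ResE (x c : K) : c ^+ q = c -> vge 0 (x * w - c / pi) -> Res pi w x = red c.
Proof.
move=> hc hx; rewrite /Res; case: xgetP => [a _|]; last first.
  move=> /(_ (red c))[]; exists 0%N, (fun=> c); split=> //.
  by rewrite big_ord1 expr1.
move=> [m [c' [hc' hint ->]]].
pose e i := c' i - (if i is 0%N then c else 0).
have he i : e i ^+ q = e i.
  have := frobeniusB 1 (c' i) (if i is 0%N then c else 0); rewrite expn1 /e => ->.
  rewrite hc'; congr (_ - _); case: i => [|i] //.
  by rewrite expr0n -[q == 0%N]negbK -lt0n (ltnW (res_card_gt1 K)).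
have : vge 0 (\sum_(i < m.+1) e i * pi ^- i.+1).
  have -> : \sum_(i < m.+1) e i * pi ^- i.+1 =
     (x * w - c / pi) - (x * w - \sum_(i < m.+1) c' i * pi ^- i.+1).
    rewrite /e; under eq_bigr do rewrite mulrBl; rewrite sumrB.
    have -> : \sum_(i < m.+1) (if (i : nat) is 0%N then c else 0) * pi ^- i.+1 = c / pi.
      rewrite big_ord_recl big1 ?addr0 ?expr1// => i _.
      by rewrite lift0 mul0r.
    by rewrite opprB addrCA [x * w - _ + _]addrAC subrr add0r.
  exact: vgeB.
by move=> /(polar_part_eq0 he)/(_ 0%N isT)/eqP; rewrite subr_eq0 => /eqP->.
Qed.

Lemma Res_integer x : vge 0 x -> Res pi w x = 0.
Proof.
move=> hx; have q0 : (0 < q)%N := ltnW (res_card_gt1 K).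
rewrite (@ResE x 0) ?red0//; first by rewrite expr0n gtn_eqF.
rewrite mul0r subr0 -[0]addr0; apply: vgeM => //; exact: unit_vge.
Qed.

Lemma Res_onto a : exists x, vge (-1) x /\ Res pi w x = a.
Proof.
have [c [hc c0 <-]] := teichmuller a; have [p0 vp] := hpi; have [w0 vw] := hw.
exists (c / pi / w); split.
  have h1 : vge (-1) pi^-1 by right; rewrite valV// vp.
  have h2 : vge 0 w^-1 by apply/unit_vge/unitV.
  apply: (vgeMl (vgeM c0 h1) h2); lia.
by apply: ResE => //; rewrite divfK// subrr.
Qed.

End Residue.

(** * Whittaker functions *)

Section Whittaker.
Variables (K : localField) (pi : K) (hpi : uniformizer pi) (n : nat) (hn : (0 < n)%N).
Variables (C : fieldType) (hC : [pchar C] =i pred0).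
Variables (lambda : C) (hlambda : lambda != 0).
Variables (psi : residue K -> C) (hpsi : nontrivial_additive_character psi).
Variables (w : K) (hw : integer_unit w).
Local Notation v := (@lf_val K).
Local Notation vge := (vge v).
Local Notation G := (GL K n).
Local Notation Iw := (@Iwahori K n).
Local Notation monomial := (monomial hpi).
Local Notation q := (res_card K C).
Local Notation cell_value := (cell_value K lambda).
Implicit Types (d : 'I_n -> int) (s t : 'S_n) (g h k b : G).

Lemma Psi_elem (i j : 'I_n) x : (i < j)%N ->
  Psi psi pi w (elem i j x : G) = if j == i.+1 :> nat then psi (Res pi w x) else 1.
Proof.
move=> ij; have nij : i != j by rewrite -val_eqE neq_ltn ij.
have e (p : 'I_n * 'I_n) : p.2 == p.1.+1 :> nat ->
    (elem i j x : G) p.1 p.2 = x * ((p.1 == i) && (p.2 == j))%:R.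
  move=> /eqP ep; rewrite elemE// -[p.1 == p.2]val_eqE/= ep ltn_eqF// add0r//.
rewrite /Psi (eq_bigr _ e); case: eqP => [eji|nji].
  rewrite (bigD1 (i, j))/=; last by rewrite eji.
  rewrite !eqxx mulr1 big1 ?addr0// => -[a b] /= /andP[_].
  by rewrite xpair_eqE => /negPf->; rewrite mulr0.
rewrite big1 => [|[a b] /= /eqP ab].
  by rewrite Res_integer//; case: hpsi.
case: eqP => [ea|]; last by rewrite mulr0.
case: eqP => [eb|]; last by rewrite mulr0.
by case: nji; rewrite -ea -eb.
Qed.

(** In terms of alcoves: the dominant chamber translated so as to contain the base
    alcove.  It is an intersection of half-spaces, hence stable under the steps of
    [affine_ind] towards 1. *)
Definition supported d s := forall i j : 'I_n, j = i.+1 :> nat -> 0 <= height d s i j.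

Lemma in_supportP d s : reflect (supported d s) (in_support d s).
Proof.
have e i j (X : int) : (d j - X <= d i) = (0 <= d i - d j + X).
  by rewrite -[LHS]subr_ge0 opprB addrA addrAC.
apply: (iffP forallP) => h i.
  by move=> j ij; have /forallP/(_ j) := h i; rewrite ij eqxx /= e.
by apply/forallP => j; apply/implyP => /eqP /h; rewrite e.
Qed.

Variable W : G -> C.
Hypothesis WPsi : forall u g, unipotent u -> W (u * g)%g = Psi psi pi w u * W g.
Hypothesis WI : Iwahori_invariant W.
Hypothesis WT : forall (i j : 'I_n), j = i.+1 :> nat -> forall g,
  \sum_(x : residue K) W (g * refl_rep i j x * perm_gl K (tperm i j))%g = - W g.
Hypothesis WR : forall g, W (g * rotation hpi n)%g = rot_eigenvalue n lambda * W g.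

(** Outside of the support, Psi is nontrivial on a root subgroup of the
    stabilizer of the coset. *)
Lemma whittaker_zero d s : ~~ in_support d s -> W (monomial d s) = 0.
Proof.
move=> nS; have [i [j [ij hij]]] : exists i j : 'I_n, j = i.+1 :> nat /\ height d s i j < 0.
  apply: contrapT => ne; case/in_supportP: nS => i j ij; rewrite leNgt; apply/negP => lt.
  by apply: ne; exists i, j.
have lij : (i < j)%N by rewrite ij.
have nij : i != j by rewrite -val_eqE neq_ltn lij.
have [_ _ [a psia]] := hpsi; have [x [hx xa]] := Res_onto hpi hw a.
have ux := unipotent_elem x lij.
have Iu : Iw ((monomial d s)^-1 * elem i j x * monomial d s)%g.
  apply/monomial_conj_Iw; split=> [b c|b]; rewrite elemE//; last first.
    rewrite eqxx; case: eqP => [->|]; last by rewrite mulr0 addr0; move=> _; exact: unit1.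
    by rewrite (negPf nij) mulr0 addr0; exact: unit1.
  apply: vgeD.
    have [->|_] := eqVneq b c; last exact: vge0.
    by rewrite /height subrr ltnn.
  have [/andP[/eqP-> /eqP->]|_] := boolP (_ && _); last by rewrite mulr0.
  by rewrite mulr1; apply: vge_le hx; lia.
have := WI (monomial d s) Iu.
have -> : (monomial d s * ((monomial d s)^-1 * elem i j x * monomial d s) = elem i j x * monomial d s)%g.
  by move: (monomial d s) => m; rewrite !mulgA mulgV mul1g.
rewrite WPsi// Psi_elem// ij eqxx xa => e.
have /eqP : (psi a - 1) * W (monomial d s) = 0 by rewrite mulrBl e mul1r subrr.
by rewrite mulf_eq0 subr_eq0 => /orP[/eqP|/eqP].
Qed.

(** On the support, the q terms of the Hecke equation at w agree, because Psi is
    trivial on the root subgroup of w (i, j) w^-1. *)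
Lemma whittaker_step d s (i j : 'I_n) : j = i.+1 :> nat -> (s i < s j)%N ->
  supported d s -> W (monomial d s) = - q * W (monomial d (tperm i j * s)%g).
Proof.
move=> ij lt hS; have nij : i != j by rewrite -val_eqE/= ij neq_ltn ltnSn.
apply: oppr_inj; rewrite -(WT ij) (eq_bigr (fun=> W (monomial d (tperm i j * s)%g))).
  by rewrite sumr_const -mulr_natl mulNr opprK.
move=> x _; rewrite monomial_conj_elem// -mulgA monomial_perm WPsi; last exact: unipotent_elem.
rewrite Psi_elem//; case: eqP => [e|_]; last by rewrite mul1r.
rewrite Res_integer ?mul1r//.
  by case: hpsi => -> _ _; rewrite mul1r.
have := hS _ _ e; rewrite /height !permK ij ltnNge leqnSn addr0 => h.
by apply: (vgeMl (uniformizer_vge _ hpi) (digit_int x)); rewrite addr0.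
Qed.

(** A descent crosses no wall of the support. *)
Lemma supported_step d s (i j : 'I_n) : j = i.+1 :> nat ->
  height d s (s i) (s j) < iw_height (s i) (s j) ->
  supported d s -> supported d (tperm i j * s)%g.
Proof.
move=> ij desc hS a b ab; rewrite height_step//; have := hS a b ab.
have sij : s i != s j by rewrite (inj_eq perm_inj) -val_eqE/= ij neq_ltn ltnSn.
have [/andP[/eqP ea /eqP eb]|_] := boolP ((a == s j) && (b == s i)); last by lia.
have := height_sym d s sij; rewrite -ea -eb => e.
have lab : (b < a)%N = false by rewrite ab ltnNge leqnSn.
move: desc; rewrite /iw_height -ea -eb ab ltnSn /= => desc.
by case: (_ && _) => /=; lia.
Qed.

(** On the support, W and [cell_value] satisfy the same equations along the steps
    of [affine_ind]. *)
Lemma whittaker_formula d s :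
  W (monomial d s) = if in_support d s then cell_value d s * W 1%g else 0.
Proof.
have q0 : q != 0 := res_card_neq0 K hC.
case: ifPn => [/in_supportP|]; last exact: whittaker_zero.
move: d s; apply: affine_ind => //.
- move=> _; rewrite -(sign_vector_monomial hpi hC hlambda) monomial1.
  by rewrite (sign_vector1 hpi n hC hlambda) mul1r.
- move=> d s; have -> : supported (rot_shift d s) (rot_perm n * s)%g = supported d s.
    by rewrite /supported height_rot.
  rewrite -monomial_rot WR cell_value_rot//.
  have c0 := rot_eigenvalue_neq0 n hlambda.
  split=> h hS; first by rewrite h// mulrA.
  by apply: (mulfI c0); rewrite h ?mulrA.
move=> d s i j ij desc IH hS.
have hS' := supported_step ij desc hS; have {}IH := IH hS'.
have e : (tperm i j * (tperm i j * s))%g = s by rewrite mulgA tperm2 mul1g.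
have sij : s i != s j :> nat.
  by rewrite val_eqE (inj_eq perm_inj) -val_eqE/= ij neq_ltn ltnSn.
case: (ltngtP (s i) (s j)) sij => // [lt|gt] _.
  rewrite (whittaker_step ij lt hS) IH (cell_value_step K hC lambda d ij lt).
  by rewrite !mulrA mulrNN divff// mul1r.
have lt : ((tperm i j * s)%g i < (tperm i j * s)%g j)%N by rewrite !permM tpermL tpermR.
have := whittaker_step ij lt hS'; rewrite e => e1.
have := cell_value_step K hC lambda d ij lt; rewrite e => ->.
by rewrite -mulrA -IH e1 mulrA mulrNN mulVf// mul1r.
Qed.

End Whittaker.

(** * Volumes *)

Section Volume.
Variables (K : localField) (pi : K) (hpi : uniformizer pi) (n : nat) (hn : (0 < n)%N).
Local Notation v := (@lf_val K).
Local Notation vge := (vge v).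
Local Notation G := (GL K n).
Local Notation Iw := (@Iwahori K n).
Local Notation monomial := (monomial hpi).
Implicit Types (g h k b : G).

Lemma openE_gl (A : set G) : open A = gl_open A. Proof. by []. Qed.

Lemma Iw_open : open Iw.
Proof. by rewrite openE_gl => g Ig; exists 1 => h; exact: Iw_close. Qed.

Lemma mul_open_preimage (x : G) (A : set G) : open A -> open [set g | A (x * g)%g]%classic.
Proof.
rewrite !openE_gl => oA g /oA[m hm]; have [B hB] := entry_bound x.
exists (m + B) => h hh; apply: hm => i j; rewrite !glME -sumrB.
apply: vge_sum => l _; rewrite -mulrBr; apply: (vgeMl (hB i l) (hh l j)).
by rewrite addrC addrK.
Qed.

Lemma image_mulE (x : G) (A : set G) :
  [set (x * a)%g | a in A]%classic = [set g | A (x^-1 * g)%g]%classic.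
Proof.
apply/seteqP; split=> [_ [a Aa <-]|g Ag] /=; first by rewrite mulKg.
by exists (x^-1 * g)%g => //; rewrite mulVKg.
Qed.

Lemma translate_open (x : G) (A : set G) : open A -> open [set g | A (x^-1 * g)%g]%classic.
Proof. exact: mul_open_preimage. Qed.

Lemma translate_compact (x : G) (A : set G) :
  compact A -> compact [set g | A (x^-1 * g)%g]%classic.
Proof.
move=> cA; rewrite -image_mulE; apply: continuous_compact => //.
apply: continuous_subspaceT; apply/continuousP => B oB.
exact: mul_open_preimage.
Qed.

Lemma ultra_coset (F : set_system G) (A : set G) (ys : seq G) : UltraFilter F ->
  F [set g | exists2 y, y \in ys & A (y^-1 * g)%g]%classic ->
  exists2 y, y \in ys & F [set g | A (y^-1 * g)%g]%classic.
Proof.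
move=> uF; elim: ys => [|y ys IH] h.
  have : F set0 by apply: filterS h => g [].
  by move/filter_ex => [].
have [Fy|Fy] := in_ultra_setVsetC [set g | A (y^-1 * g)%g]%classic uF.
  by exists y => //; rewrite mem_head.
have [|z zy Fz] := IH.
  apply: filterS (filterI h Fy) => g [[z]]; rewrite inE => /orP[/eqP->//|zy Az _].
  by exists z.
by exists z => //; rewrite inE zy orbT.
Qed.

(** An ultrafilter on the Iwahori subgroup contains one coset of each
    congruence subgroup; their representatives converge by completeness. *)
Lemma Iw_compact : compact Iw.
Proof.
rewrite compact_ultra => F uF FI.
have exz M : exists z, Iw z /\ F [set g | congruence M (z^-1 * g)%g]%classic.
  have [zs [hz cz]] := congruence_reps hpi n M.
  have [|z zz Fz] := @ultra_coset F (@congruence K n M) zs uF.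
    apply: filterS FI => g Ig; have : has (fun y => `[< congruence M (y^-1 * g)%g >]) zs.
      by rewrite has_count cz.
    by move=> /hasP[y yz /asboolP cy]; exists y.
  by exists z; split=> //; exact: hz.
pose z M := sval (cid (exz M)).
have Iz M : Iw (z M) by have [] := svalP (cid (exz M)).
have Fz M : F [set g | congruence M ((z M)^-1 * g)%g]%classic by have [] := svalP (cid (exz M)).
have near M g : congruence M ((z M)^-1 * g)%g -> Iw g /\ forall i j, vge M%:Z (g i j - z M i j).
  move=> cg; have Ig : Iw g.
    by rewrite -[g](mulVKg (z M)); apply: IwM => //; case: cg.
  by split=> //; apply/(congruence_close M (Iz M) Ig).
have cau M M' i j : (M <= M')%N -> vge M%:Z (z M' i j - z M i j).
  move=> le; have [g [/near[_ h1] /near[_ h2]]] := filter_ex (filterI (Fz M) (Fz M')).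
  rewrite -(subrKA (g i j)) addrC; apply: vgeD => //.
  rewrite -opprB; apply: vgeN; apply: vge_le (h2 i j).
  by rewrite lez_nat.
have lim i j : exists l, forall M, vge M%:Z (l - z M i j).
  have [m|l hl] := lf_complete (u := fun M => z M i j).
    exists `|m|%N => a b ha hb; have mm : m <= `|m|%N%:Z by rewrite abszE ler_norm.
    apply: vge_le mm _; rewrite -(subrKA (z `|m|%N i j)); apply: vgeD; first exact: cau.
    by rewrite -opprB; apply: vgeN; exact: cau.
  exists l => M; have [N hN] := hl M%:Z.
  rewrite -(subrKA (z (maxn M N) i j)); apply: vgeD; last by apply: cau; rewrite leq_maxl.
  by rewrite -opprB; apply: vgeN; apply: hN; rewrite leq_maxr.
pose l : 'M[K]_n := \matrix_(i, j) sval (cid (lim i j)).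
have lE i j M : vge M%:Z (l i j - z M i j).
  by rewrite mxE; exact: (svalP (cid (lim i j))).
have bl : bounded (@iw_height n) l.
  have [b1 b2] := (IwP _).1 (Iz 1%N); split=> [i j|i]; last exact: unitD (b2 i) (lE i i 1%N).
  rewrite -(subrK (z 1%N i j) (l i j)); apply: vgeD => //; apply: vge_le (lE i j 1%N).
  by rewrite /iw_height; case: ltnP.
have [el Il] := Iw_toGL bl; exists (toGL l); split=> // A.
rewrite nbhsE => -[B [oB Bl] BA]; have [m hm] := oB _ Bl.
apply: filterS (Fz `|m|%N) => g /near[_ hg]; apply/BA/hm => i j; rewrite el.
have mm : m <= `|m|%N%:Z by rewrite abszE ler_norm.
apply: vge_le mm _; rewrite -(subrKA (z `|m|%N i j)); apply: vgeD => //.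
by rewrite -opprB; apply: vgeN.
Qed.

Variables (C : closedFieldType) (vol : set G -> C) (hvol : is_normalized_haar vol).

Lemma vol_cosets (x : seq G) :
  (forall g, count (fun y => `[< Iw (y^-1 * g)%g >]) x <= 1)%N ->
  let U := [set g | exists2 y, y \in x & Iw (y^-1 * g)%g]%classic in
  [/\ compact U, open U & vol U = (size x)%:R].
Proof.
have [volD volM vol1] := hvol.
have e0 : [set g : G | exists2 y, y \in [::] & Iw (y^-1 * g)%g]%classic = set0.
  by apply/seteqP; split=> // g [].
elim: x => [|y x IH] h /=.
  rewrite e0; split; [exact: compact0|exact: open0|].
  have := volD set0 set0 compact0 open0 compact0 open0 (setI0 _); rewrite setU0.
  by move/eqP; rewrite -subr_eq0 opprD addrA subrr sub0r oppr_eq0 => /eqP.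
have hx g : (count (fun y => `[< Iw (y^-1 * g)%g >]) x <= 1)%N.
  by apply: leq_trans (h g); rewrite /= leq_addl.
have [cU oU vU] := IH hx; set U := [set _ | _]%classic in cU oU vU.
have -> : [set g | exists2 y0, y0 \in y :: x & Iw (y0^-1 * g)%g]%classic
    = ([set g | Iw (y^-1 * g)%g] `|` U)%classic.
  apply/seteqP; split=> g /=.
    by move=> [z]; rewrite inE => /orP[/eqP->|zx Iz]; [left|right; exists z].
  by move=> [Ig|[z zx Iz]]; [exists y; rewrite ?mem_head|exists z; rewrite ?inE ?zx ?orbT].
have cy := translate_compact (x := y) Iw_compact; have oy := translate_open (x := y) Iw_open.
split; [exact: compactU|exact: openU|].
rewrite volD//.
  by rewrite -image_mulE volM ?vol1 ?vU; [rewrite -natr1 addrC|exact: Iw_compact|exact: Iw_open].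
apply/seteqP; split=> // g [Ig [z zx Iz]].
have := h g; rewrite /= (asboolT Ig) add1n ltnS leqNgt -has_count => /negP; apply.
by apply/hasP; exists z => //; apply/asboolP.
Qed.

(** The double coset of w is the disjoint union of the y w Iw. *)
Lemma vol_double_coset w ys : coset_reps Iw (stab w) ys ->
  vol (Iwahori_double_coset w) = (size ys)%:R.
Proof.
move=> [hy cy]; have gI := @Iw_subgroup K n.
have [|_ _] := @vol_cosets [seq (y * w)%g | y <- ys].
  move=> g; rewrite count_map.
  have [/hasP[y yy /asboolP Iy]|] := boolP (has (preim (fun y => y * w)%g (fun y => `[< Iw (y^-1 * g)%g >])) ys); last first.
    by rewrite has_count -leqNgt => /leq_trans; apply.
  set P := (X in count X ys); rewrite -(cy y (hy y yy)).
  rewrite (@eq_in_count _ _ (predI P (mem ys))) => [|z zy]; last by rewrite /= zy andbT.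
  apply: sub_count => z /andP[/asboolP Iz /= zy]; apply/asboolP.
  split; first by apply: IwM; [apply: IwV|]; exact: hy.
  have -> : (w^-1 * (z^-1 * y) * w = (z * w)^-1 * g * ((y * w)^-1 * g)^-1)%g.
    by rewrite !invgM !invgK !mulgA mulgK.
  by apply: IwM => //; exact: IwV.
rewrite size_map => <-; congr vol; apply/seteqP; split=> g.
  move=> [a [b [Ia Ib ->]]]; have : has (fun y => `[< stab w (y^-1 * a)%g >]) ys.
    by rewrite has_count cy.
  move=> /hasP[y yy /asboolP[_ Iy]]; exists (y * w)%g; first exact: map_f.
  have -> : ((y * w)^-1 * (a * w * b) = w^-1 * (y^-1 * a) * w * b)%g by rewrite invgM !mulgA.
  exact: IwM.
move=> [z /mapP[y yy ->] Iz]; exists y, ((y * w)^-1 * g)%g; split=> //; first exact: hy.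
by rewrite mulVKg.
Qed.

End Volume.

(** * The Iwahori-fixed Whittaker function *)

Section Transport.
Variables (K : localField) (n : nat) (C : fieldType).
Local Notation G := (GL K n).
Variables (V S : set (G -> C)) (Phi : (G -> C) -> (G -> C)).
Hypothesis sS : subrepresentation V S.
Hypothesis PhiD : forall a f1 f2, S f1 -> S f2 ->
  Phi (fun g => a * f1 g + f2 g) = (fun g => a * Phi f1 g + Phi f2 g).

Lemma transport0 : Phi (fun=> 0) = (fun=> 0).
Proof.
have [_ S0 _ _] := sS; have := PhiD (-1) S0 S0.
rewrite (_ : (fun g : G => -1 * 0 + 0) = (fun=> 0)); last first.
  by apply/funext => g; rewrite mulr0 addr0.
by move=> ->; apply/funext => g; rewrite mulN1r addNr.
Qed.

Lemma transportZ a f : S f -> Phi (fun g => a * f g) = (fun g => a * Phi f g).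
Proof.
move=> Sf; have [_ S0 _ _] := sS; have := PhiD a Sf S0.
rewrite transport0 (_ : (fun g => a * f g + 0) = (fun g => a * f g)).
  by move=> ->; apply/funext => g; rewrite addr0.
by apply/funext => g; rewrite addr0.
Qed.

Lemma transport_sum (I : Type) (r : seq I) (f : I -> G -> C) : (forall i, S (f i)) ->
  Phi (fun g => \sum_(i <- r) f i g) = (fun g => \sum_(i <- r) Phi (f i) g).
Proof.
move=> Sf; elim: r => [|i r IH].
  rewrite (_ : (fun _ => _) = (fun=> 0)); last by apply/funext => g; rewrite big_nil.
  by rewrite transport0; apply/funext => g; rewrite big_nil.
rewrite (_ : (fun _ => _) = (fun g => 1 * f i g + \sum_(j <- r) f j g)); last first.
  by apply/funext => g; rewrite big_cons mul1r.
rewrite PhiD//; last exact: (subrep_sum _ sS).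
by rewrite IH; apply/funext => g; rewrite big_cons mul1r.
Qed.

End Transport.

Lemma sum_height (n : nat) (d : 'I_n -> int) (s : 'S_n) :
  \sum_(p : 'I_n * 'I_n | (p.1 < p.2)%N) height d s p.1 p.2
  = \sum_(p : 'I_n * 'I_n | (p.1 < p.2)%N) (d p.1 - d p.2) + (len (fun=> 0) s)%:Z.
Proof.
rewrite /len (big_morph Posz PoszD (erefl _)) -big_split/=.
by apply: eq_bigr => p _; rewrite /height; congr (_ + _); case: (_ < _)%N.
Qed.

Theorem proposition1p2
    (K : localField) (pi : K) (hpi : uniformizer pi)
    (n : nat) (hn : (0 < n)%N)
    (* more generally than for the algebraic closure of Q_l *)
    (C : closedFieldType) (hC : [pchar C] =i pred0)
    (lambda : C) (hlambda : lambda != 0)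
    (psi : residue K -> C) (hpsi : nontrivial_additive_character psi)
    (* omega = w d(pi) *)
    (w : K) (hw : integer_unit w)
    (vol : set (GL K n) -> C) (hvol : is_normalized_haar vol)
    (St : set (GL K n -> C)) (hSt : is_steinberg lambda St)
    (Wh : set (GL K n -> C)) (hWh : is_whittaker_model psi pi w St Wh) :
  exists W : GL K n -> C,
    unique (fun f => [/\ Wh f, Iwahori_invariant f & f 1%g = 1]) W /\
    forall (d : 'I_n -> int) (s : 'S_n),
      W (diag_pi hpi d * perm_gl K s)%g =
        if in_support d s then
          (-1) ^+ s * lambda ^ (\sum_i d i) /
          (res_card K C ^ (\sum_(p : 'I_n * 'I_n | (p.1 < p.2)%N) (d p.1 - d p.2)) *
           vol (Iwahori_double_coset (perm_gl K s)))
        else 0.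
Proof.
have q0 : res_card K C != 0 := res_card_neq0 K hC.
have [sS [[f0 Sf0 [g0 f0g0]] _]] := hSt.
pose phi := @sign_vector K n C lambda.
have Sphi : St phi by apply: (sign_vector_in hpi hn hC hlambda sS Sf0 (g := g0)); apply/eqP.
have phi1 : phi 1%g = 1 := sign_vector1 hpi n hC hlambda.
have [phiI _] := sign_vector_equivariant hpi n hC hlambda.
have [sWh [Phi [[PhiS Phi_inj Phi_surj] PhiD PhiR]]] := hWh.
have [_ _ _ SR] := sS; have [WhPsi _ _ _] := sWh.
pose W0 := Phi phi.
have WhW0 : Wh W0 by exact: PhiS.
have transl h g : W0 (g * h)%g = Phi (right_translate h phi) g by rewrite PhiR.
have W0I : Iwahori_invariant W0.
  move=> g k Ik; rewrite transl; congr (Phi _ g); apply/funext => x.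
  exact: phiI.
have W0T (i j : 'I_n) : j = i.+1 :> nat -> forall g,
    \sum_(x : residue K) W0 (g * refl_rep i j x * perm_gl K (tperm i j))%g = - W0 g.
  move=> ij g; under eq_bigr do rewrite -mulgA transl.
  have := transport_sum sS PhiD (index_enum (residue K))
    (f := fun x => right_translate (refl_rep i j x * perm_gl K (tperm i j))%g phi)
    (fun x => SR _ _ Sphi).
  move=> /(congr1 (fun F : GL K n -> C => F g)) <-.
  rewrite (_ : (fun _ => _) = (fun g => -1 * phi g)); last first.
    apply/funext => y; rewrite mulN1r -(sign_vector_refl hpi hC hlambda ij).
    by apply: eq_bigr => x _; rewrite /right_translate mulgA.
  by rewrite (transportZ sS PhiD)// mulN1r.
have W0R g : W0 (g * rotation hpi n)%g = rot_eigenvalue n lambda * W0 g.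
  rewrite transl (_ : right_translate _ _ = (fun g => rot_eigenvalue n lambda * phi g)).
    by rewrite (transportZ sS PhiD).
  apply/funext => y; exact: (sign_vector_rot hpi hn hC hlambda).
have W0Psi u g : unipotent u -> W0 (u * g)%g = Psi psi pi w u * W0 g.
  by have [_] := WhPsi _ WhW0; apply.
have formula := whittaker_formula hn hC hlambda hpsi hw W0Psi W0I W0T W0R.
have W01 : W0 1%g != 0.
  apply/eqP => z; have W00 : W0 = (fun=> 0).
    apply/funext => g; have [u [d [s [k [uu Ik ->]]]]] := iwasawa hpi g.
    rewrite (W0I _ _ Ik) W0Psi// formula z mulr0.
    by case: ifP; rewrite mulr0.
  have [_ S0 _ _] := sS.
  have : phi = (fun=> 0).
    by apply: Phi_inj; rewrite ?inE// (transport0 sS PhiD).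
  by move/(congr1 (fun F : GL K n -> C => F 1%g))/eqP; rewrite phi1 oner_eq0.
pose W g := (W0 1%g)^-1 * W0 g.
have WhW : Wh W by exact: (subrepZ _ sWh).
have WI : Iwahori_invariant W by move=> g k Ik; rewrite /W (W0I _ _ Ik).
exists W; split; [split|].
- by split=> //; rewrite /W mulVf.
- move=> f [Whf fI f1]; have [f' Sf' ef'] := Phi_surj f Whf.
  have f'I : Iwahori_invariant f'.
    move=> g k Ik; suff : right_translate k f' = f' by move/(congr1 (fun F : GL K n -> C => F g)).
    apply: Phi_inj; rewrite ?inE//; first exact: SR.
    by rewrite PhiR// ef'; apply/funext => x; exact: fI.
  have [a ea] := fixed_vector_unique hpi hn hC hlambda hSt Sf' f'I.
  have ef : f = (fun g => a * W0 g) by rewrite -ef' ea (transportZ sS PhiD).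
  apply/funext => g; rewrite /W ef; congr (_ * _).
  by apply: (mulIf W01); rewrite mulVf// -f1 ef.
move=> d s; rewrite /W -[(diag_pi _ _ * _)%g]/(monomial hpi d s) formula.
case: ifP => _; last by rewrite mulr0.
rewrite mulrCA mulVf// mulr1.
have [//||ys [rys sys _]] := @sign_vector_eigen K pi hpi n hn C (fun=> 0) 1 (oner_neq0 _) _ _ (fun=> 0) s.
- by move=> i j _ g; rewrite big1 ?oppr0.
- by move=> g; rewrite mulr0.
rewrite -(perm_monomial hpi) in rys.
rewrite (vol_double_coset hpi hvol rys) sys natrX /cell_value sum_height opprD expfzDr//.
by rewrite invfM invr_expz exprnN.
Qed.
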